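(* Let $(M,\tau)$ be a separable abelian tracial von Neumann algebra with set of minimal projections $P$. Then for any weakly dense finitely generated unital $*$-subalgebra $A\subset M$ one has \[ \sigma(A,\tau)=1-\sum_{p\in P}\tau(p)^2. \]
   Context: A tracial von Neumann algebra $(M,\tau)$ is a finite von Neumann algebra $M$ with a faithful normal tracial state $\tau$. $M^\circ$ is the opposite algebra with trace $\tau^\circ$, and $M\bar\otimes M^\circ$ carries the trace $\tau\otimes\tau^\circ$. For a unital $*$-subalgebra $A\subset M$, $L^2(A\otimes A^\circ,\tau\otimes\tau^\circ)$ is the closure of $A\otimes A^\circ$ in $L^2(M\bar\otimes M^\circ,\tau\otimes\tau^\circ)$ and $(A\otimes A^\circ)''$ is the von Neumann algebra generated by $A\otimes A^\circ$. This Hilbert space is an $A$-$A$ bimodule via $x\cdot\xi\cdot y=(x\otimes y^\circ)\xi$, and has the commuting right action of $(A\otimes A^\circ)''$ by right multiplication. A derivation is a linear map $\delta\colon A\to L^2(A\otimes A^\circ,\tau\otimes\tau^\circ)$ with $\delta(xy)=x\cdot\delta(y)+\delta(x)\cdot y$. Finitely generated means generated as a unital $*$-algebra by a finite set. $\mathrm{Der}_{1\otimes1}(A,\tau)$ is the space of derivations $\delta$ such that $1\otimes1\in\mathrm{dom}(\delta^* )$, where $\delta$ is viewed as a densely defined operator $L^2(A,\tau)\to L^2(A\otimes A^\circ,\tau\otimes\tau^\circ)$. If $X=X^*$ is a finite generating set of $A$, then $\phi_X(\delta)=(\delta(x))_{x\in X}$ is an injective right $(A\otimes A^\circ)''$-linear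 map with closed range from the space of all derivations on $A$ into $L^2(A\otimes A^\circ,\tau\otimes\tau^\circ)^X$, giving the norm $\|\delta\|_X=(\sum_{x\in X}\|\delta(x)\|^2)^{1/2}$; the topology is independent of $X$, and closures are taken in it. The free Stein dimension is \[\sigma(A,\tau)=\dim\overline{\mathrm{Der}_{1\otimes1}(A,\tau)}_{(A\otimes A^\circ)''},\] the von Neumann dimension (with respect to $\tau\otimes\tau^\circ$) of the right Hilbert $(A\otimes A^\circ)''$-module $\phi_X\big(\overline{\mathrm{Der}_{1\otimes1}(A,\tau)}\big)\subset L^2(A\otimes A^\circ,\tau\otimes\tau^\circ)^X$; it does not depend on $X$. *)

(* Defs.v *)
From HB Require Import structures.
From mathcomp Require Import all_boot all_order all_algebra.
From mathcomp Require Import complex.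
From mathcomp Require Import all_classical all_reals all_analysis.

Set Implicit Arguments.
Unset Strict Implicit.
Unset Printing Implicit Defensive.

Import Order.TTheory GRing.Theory Num.Theory.
Import numFieldNormedType.Exports.

Local Open Scope classical_set_scope.
Local Open Scope ring_scope.
Local Open Scope complex_scope.

(* Complex Hilbert spaces; the inner product is linear in its first argument. *)
Structure hilbertType (R : realType) := Hilbert {
  hilbert_sort :> completeNormedModType R[i];
  hdot : {dot hilbert_sort for Num.conj};
  hdotE : forall x, hdot x x = `|x| ^+ 2 }.

Arguments hdot {R} h.
Notation dot := (hdot _).

Section Operators.
Context {R : realType} {H : hilbertType R}.

(* Operators are plain functions, whose algebra structure is pointwise
   addition and scaling together with composition. *)
Definition bounded_op (T : H -> H) := linear T /\ continuous T.

Definition is_adjoint (T S : H -> H) := forall x y, dot (T x) y = dot x (S y).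

Definition adj (T : H -> H) : H -> H := xget 0 [set S | is_adjoint T S].

Record unital_star_alg (A : set (H -> H)) : Prop := {
  star_alg_id : A id;
  star_alg_lin : forall (c : R[i]) S T, A S -> A T -> A (c *: S + T);
  star_alg_comp : forall S T, A S -> A T -> A (S \o T);
  star_alg_adj : forall T, A T -> is_adjoint T (adj T) /\ A (adj T) }.

Definition commutant (A : set (H -> H)) : set (H -> H) :=
  [set T | bounded_op T /\ forall S, A S -> T \o S = S \o T].

Record von_neumann_alg (M : set (H -> H)) : Prop := {
  vna_star_alg : unital_star_alg M;
  vna_bounded : forall T, M T -> bounded_op T;
  vna_bicommutant : commutant (commutant M) = M }.

Definition abelian_alg (M : set (H -> H)) :=
  forall S T, M S -> M T -> S \o T = T \o S.

(* Normality is ultraweak continuity: tau is the restriction to M of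
   T |-> \sum_n <T xi_n, eta_n> with xi, eta in l^2(nat, H). *)
Definition normal_functional (M : set (H -> H)) (tau : (H -> H) -> R[i]) :=
  exists xi eta : nat -> H,
    [/\ cvgn (series (fun n => `|xi n| ^+ 2)),
        cvgn (series (fun n => `|eta n| ^+ 2)) &
        forall T, M T ->
          series (fun n => dot (T (xi n)) (eta n)) @ \oo --> (tau T : R[i]^o)].

(* tau is only ever used on M.  Finiteness of M as a von Neumann algebra follows
   from the existence of a faithful normal tracial state. *)
Record tracial_vna (M : set (H -> H)) (tau : (H -> H) -> R[i]) : Prop := {
  tvna_vna : von_neumann_alg M;
  tvna_linear : forall (c : R[i]) S T, M S -> M T ->
    tau (c *: S + T) = c * tau S + tau T;
  tvna_unital : tau id = 1;
  tvna_positive : forall T, M T -> 0 <= tau (adj T \o T);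
  tvna_faithful : forall T, M T -> tau (adj T \o T) = 0 -> T = 0;
  tvna_tracial : forall S T, M S -> M T -> tau (S \o T) = tau (T \o S);
  tvna_normal : normal_functional M tau }.

Definition norm2 (tau : (H -> H) -> R[i]) (T : H -> H) : R[i] :=
  sqrtC (tau (adj T \o T)).

(* For a tracial (M, tau), separability means separability of L^2(M, tau), i.e.
   of M for the 2-norm. *)
Definition separable_tracial (M : set (H -> H)) (tau : (H -> H) -> R[i]) :=
  exists d : nat -> H -> H, (forall n, M (d n)) /\
    forall T, M T -> forall e : R[i], 0 < e -> exists n, norm2 tau (T - d n) < e.

Definition projection (M : set (H -> H)) (p : H -> H) :=
  [/\ M p, p \o p = p & is_adjoint p p].

Definition minimal_projections (M : set (H -> H)) : set (H -> H) :=
  [set p | [/\ projection M p, p != 0 &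
    forall q, projection M q -> p \o q = q -> q = 0 \/ q = p]].

(* Density in the weak operator topology. *)
Definition weakly_dense (A M : set (H -> H)) :=
  A `<=` M /\
  forall T, M T -> forall (m : nat) (xi eta : 'I_m -> H) (e : R[i]), 0 < e ->
    exists2 S, A S & forall i, `|dot ((T - S) (xi i)) (eta i)| < e.

Definition generates (n : nat) (X : 'I_n -> H -> H) (A : set (H -> H)) :=
  smallest unital_star_alg (range X) = A.

(* X enumerates, without repetition, a finite set with X = X^*. *)
Definition self_adjoint_family (n : nat) (X : 'I_n -> H -> H) :=
  injective X /\ forall i, exists j, X j = adj (X i).

End Operators.

Section L2Tensor.
Context {R : realType} {H K : hilbertType R}.
Implicit Types (M A : set (H -> H)) (tau : (H -> H) -> R[i]).
Implicit Types (pi : (H -> H) -> (H -> H) -> K -> K) (Om : K).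

Definition tensor_vectors A pi Om : set K :=
  [set v | exists m (a b : 'I_m -> H -> H),
    [/\ forall i, A (a i), forall i, A (b i) &
        v = \sum_(i < m) pi (a i) (b i) Om]].

(* (K, pi, Om) is the GNS triple of tau (x) tau^o on the algebraic tensor product
   of M and M^o: K is L^2(M (x) M^o, tau (x) tau^o), pi x y is left multiplication
   by x (x) y^o and Om is the vector 1 (x) 1.  Such a triple is unique up to a
   unitary.  The order of composition is reversed in the second variable. *)
Record is_L2_tensor M tau pi Om : Prop := {
  L2_bounded : forall x y, M x -> M y -> bounded_op (pi x y);
  L2_linearl : forall (c : R[i]) x x' y, M x -> M x' -> M y ->
    pi (c *: x + x') y = c *: pi x y + pi x' y;
  L2_linearr : forall (c : R[i]) x y y', M x -> M y -> M y' ->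
    pi x (c *: y + y') = c *: pi x y + pi x y';
  L2_unital : pi id id = id;
  L2_mul : forall x y a b, M x -> M y -> M a -> M b ->
    pi x y \o pi a b = pi (x \o a) (b \o y);
  L2_adj : forall x y, M x -> M y -> is_adjoint (pi x y) (pi (adj x) (adj y));
  L2_trace : forall x y, M x -> M y -> dot (pi x y Om) Om = tau x * tau y;
  L2_cyclic : closure (tensor_vectors M pi Om) = setT }.

(* L^2(A (x) A^o, tau (x) tau^o) *)
Definition L2_alg A pi Om : set K := closure (tensor_vectors A pi Om).

(* Only the values of delta on A matter; x . xi . y is pi x y xi. *)
Record derivation A pi Om (delta : (H -> H) -> K) : Prop := {
  der_range : forall x, A x -> L2_alg A pi Om (delta x);
  der_linear : forall (c : R[i]) x y, A x -> A y ->
    delta (c *: x + y) = c *: delta x + delta y;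
  der_leibniz : forall x y, A x -> A y ->
    delta (x \o y) = pi x id (delta y) + pi id y (delta x) }.

(* Om lies in dom(delta^* ) iff x |-> <delta x, Om> is bounded on A for the norm
   of L^2(A, tau). *)
Definition Der_1x1 A tau pi Om : set ((H -> H) -> K) :=
  [set delta | derivation A pi Om delta /\
    exists C : R[i], forall x, A x -> `|dot (delta x) Om| <= C * norm2 tau x].

Definition normX (n : nat) (X : 'I_n -> H -> H) (delta : (H -> H) -> K) : R[i] :=
  sqrtC (\sum_(i < n) `|delta (X i)| ^+ 2).

(* Closure of Der_{1 (x) 1} in the space of all derivations. *)
Definition Der_1x1_closure A tau pi Om (n : nat) (X : 'I_n -> H -> H) :
    set ((H -> H) -> K) :=
  [set delta | derivation A pi Om delta /\
    forall e : R[i], 0 < e -> exists2 delta', Der_1x1 A tau pi Om delta' &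
      normX X (delta - delta') < e].

Definition phiX (n : nat) (X : 'I_n -> H -> H) (delta : (H -> H) -> K) :
    'I_n -> K := fun i => delta (X i).

(* Orthogonal projection of K^n onto a closed subspace V. *)
Definition orth_proj (n : nat) (V : set ('I_n -> K)) (xi : 'I_n -> K) :
    'I_n -> K :=
  xget 0 [set eta | V eta /\
    forall v, V v -> \sum_(i < n) dot (xi i - eta i) (v i) = 0].

Definition orth_proj_entry (n : nat) (V : set ('I_n -> K)) (i j : 'I_n) :
    K -> K :=
  fun xi => orth_proj V (fun k => if k == j then xi else 0) i.

(* Let N be a von Neumann algebra with trace T |-> <T Om, Om> acting on
   L^2(N) = closure (N Om), such as (A (x) A^o)'' on L2_alg A pi Om.  If V is a
   closed right N-submodule of L^2(N)^n, the projection onto V commutes with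
   the right action, so its matrix entries lie in N, and the von Neumann
   dimension of V is the (non-normalized) trace of this matrix. *)
Definition vN_dim Om (n : nat) (V : set ('I_n -> K)) : R :=
  complex.Re (\sum_(i < n) dot (orth_proj_entry V i i Om) Om).

(* sigma(A, tau), computed with the generating family X. *)
Definition free_stein_dim A tau pi Om (n : nat) (X : 'I_n -> H -> H) : R :=
  vN_dim Om (phiX X @` Der_1x1_closure A tau pi Om X).

End L2Tensor.

(* Main.v *)
Require Import Defs.
From HB Require Import structures.
From mathcomp Require Import all_boot all_order all_algebra.
From mathcomp Require Import complex.
From mathcomp Require Import all_classical all_reals all_analysis.
From mathcomp Require Import ring lra.

(* An element f of L^2(A (x) A^o) gives the inner derivation x |-> [x, f], for which
   1 (x) 1 is in the domain of the adjoint.  If delta is any derivation, the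
   commutativity of A gives [x, delta y] = [y, delta x], and therefore the component
   of (delta X_i)_i orthogonal to the inner derivations is diagonal, that is,
   annihilated by all the [x, -].  Diagonal vectors live on the p (x) p for p a
   minimal projection, because the rest of 1 (x) 1 is cut by partitions of unity into
   arbitrarily small pieces q (x) q.  If moreover 1 (x) 1 is in the domain of delta^*,
   then p delta(x) p = 0 for p minimal: if x p = 0, the contractions c = 1 + i x - x^2
   have c^k / k -> 0 whereas delta (c^k / k) converges to e delta(c) e, with e the
   projection onto ker x, which contains p.  So the closure of Der_{1 (x) 1} is the
   closure of the inner derivations, i.e. of the range of T f = ([X_i, f])_i, and as
   everything commutes its dimension is <(1 - E) 1 (x) 1, 1 (x) 1>, where E is the
   projection onto ker T, the diagonal vectors. *)

Set Implicit Arguments.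
Unset Strict Implicit.
Unset Printing Implicit Defensive.

Import Order.TTheory GRing.Theory Num.Theory.
Import numFieldNormedType.Exports.

Local Open Scope classical_set_scope.
Local Open Scope ring_scope.
Local Open Scope complex_scope.

(** * Real inner products and convergence in Hilbert spaces *)

(** Commutation alone does not give p delta(x) p = 0. Compressed to p (x) p, a derivation becomes a
    point derivation of A at the character by which A acts on the range of p, and a polynomial
    algebra has one at every point, namely f |-> f'(t). Only the bound expressing that 1 (x) 1 is in
    the domain of the adjoint excludes these. It is tested on elements whose 2-norm stays bounded
    while their derivative at the point grows like k: powers of a contraction c with c = 1 and dc/dx
    nonzero at x = 0. A real polynomial in x that is at most 1 near 0 and equals 1 at 0 is critical
    there, whence the imaginary coefficient in c. The projections onto kernels in M, onto ker T and
    onto the closure of the range of T are strong limits of powers of positive contractions. The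
    last two come from 1 - s T^*T and 1 - s T T^* with the same s, and comparing their powers turns
    the trace of the matrix of the range projection into one inner product with 1 (x) 1. *)

Section HilbertSpace.
Context {R : realType} {H : hilbertType R}.
Implicit Types (x y z : H) (c : R[i]) (r : R).

(** Hilbert space identities are checked on the real part of the inner product, where they become
    real polynomial identities for [ring] and [lra]; [dotE] recovers the complex product. *)
Definition rdot x y : R := complex.Re (hdot H x y).
Definition nr x : R := complex.Re `|x|.

Lemma ReD (c d : R[i]) : complex.Re (c + d) = complex.Re c + complex.Re d.
Proof. by case: c; case: d. Qed.

Lemma ReN (c : R[i]) : complex.Re (- c) = - complex.Re c.
Proof. by case: c. Qed.

Lemma ReM_real r c : complex.Re (r%:C * c) = r * complex.Re c.
Proof. by case: c => a b; simpc. Qed.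

Lemma Re_conj c : complex.Re (Num.conj c) = complex.Re c.
Proof. by case: c. Qed.

Lemma Re_sum I (s : seq I) (P : pred I) (F : I -> R[i]) :
  complex.Re (\sum_(i <- s | P i) F i) = \sum_(i <- s | P i) complex.Re (F i).
Proof. by apply: (big_morph _ ReD). Qed.

Lemma Re_le_norm c : `|complex.Re c| <= complex.Re `|c|.
Proof. by have := normc_ge_Re c; rewrite normc_def lecR. Qed.

Lemma nrE x : `|x| = (nr x)%:C.
Proof.
have : 0 <= `|x| := normr_ge0 _.
by rewrite /nr; case: `|x| => a b /=; rewrite lecE /= => /andP[/eqP-> _].
Qed.

Lemma nr_ge0 x : 0 <= nr x.
Proof. by have := normr_ge0 x; rewrite nrE ler0c. Qed.

Lemma nr0 : nr 0 = 0.
Proof. by rewrite /nr normr0. Qed.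

Lemma nr0_eq0 x : nr x = 0 -> x = 0.
Proof. by move=> x0; apply/normr0_eq0; rewrite nrE x0. Qed.

Lemma nrD x y : nr (x + y) <= nr x + nr y.
Proof. by have := ler_normD x y; rewrite !nrE -rmorphD lecR. Qed.

Lemma nrN x : nr (- x) = nr x.
Proof. by rewrite /nr normrN. Qed.

Lemma nrB x y : nr (x - y) <= nr x + nr y.
Proof. by rewrite -(nrN y) nrD. Qed.

Lemma nrBC x y : nr (x - y) = nr (y - x).
Proof. by rewrite -nrN opprB. Qed.

Lemma nr_split z x y : nr (x - y) <= nr (x - z) + nr (z - y).
Proof. by rewrite -{1}(subrK z x) -addrA nrD. Qed.

Lemma nr_dist x y : `|nr x - nr y| <= nr (x - y).
Proof.
have := nrD (x - y) y; have := nrD (y - x) x; rewrite !subrK (nrBC y) => h1 h2.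
by rewrite ler_norml; apply/andP; split; lra.
Qed.

Lemma nrZ c x : nr (c *: x) = complex.Re `|c| * nr x.
Proof.
by rewrite /nr normrZ [in LHS]normc_def ReM_real [in RHS]normc_def.
Qed.

Lemma nrZr r x : nr (r%:C *: x) = `|r| * nr x.
Proof. by rewrite nrZ normc_def /= expr0n addr0 sqrtr_sqr. Qed.

Lemma rdotDl x y z : rdot (x + y) z = rdot x z + rdot y z.
Proof. by rewrite /rdot linearDl ReD. Qed.

Lemma rdotNl x z : rdot (- x) z = - rdot x z.
Proof. by rewrite /rdot linearNl ReN. Qed.

Lemma rdotC x y : rdot x y = rdot y x.
Proof. by rewrite /rdot hermitian_subproof expr0 mul1r Re_conj. Qed.

Lemma rdotDr x y z : rdot z (x + y) = rdot z x + rdot z y.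
Proof. by rewrite rdotC rdotDl !(rdotC z). Qed.

Lemma rdotNr x z : rdot z (- x) = - rdot z x.
Proof. by rewrite rdotC rdotNl rdotC. Qed.

Lemma rdotBl x y z : rdot (x - y) z = rdot x z - rdot y z.
Proof. by rewrite rdotDl rdotNl. Qed.

Lemma rdotBr x y z : rdot z (x - y) = rdot z x - rdot z y.
Proof. by rewrite rdotDr rdotNr. Qed.

Lemma rdotZl r x y : rdot (r%:C *: x) y = r * rdot x y.
Proof. by rewrite /rdot linearZl_LR ReM_real. Qed.

Lemma rdotZr r x y : rdot x (r%:C *: y) = r * rdot x y.
Proof. by rewrite rdotC rdotZl rdotC. Qed.

Lemma rdot0l x : rdot 0 x = 0.
Proof. by rewrite /rdot linear0l. Qed.

Lemma rdot0r x : rdot x 0 = 0.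
Proof. by rewrite rdotC rdot0l. Qed.

Lemma rdot_suml I (s : seq I) (P : pred I) (F : I -> H) z :
  rdot (\sum_(i <- s | P i) F i) z = \sum_(i <- s | P i) rdot (F i) z.
Proof.
by elim/big_ind2 : _ => [|? ? ? ? <- <-|//]; rewrite ?rdot0l ?rdotDl.
Qed.

Lemma rdot_sumr I (s : seq I) (P : pred I) (F : I -> H) z :
  rdot z (\sum_(i <- s | P i) F i) = \sum_(i <- s | P i) rdot z (F i).
Proof. by rewrite rdotC rdot_suml; apply: eq_bigr => i _; rewrite rdotC. Qed.

Lemma rdotxx x : rdot x x = nr x ^+ 2.
Proof. by rewrite /rdot hdotE nrE -rmorphXn. Qed.

Lemma dotC x y : hdot H x y = Num.conj (hdot H y x).
Proof. by rewrite hermitian_subproof expr0 mul1r. Qed.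

Lemma dotDl x y z : hdot H (x + y) z = hdot H x z + hdot H y z.
Proof. exact: linearDl. Qed.

Lemma dotDr x y z : hdot H z (x + y) = hdot H z x + hdot H z y.
Proof. exact: linearDr. Qed.

Lemma dotZl c x y : hdot H (c *: x) y = c * hdot H x y.
Proof. by rewrite linearZl_LR. Qed.

Lemma dotZr c x y : hdot H x (c *: y) = Num.conj c * hdot H x y.
Proof. by rewrite dotC dotZl rmorphM (dotC x). Qed.

Lemma rdotZi x y : rdot ('i *: x) ('i *: y) = rdot x y.
Proof.
rewrite /rdot dotZl dotZr mulrA -normCK.
by rewrite normc_def /= expr0n expr1n add0r sqrtr1 expr1n mul1r.
Qed.

Lemma rdotiC x y : rdot ('i *: x) y = - rdot x ('i *: y).
Proof. by rewrite -rdotZi (scalerA 'i 'i) -expr2 sqr_i scaleN1r rdotNl. Qed.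

Lemma dotE x y : hdot H x y = rdot x y +i* rdot x ('i *: y).
Proof.
rewrite /rdot dotZr.
by case: (hdot H x y) => a b /=; simpc.
Qed.

Lemma rdot_le x y : rdot x y <= nr x * nr y.
Proof.
have sq_ge0 (t s : R) :
    0 <= t ^+ 2 * nr x ^+ 2 - 2 * t * s * rdot x y + s ^+ 2 * nr y ^+ 2.
  have := sqr_ge0 (nr (t%:C *: x - s%:C *: y)).
  rewrite -[X in 0 <= X -> _]rdotxx rdotBl !rdotBr !rdotZl !rdotZr !rdotxx (rdotC y x).
  by move=> h; lra.
have [->|y0] := eqVneq y 0; first by rewrite rdot0r nr0 mulr0.
have [->|x0] := eqVneq x 0; first by rewrite rdot0l nr0 mul0r.
have yp : 0 < nr y.
  by rewrite lt_def nr_ge0 andbT; apply: contra_neq y0 => /nr0_eq0.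
have xp : 0 < nr x.
  by rewrite lt_def nr_ge0 andbT; apply: contra_neq x0 => /nr0_eq0.
rewrite -(@ler_pM2l _ (2 * nr x * nr y)) ?mulr_gt0 //.
by have h := sq_ge0 (nr y) (nr x); lra.
Qed.

Lemma rdot_abs_le x y : `|rdot x y| <= nr x * nr y.
Proof.
rewrite ler_norml rdot_le andbT lerNl -rdotNl.
by apply: le_trans (rdot_le _ _) _; rewrite nrN.
Qed.

(* Multiplying x by a phase makes the complex inner product real. *)
Lemma dot_abs_le x y : `|hdot H x y| <= (nr x * nr y)%:C.
Proof.
have [->|d0] := eqVneq (hdot H x y) 0.
  by rewrite normr0 ler0c mulr_ge0 ?nr_ge0.
pose c := Num.conj (hdot H x y) / `|hdot H x y|.
have c1 : `|c| = 1.
  by rewrite normrM norm_conjC normfV normr_id divff // normr_eq0.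
have cE : hdot H (c *: x) y = `|hdot H x y|.
  rewrite dotZl /c -mulrA mulrC -mulrA mulrC -normCK.
  by rewrite expr2 mulfK // normr_eq0.
have := rdot_le (c *: x) y; rewrite /rdot cE nrZ c1 mul1r -lecR.
by rewrite RRe_real // normr_real.
Qed.

Lemma rdot_inj x y : (forall z, rdot x z = rdot y z) -> x = y.
Proof.
move=> h; apply/eqP; rewrite -subr_eq0; apply/eqP/nr0_eq0/eqP.
by rewrite -sqrf_eq0 -rdotxx rdotBl h subrr.
Qed.

Lemma nr_sqrD x y : nr (x + y) ^+ 2 = nr x ^+ 2 + 2 * rdot x y + nr y ^+ 2.
Proof. by rewrite -!rdotxx rdotDl !rdotDr (rdotC y x); ring. Qed.

Lemma nr_sqrB x y : nr (x - y) ^+ 2 = nr x ^+ 2 - 2 * rdot x y + nr y ^+ 2.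
Proof. by rewrite -!rdotxx rdotBl !rdotBr (rdotC y x); ring. Qed.

Lemma nr_le_sqr x y : (nr x <= nr y) = (nr x ^+ 2 <= nr y ^+ 2).
Proof. by rewrite ler_sqr // nnegrE nr_ge0. Qed.

Definition hcv (u : nat -> H) (l : H) := (fun k => nr (u k - l)) @ \oo --> (0 : R).

Lemma hcvP u l : hcv u l <->
  forall e : R, 0 < e -> exists N, forall k, (N <= k)%N -> nr (u k - l) < e.
Proof.
split => [/cvgrPdist_lt h e /h[N _ hN]|h].
  exists N => k /hN /=; rewrite sub0r normrN ger0_norm //; exact: nr_ge0.
apply/cvgrPdist_lt => e /h[N hN]; exists N => // k /hN /=.
by rewrite sub0r normrN ger0_norm // nr_ge0.
Qed.

Lemma hcv_le u l (b : nat -> R) :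
  (forall k, nr (u k - l) <= b k) -> b @ \oo --> (0 : R) -> hcv u l.
Proof.
move=> h b0; apply: (squeeze_cvgr _ (cvg_cst 0) b0).
by apply: nearW => k; rewrite nr_ge0 h.
Qed.

Lemma hcv_cst l : hcv (fun=> l) l.
Proof. by rewrite /hcv subrr nr0; apply: cvg_cst. Qed.

Lemma hcvD u v l m : hcv u l -> hcv v m -> hcv (fun k => u k + v k) (l + m).
Proof.
move=> hu hv; apply: (@hcv_le _ _ (fun k => nr (u k - l) + nr (v k - m))).
  by move=> k; rewrite opprD addrACA nrD.
by rewrite -[X in _ --> X](addr0 0); apply: cvgD.
Qed.

Lemma hcvZ c u l : hcv u l -> hcv (fun k => c *: u k) (c *: l).
Proof.
move=> hu; apply: (@hcv_le _ _ (fun k => complex.Re `|c| * nr (u k - l))).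
  by move=> k; rewrite -scalerBr nrZ.
by rewrite -[X in _ --> X](mulr0 (complex.Re `|c|)); apply: cvgM => //; apply: cvg_cst.
Qed.

Lemma hcvB u v l m : hcv u l -> hcv v m -> hcv (fun k => u k - v k) (l - m).
Proof.
move=> hu hv; apply: (hcvD hu); rewrite -scaleN1r.
rewrite (_ : (fun k => - v k) = (fun k => -1 *: v k)); first exact: hcvZ.
by apply/funext => k; rewrite scaleN1r.
Qed.

Lemma hcv_shift u l m : hcv u l -> hcv (fun k => u (k + m)%N) l.
Proof.
move=> /hcvP h; apply/hcvP => e /h[N hN]; exists N => k Nk.
by apply: hN; rewrite (leq_trans Nk) // leq_addr.
Qed.

Lemma hcv_rdot u l y : hcv u l -> (fun k => rdot (u k) y) @ \oo --> rdot l y.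
Proof.
move=> hu; apply/cvgrPdist_lt => e e0.
have /cvgrPdist_lt/(_ e e0) : (fun k => nr (u k - l) * nr y) @ \oo --> (0 : R).
  by rewrite -[X in _ --> X](mul0r (nr y)); apply: cvgM => //; apply: cvg_cst.
apply: filterS => k; rewrite sub0r normrN ger0_norm ?mulr_ge0 ?nr_ge0 //.
by apply: le_lt_trans; rewrite distrC -rdotBl rdot_abs_le.
Qed.

Lemma hcv_nr u l : hcv u l -> (fun k => nr (u k)) @ \oo --> nr l.
Proof.
move=> hu; apply/cvgrPdist_lt => e e0.
have /cvgrPdist_lt/(_ e e0) := hu.
apply: filterS => k; rewrite sub0r normrN ger0_norm ?nr_ge0 //.
by apply: le_lt_trans; rewrite nrBC nr_dist.
Qed.

Lemma hcv_uniq u l m : hcv u l -> hcv u m -> l = m.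
Proof.
move=> hl hm; apply/eqP; rewrite -subr_eq0; apply/eqP/nr0_eq0.
have /hcv_nr : hcv (fun k => u k - u k) (m - l) by apply: hcvB.
under eq_fun do rewrite subrr nr0.
by rewrite nrBC => /cvg_lim <- //; rewrite lim_cst.
Qed.

Lemma hcv_le_nr u l r : hcv u l -> (forall k, nr (u k) <= r) -> nr l <= r.
Proof.
move=> /hcv_nr h hr; rewrite -(cvg_lim _ h) //.
by apply: limr_le; [apply/cvg_ex; exists (nr l) | apply: nearW].
Qed.

Lemma pos_complexE (e : R[i]) : 0 < e -> 0 < complex.Re e /\ e = (complex.Re e)%:C.
Proof.
by case: e => a b; rewrite ltcE /= => /andP[/eqP-> a0].
Qed.

Lemma hcv_cvg (u : nat -> H) l : hcv u l <-> u @ \oo --> l.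
Proof.
split => [/hcvP h|h]; last first.
  apply/hcvP => e e0; have e0' : 0 < e%:C by rewrite ltcR.
  have /cvgrPdist_lt/(_ _ e0')[N _ hN] := h.
  by exists N => k /hN; rewrite /= nrE ltcR nrBC.
apply/cvgrPdist_lt => e /pos_complexE[e0 ->]; have [N hN] := h _ e0.
by exists N => // k /hN; rewrite /= nrE ltcR nrBC.
Qed.

Lemma hcv_complete (u : nat -> H) :
  (forall e : R, 0 < e -> exists N, forall k l, (N <= k)%N -> (N <= l)%N ->
     nr (u k - u l) < e) -> exists l, hcv u l.
Proof.
move=> h; suff : cvg (u @ \oo) by move=> /cvg_ex[l hl]; exists l; apply/hcv_cvg.
apply/cauchy_cvgP/cauchy_exP => e /pos_complexE[e0 ->].
have [N hN] := h _ e0; exists (u N); exists N => // k Nk /=.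
by rewrite -ball_normE /= nrE ltcR hN.
Qed.

(** [b] decreases and is bounded below, hence is Cauchy, and so is [u]. Powers of a positive
    contraction and decreasing projections both converge strongly by this criterion. *)
Lemma hcv_monotone (u : nat -> H) (b : nat -> R) :
  (forall k, 0 <= b k) ->
  (forall k l, (k <= l)%N -> nr (u k - u l) ^+ 2 <= b k - b l) ->
  exists l, hcv u l.
Proof.
move=> b0 h.
have ndb : nonincreasing_seq b.
  by move=> k l kl; rewrite -subr_ge0 (le_trans _ (h _ _ kl)) // sqr_ge0.
have : cvgn b.
  by apply: nonincreasing_is_cvgn => //; exists 0 => _ [k _ <-].
move=> /cvg_ex[l hl]; apply: hcv_complete => e e0.
have e2 : 0 < e ^+ 2 / 2 by rewrite divr_gt0 ?exprn_gt0.
have /cvgrPdist_lt/(_ _ e2)[N _ hN] := hl.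
exists N => k m Nk Nm.
wlog km : k m Nk Nm / (k <= m)%N.
  move=> W; have [/W|/ltnW/W] := leqP k m; first exact.
  by rewrite nrBC; apply.
rewrite -ltr_sqr ?nnegrE ?nr_ge0 ?ltW //.
apply: le_lt_trans (h _ _ km) _.
have := hN _ Nk; have := hN _ Nm; rewrite /= !ltr_norml => /andP[? ?] /andP[? ?].
lra.
Qed.

End HilbertSpace.

Lemma cvgn_sum (R : realType) I (s : seq I) (F : I -> nat -> R) (l : I -> R) :
  (forall i, F i @ \oo --> l i) ->
  (fun k => \sum_(i <- s) F i k) @ \oo --> \sum_(i <- s) l i.
Proof.
move=> h; elim: s => [|i s IH].
  by rewrite big_nil; under eq_fun do rewrite big_nil; apply: cvg_cst.
rewrite big_cons; under eq_fun do rewrite big_cons.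
by apply: cvgD.
Qed.

Section LinearOperators.
Context {R : realType} {H : hilbertType R}.
Implicit Types (T S : H -> H) (u v : H) (c r : R).

Lemma linD T u v : linear T -> T (u + v) = T u + T v.
Proof. by move=> lT; have := lT 1 u v; rewrite !scale1r. Qed.

Lemma lin0 T : linear T -> T 0 = 0.
Proof.
by move=> lT; have /eqP := linD 0 0 lT; rewrite addr0 -subr_eq subrr eq_sym => /eqP.
Qed.

Lemma linZ T (a : R[i]) u : linear T -> T (a *: u) = a *: T u.
Proof. by move=> lT; have := lT a u 0; rewrite (lin0 lT) !addr0. Qed.

Lemma linN T u : linear T -> T (- u) = - T u.
Proof. by move=> lT; rewrite -scaleN1r linZ // scaleN1r. Qed.

Lemma linB T u v : linear T -> T (u - v) = T u - T v.
Proof. by move=> lT; rewrite linD // linN. Qed.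

Lemma lin_sum T I (s : seq I) (P : pred I) (F : I -> H) : linear T ->
  T (\sum_(i <- s | P i) F i) = \sum_(i <- s | P i) T (F i).
Proof.
move=> lT; elim/big_ind2 : _ => [|x y z t <- <-|//]; first exact: lin0.
by rewrite linD.
Qed.

Definition nr_bounded c T := forall v, nr (T v) <= c * nr v.

Lemma bounded_op_linear T : bounded_op T -> linear T. Proof. by case. Qed.

Lemma bounded_op_nr T : bounded_op T -> exists2 c, 0 < c & nr_bounded c T.
Proof.
move=> [lT cT].
pose T' : {linear H -> H} := HB.pack T (GRing.isLinear.Build _ _ _ _ T lT).
have /linear_boundedP : bounded_near T' (nbhs 0).
  by apply/continuous_linear_bounded; exact: cT.
move=> [y [yreal fr]].
pose r := (`|complex.Re y| + 1).
exists r => [|v]; first by rewrite ltr_wpDl.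
have /(_ r%:C _ v) := fr; rewrite /= !nrE -rmorphM lecR; apply.
rewrite -(RRe_real yreal) ltcR; apply: le_lt_trans (ler_norm _) _.
by rewrite ltrDl.
Qed.

Lemma nr_bounded_op T c : linear T -> nr_bounded c T -> bounded_op T.
Proof.
move=> lT bT; split => //.
pose T' : {linear H -> H} := HB.pack T (GRing.isLinear.Build _ _ _ _ T lT).
have : bounded_near T' (nbhs 0).
  apply/linear_boundedP; exists c%:C; split; first by rewrite complex_real.
  move=> y cy v; rewrite !nrE /=.
  have [y0 ->] : 0 < y - c%:C /\ y = (complex.Re y)%:C.
    split; first by rewrite subr_gt0.
    by move: cy; case: (y) => a b; rewrite ltcE /= => /andP[/eqP->].
  rewrite -rmorphM lecR; apply: le_trans (bT v) _.
  rewrite ler_wpM2r ?nr_ge0 //; move: cy; rewrite ltcE => /andP[_ /=]; exact: ltW.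
by move/linear_bounded_continuous.
Qed.

Lemma hcv_op T (x : nat -> H) l : bounded_op T -> hcv x l -> hcv (T \o x) (T l).
Proof.
move=> bT xl; have lT := bounded_op_linear bT.
have [c c0 hc] := bounded_op_nr bT.
apply: (@hcv_le _ _ _ _ (fun k => c * nr (x k - l))).
  by move=> k; rewrite /= -linB.
by rewrite -[X in _ --> X](mulr0 c); apply: cvgM => //; apply: cvg_cst.
Qed.

End LinearOperators.

(** * Powers of a positive contraction *)

Section PositiveContraction.
Context {R : realType} {H : hilbertType R} {n : nat}.
Implicit Types (u v w z : 'I_n -> H).

Definition ip u v : R := \sum_i rdot (u i) (v i).

Lemma ipC u v : ip u v = ip v u.
Proof. by apply: eq_bigr => i _; rewrite rdotC. Qed.

Lemma ipBl u v z : ip (fun i => u i - v i) z = ip u z - ip v z.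
Proof. by rewrite /ip -sumrB; apply: eq_bigr => i _; rewrite rdotBl. Qed.

Lemma ipBr u v z : ip z (fun i => u i - v i) = ip z u - ip z v.
Proof. by rewrite ipC ipBl !(ipC z). Qed.

Lemma ip_ge0 u : 0 <= ip u u.
Proof. by apply: sumr_ge0 => i _; rewrite rdotxx sqr_ge0. Qed.

Lemma nr_le_ip u i : nr (u i) ^+ 2 <= ip u u.
Proof.
rewrite /ip (bigD1 i) //= rdotxx lerDl.
by apply: sumr_ge0 => j _; rewrite rdotxx sqr_ge0.
Qed.

(** For a symmetric [C] the condition [Ccon], that is C^2 <= C, expresses 0 <= C <= 1. Tuples are
    allowed because the iteration is run both on a single space and on K^n. *)
Variable C : ('I_n -> H) -> 'I_n -> H.
Hypothesis CB : forall u v, C (fun i => u i - v i) = (fun i => C u i - C v i).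
Hypothesis Csym : forall u v, ip (C u) v = ip u (C v).
Hypothesis Ccon : forall u, ip (C u) (C u) <= ip (C u) u.

Let Cle u : ip (C u) u <= ip u u.
Proof.
have := ip_ge0 (fun i => u i - C u i).
by rewrite ipBl !ipBr (ipC u (C u)) => h; have := Ccon u; lra.
Qed.

Let iterip u k l : ip (iter k C u) (iter l C u) = ip (iter (k + l) C u) u.
Proof.
by elim: l k => [|l IH] k; rewrite ?addn0 //= -Csym -iterS IH addSnnS.
Qed.

(** Consecutive moments compare by parity: from 2m to 2m+1 by C <= 1, from 2m+1 to 2m+2 by C^2 <= C,
    both tested on C^m u. *)
Let iter_dec u k l : (k <= l)%N -> ip (iter l C u) u <= ip (iter k C u) u.
Proof.
elim: l => [|l IH]; first by rewrite leqn0 => /eqP ->.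
rewrite leq_eqVlt => /predU1P[-> //|]; rewrite ltnS => /IH; apply: le_trans.
rewrite -(odd_double_half l) -addnn; set m := l./2.
case: (odd l); rewrite ?add0n ?add1n.
  have := Ccon (iter m C u); rewrite -iterS !iterip.
  by rewrite addSn addnS.
have := Cle (iter m C u); rewrite -iterS !iterip.
by rewrite addSn.
Qed.

(** With the moments a_m = <C^m u, u> one has |C^k u - C^l u|^2 = a_2k - 2 a_(k+l) + a_2l <= a_2k -
    a_2l for k <= l, so [hcv_monotone] applies. Against a fixed z the pairing <C^k u, z> does not
    depend on k, so the limit is the orthogonal projection of u onto the fixed vectors. *)
Lemma iter_cvg_fixed u : exists w,
  [/\ forall i, hcv (fun k => iter k C u i) (w i), C w = w &
      forall z, C z = z -> ip (fun i => u i - w i) z = 0].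
Proof.
pose a m := ip (iter m C u) u.
have cvgi i : exists l, hcv (fun k => iter k C u i) l.
  apply: (@hcv_monotone _ _ _ (fun k => a (k + k)%N)).
    by move=> k; rewrite /a -iterip ip_ge0.
  move=> k l kl.
  apply: le_trans (nr_le_ip (fun i => iter k C u i - iter l C u i) i) _.
  rewrite ipBl !ipBr (ipC (iter l C u)) !iterip -/(a _) -/(a (k + l)%N) -/(a (l + l)%N).
  have : a (l + l)%N <= a (k + l)%N by apply: iter_dec; rewrite leq_add2r.
  lra.
have [w hw] := choice cvgi; exists w; split => //.
  apply/funext => i; apply/esym.
  apply: (@hcv_uniq _ _ (fun k => iter (k + 1) C u i)); first exact: (hcv_shift 1 (hw i)).
  pose s k := \sum_j nr (iter k C u j - w j) ^+ 2.
  have s0 : s @ \oo --> (0 : R).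
    rewrite -[X in _ --> X](_ : \sum_(j < n) (0 : R) = 0); last exact: big1.
    apply: cvgn_sum => j; rewrite -[X in _ --> X](mulr0 (0 : R)).
    by under eq_fun do rewrite expr2; apply: cvgM; apply: hw.
  apply/hcvP => e e0.
  have e2 : 0 < e ^+ 2 by rewrite exprn_gt0.
  have /cvgrPdist_lt/(_ _ e2)[N _ hN] := s0; exists N => k /hN /=.
  rewrite sub0r normrN ger0_norm; last by apply: sumr_ge0 => j _; rewrite sqr_ge0.
  move=> sk; rewrite -ltr_sqr ?nnegrE ?nr_ge0 ?ltW //; apply: le_lt_trans sk.
  rewrite addn1 /= -[C _ i - C w i]/((fun i => C (iter k C u) i - C w i) i) -CB.
  apply: le_trans (nr_le_ip _ _) _; apply: le_trans (Ccon _) _; apply: le_trans (Cle _) _.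
  by rewrite /ip /s le_eqVlt; apply/orP; left; apply/eqP; apply: eq_bigr => j _; rewrite rdotxx.
move=> z Cz.
have iz k : ip (iter k C u) z = ip u z.
  by elim: k => //= k <-; rewrite Csym Cz.
rewrite ipBl; apply/eqP; rewrite subr_eq0; apply/eqP.
have : (fun k => ip (iter k C u) z) @ \oo --> ip w z.
  by apply: cvgn_sum => i; apply: hcv_rdot.
under eq_fun do rewrite iz.
by move/cvg_lim <- => //; rewrite lim_cst.
Qed.

End PositiveContraction.

(** * Tracial von Neumann algebras *)

Section Adjoints.
Context {R : realType} {H : hilbertType R}.
Implicit Types (S T x y : H -> H) (c r : R).

Lemma is_adjoint_sym S T : is_adjoint S T -> is_adjoint T S.
Proof. by move=> h u v; rewrite dotC -h -dotC. Qed.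

Lemma adjE T S : is_adjoint T S -> adj T = S.
Proof.
move=> h; have h' : is_adjoint T (adj T) by exact: (@xgetI _ _ _ S h).
apply/funext => v; apply: rdot_inj => u.
by rewrite rdotC /rdot -h' h -/(rdot _ _) rdotC.
Qed.

Lemma adjK x : is_adjoint x (adj x) -> adj (adj x) = x.
Proof. by move=> h; apply/adjE/is_adjoint_sym. Qed.

Lemma is_adjoint_rdot S T u v : is_adjoint S T -> rdot (S u) v = rdot u (T v).
Proof. by move=> h; rewrite /rdot h. Qed.

Lemma is_adjoint_id : is_adjoint (@id H) id. Proof. by []. Qed.

Lemma is_adjoint_lin (a : R[i]) S T S' T' : is_adjoint S S' -> is_adjoint T T' ->
  is_adjoint (a *: S + T) (Num.conj a *: S' + T').
Proof.
move=> hS hT u v.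
have -> : (a *: S + T) u = a *: S u + T u by [].
have -> : (Num.conj a *: S' + T') v = Num.conj a *: S' v + T' v by [].
by rewrite dotDl dotZl dotDr dotZr conjCK hS hT.
Qed.

Lemma is_adjoint_comp S T S' T' : is_adjoint S S' -> is_adjoint T T' ->
  is_adjoint (S \o T) (T' \o S').
Proof. by move=> hS hT u v; rewrite /= hS hT. Qed.

End Adjoints.

Section StarAlgebra.
Context {R : realType} {H : hilbertType R} (A : set (H -> H)) (hA : unital_star_alg A).
Implicit Types (S T x y : H -> H).

Lemma alg_zero : A 0.
Proof.
have := star_alg_lin hA (-1) (star_alg_id hA) (star_alg_id hA).
by rewrite scaleN1r addNr.
Qed.

Lemma alg_scale (a : R[i]) S : A S -> A (a *: S).
Proof. by move=> hS; rewrite -[_ *: _]addr0; apply: star_alg_lin => //; apply: alg_zero. Qed.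

Lemma alg_add S T : A S -> A T -> A (S + T).
Proof. by move=> hS hT; rewrite -[S]scale1r; apply: star_alg_lin. Qed.

Lemma alg_opp S : A S -> A (- S).
Proof. by move=> hS; rewrite -scaleN1r; apply: alg_scale. Qed.

Lemma alg_sub S T : A S -> A T -> A (S - T).
Proof. by move=> hS hT; apply: alg_add => //; apply: alg_opp. Qed.

Lemma alg_adj S : A S -> A (adj S). Proof. by case/(star_alg_adj hA). Qed.

Lemma alg_is_adj S : A S -> is_adjoint S (adj S).
Proof. by case/(star_alg_adj hA). Qed.

Lemma alg_iter k S : A S -> A (iter k S).
Proof.
move=> hS; elim: k => [|k IH]; first exact: (star_alg_id hA).
exact: (star_alg_comp hA hS IH).
Qed.

End StarAlgebra.

Section TracialAlgebra.
Context {R : realType} {H : hilbertType R}.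
Variables (M : set (H -> H)) (tau : (H -> H) -> R[i]).
Hypotheses (hM : tracial_vna M tau).
Implicit Types (S T x y : H -> H) (c e r : R).

Lemma vna_star : unital_star_alg M.
Proof. exact: (vna_star_alg (tvna_vna hM)). Qed.

Lemma vna_op T : M T -> bounded_op T.
Proof. exact: (vna_bounded (tvna_vna hM)). Qed.

Lemma vna_lin T : M T -> linear T.
Proof. by move=> /vna_op/bounded_op_linear. Qed.

Lemma tauB S T : M S -> M T -> tau (S - T) = tau S - tau T.
Proof.
move=> hS hT; rewrite addrC -scaleN1r (tvna_linear hM) //.
by rewrite mulN1r addrC.
Qed.

Lemma tauD S T : M S -> M T -> tau (S + T) = tau S + tau T.
Proof. by move=> hS hT; rewrite -{1}[S]scale1r (tvna_linear hM) // mul1r. Qed.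

Lemma tau0 : tau 0 = 0.
Proof.
have M1 := star_alg_id vna_star.
by have := tauB M1 M1; rewrite !subrr.
Qed.

(* Cutting the series of the normal functional off: tau is small on operators
   of bounded norm which are small on finitely many vectors. *)
Lemma tau_small : exists xi : nat -> H, forall c e, 0 <= c -> 0 < e ->
  exists N d, 0 < d /\ forall S, M S -> nr_bounded c S ->
    (forall n, (n < N)%N -> nr (S (xi n)) <= d) -> complex.Re `|tau S| <= e.
Proof.
have [xi [eta [cxi ceta htau]]] := tvna_normal hM.
exists xi => c e c0 e0.
have tail (z : nat -> H) (cz : cvgn (series (fun n => `|z n| ^+ 2))) d : 0 < d ->
    exists N, forall m, \sum_(N <= n < m) nr (z n) ^+ 2 <= d.
  move=> d0; have d20 : 0 < (d / 2)%:C by rewrite ltcR divr_gt0.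
  move: cz => /cvg_ex[l /cvgrPdist_lt/(_ _ d20)[N _ hN]].
  exists N => m; have [mN|/ltnW Nm] := leqP m N.
    by rewrite big_geq // ltW.
  have -> : \sum_(N <= n < m) nr (z n) ^+ 2 =
            complex.Re (\sum_(N <= n < m) `|z n| ^+ 2).
    rewrite Re_sum; apply: eq_bigr => n _.
    by rewrite nrE -rmorphXn.
  rewrite -sub_series_geq //.
  apply: le_trans (ler_norm _) _; apply: le_trans (Re_le_norm _) _.
  rewrite -lecR RRe_real ?normr_real //.
  have := hN m Nm; have := hN N (leqnn N) => /= h1 h2.
  have -> : series (fun n => `|z n| ^+ 2) m - series (fun n => `|z n| ^+ 2) N
     = (l - series (fun n => `|z n| ^+ 2) N) - (l - series (fun n => `|z n| ^+ 2) m) by ring.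
  apply: le_trans (ler_normB _ _) _.
  rewrite [d]splitr rmorphD lerD // ltW //.
(* Terms beyond N are at most c/2 (|xi_n|^2 + |eta_n|^2) and add up to at most e/4; the first N
   terms cost e/4 by the choice of d, and cutting the series at m costs e/2. The + 1 avoids dividing
   by zero. *)
have e8 : 0 < e / 4 / (c + 1) by rewrite !divr_gt0 // ltr_wpDl.
have [N1 hN1] := tail _ cxi _ e8.
have [N2 hN2] := tail _ ceta _ e8.
pose N := maxn N1 N2.
have tailN (z : nat -> H) N' m d : (forall m, \sum_(N' <= n < m) nr (z n) ^+ 2 <= d) ->
    (N' <= N)%N -> 0 <= d -> \sum_(N <= n < m) nr (z n) ^+ 2 <= d.
  move=> h N'N d0; have [mN|/ltnW Nm] := leqP m N; first by rewrite big_geq.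
  apply: le_trans (h m); rewrite (big_cat_nat N'N Nm) /= lerDr.
  by apply: sumr_ge0 => n _; rewrite sqr_ge0.
pose E := \sum_(0 <= n < N) nr (eta n).
have E0 : 0 <= E by apply: sumr_ge0 => n _; rewrite nr_ge0.
exists N, (e / 4 / (E + 1)); split.
  by rewrite !divr_gt0 // ltr_wpDl.
move=> S MS bS hS.
have e20 : 0 < (e / 2)%:C by rewrite ltcR divr_gt0.
have /cvgrPdist_lt/(_ _ e20)[m0 _ hm] := htau _ MS.
pose m := maxn m0 N.
have {}hm := hm m (leq_maxl _ _).
rewrite -lecR RRe_real ?normr_real //.
rewrite -(subrK (series (fun n => hdot H (S (xi n)) (eta n)) m) (tau S)).
apply: le_trans (ler_normD _ _) _.
rewrite [e]splitr rmorphD lerD //; first exact: ltW.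
rewrite /series /=.
apply: le_trans (ler_norm_sum _ _ _) _.
apply: (@le_trans _ _ (\sum_(0 <= n < m) (nr (S (xi n)) * nr (eta n))%:C)).
  by apply: ler_sum => n _; apply: dot_abs_le.
rewrite -rmorph_sum lecR (@big_cat_nat _ _ _ N 0 m (fun=> true)) ?leq_maxr //=.
have h1 : \sum_(0 <= i < N) nr (S (xi i)) * nr (eta i) <= e / 4.
  apply: (@le_trans _ _ (\sum_(0 <= i < N) e / 4 / (E + 1) * nr (eta i))).
    rewrite !big_mkord; apply: ler_sum => n _.
    by rewrite ler_wpM2r ?nr_ge0 // hS.
  rewrite -mulr_sumr -/E -mulrA ler_piMr //; first by rewrite divr_ge0 // ltW.
  by rewrite mulrC ler_pdivrMr ?mul1r ?lerDl // ltr_wpDl.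
have h2 : \sum_(N <= i < m) nr (S (xi i)) * nr (eta i) <= e / 4.
  apply: (@le_trans _ _ (\sum_(N <= i < m) c / 2 * (nr (xi i) ^+ 2 + nr (eta i) ^+ 2))).
    apply: ler_sum => n _.
    apply: (@le_trans _ _ (c * nr (xi n) * nr (eta n))).
      by rewrite ler_wpM2r ?nr_ge0 // bS.
    rewrite -subr_ge0.
    rewrite (_ : _ - _ = c / 2 * (nr (xi n) - nr (eta n)) ^+ 2); last by field.
    by rewrite mulr_ge0 ?sqr_ge0 ?divr_ge0.
  rewrite -mulr_sumr big_split /=.
  have a1 := tailN _ _ m _ hN1 (leq_maxl _ _) (ltW e8).
  have a2 := tailN _ _ m _ hN2 (leq_maxr _ _) (ltW e8).
  apply: (@le_trans _ _ (c / 2 * (e / 4 / (c + 1) + e / 4 / (c + 1)))).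
    by rewrite ler_wpM2l ?divr_ge0 // lerD.
  rewrite (_ : _ * _ = e / 4 * (c / (c + 1))); last by field; rewrite gt_eqF // ltr_wpDl.
  rewrite ler_piMr //; first by rewrite divr_ge0 // ltW.
  by rewrite ler_pdivrMr ?mul1r ?lerDl // ltr_wpDl.
by lra.
Qed.

(** A strong limit still commutes with the commutant, so it lies in the bicommutant M. The
    differences [T_ k] - [T] are bounded by 2c and eventually small on any finite set of vectors,
    which is what [tau_small] asks for. *)
Lemma vna_strong_limit (T_ : nat -> H -> H) T c : 0 <= c ->
  (forall k, M (T_ k)) -> (forall k, nr_bounded c (T_ k)) ->
  (forall v, hcv (fun k => T_ k v) (T v)) ->
  M T /\ (fun k => complex.Re (tau (T_ k))) @ \oo --> complex.Re (tau T).
Proof.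
move=> c0 MT bT hT.
have bTl : nr_bounded c T.
  move=> v; apply: (hcv_le_nr (hT v)) => k; exact: bT.
have lT : linear T.
  move=> a u v; apply: (hcv_uniq (hT _)).
  rewrite (_ : (fun k => _) = (fun k => a *: T_ k u + T_ k v)).
    by apply: hcvD => //; apply: hcvZ.
  by apply/funext => k; rewrite (vna_lin (MT k)).
have MTl : M T.
  rewrite -(vna_bicommutant (tvna_vna hM)); split; first exact: nr_bounded_op lT bTl.
  move=> S [bS hS]; apply/funext => v /=.
  apply: (hcv_uniq (hT _)).
  rewrite (_ : (fun k => _) = S \o (fun k => T_ k v)); first exact: hcv_op.
  by apply/funext => k; have := congr1 (fun f => f v) (hS _ (MT k)).
split=> //; apply/cvgrPdist_le => e e0.
have [xi hxi] := tau_small.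
have c20 : 0 <= c + c by rewrite addr_ge0.
have [N [d [d0 hd]]] := hxi _ _ c20 e0.
have [m hm] : exists m, forall k, (m <= k)%N -> forall n, (n < N)%N -> nr (T_ k (xi n) - T (xi n)) <= d.
  elim: N {hd} => [|N [m hm]]; first by exists 0.
  have /hcvP/(_ _ d0)[m' hm'] := hT (xi N).
  exists (maxn m m') => k; rewrite geq_max => /andP[mk m'k] n.
  rewrite ltnS leq_eqVlt => /predU1P[->|]; first exact/ltW/hm'.
  exact: hm.
exists m => // k /hm mk; rewrite /= distrC -ReN -ReD -tauB //.
apply: le_trans (Re_le_norm _) _; apply: hd => //.
  exact: (alg_sub vna_star (MT k) MTl).
move=> v; rewrite mulrDl; apply: le_trans (nrB _ _) _.
by apply: lerD; [exact: bT | exact: bTl].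
Qed.

End TracialAlgebra.

(** * Commuting self-adjoint operators *)

(* Identities between real linear combinations of vectors, tested against an
   arbitrary vector. *)
Ltac vring := apply: rdot_inj => ?;
  rewrite ?(rdotBl, rdotDl, rdotNl, rdotZl, rdot0l); by [lra | field].

Section SelfAdjoint.
Context {R : realType} {H : hilbertType R}.
Implicit Types (T : H -> H).

Definition symm T := forall u v, rdot (T u) v = rdot u (T v).

Lemma iter_cvg_fixed1 T : linear T -> symm T ->
  (forall v, nr (T v) ^+ 2 <= rdot (T v) v) ->
  forall v, exists w, [/\ hcv (fun k => iter k T v) w, T w = w &
    forall z, T z = z -> rdot (v - w) z = 0].
Proof.
move=> lT sT hT v.
pose C (u : 'I_1 -> H) := fun i => T (u i).
have iterC k (u : 'I_1 -> H) : iter k C u = fun i => iter k T (u i).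
  by elim: k => //= k ->.
have [|||w [h1 h2 h3]] := @iter_cvg_fixed _ _ _ C _ _ _ (fun=> v).
- by move=> a b; apply/funext => i; rewrite /C linB.
- by move=> a b; apply: eq_bigr => i _; apply: sT.
- by move=> a; apply: ler_sum => i _; rewrite rdotxx; apply: hT.
exists (w ord0); split.
- rewrite (_ : (fun k => _) = (fun k => iter k C (fun=> v) ord0)); first exact: h1.
  by apply/funext => k; rewrite iterC.
- by rewrite -[RHS](congr1 (fun f => f ord0) h2).
move=> z Tz; have := h3 (fun=> z); rewrite /ip big_ord1; apply.
by apply/funext => i; rewrite /C.
Qed.

End SelfAdjoint.

Section AbelianAlgebra.
Context {R : realType} {H : hilbertType R}.
Variables (M : set (H -> H)) (tau : (H -> H) -> R[i]).
Hypotheses (hM : tracial_vna M tau) (hab : abelian_alg M).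
Implicit Types (S T x y : H -> H) (c e r : R) (u v w : H).

Lemma is_adjoint_symm T : is_adjoint T T -> symm T.
Proof. by move=> h u v; apply: is_adjoint_rdot. Qed.

Lemma symm_is_adjoint T : linear T -> symm T -> is_adjoint T T.
Proof. by move=> lT h u v; rewrite !dotE !h linZ. Qed.

Lemma vna_comm S T v : M S -> M T -> S (T v) = T (S v).
Proof. by move=> hS hT; have := congr1 (fun f => f v) (hab hS hT). Qed.

Lemma symm_nr_sqr T v : symm T -> rdot (T (T v)) v = nr (T v) ^+ 2.
Proof. by move=> sT; rewrite sT rdotxx. Qed.

Lemma symm_comp S T : M S -> M T -> symm S -> symm T -> symm (S \o T).
Proof. by move=> MS MT sS sT u v; rewrite /= sS sT vna_comm. Qed.

(** p is the strong limit of the powers of G, and p is symmetric because v - p v is orthogonal to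
    the range of p. The convergence of traces serves [powers_to_kernel], where G is c^* c. *)
Lemma iter_projection (G : H -> H) : M G -> symm G ->
  (forall v, nr (G v) ^+ 2 <= rdot (G v) v) ->
  exists p, [/\ projection M p, symm p,
    forall v, G (p v) = p v, forall v, G v = v -> p v = v &
    (fun k => complex.Re (tau (iter k G))) @ \oo --> complex.Re (tau p)].
Proof.
move=> MG sG hG; have lG := vna_lin hM MG.
have [p hp] := choice (iter_cvg_fixed1 lG sG hG).
have Gcon v : nr (G v) <= nr v.
  have := hG v; rewrite expr2 => h.
  have [g0|g0] := eqVneq (nr (G v)) 0; first by rewrite g0 nr_ge0.
  rewrite -(@ler_pM2l _ (nr (G v))) ?lt_def ?g0 ?nr_ge0 //.
  exact: le_trans h (rdot_le _ _).
have Gk1 k : nr_bounded 1 (iter k G).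
  move=> v; rewrite mul1r; elim: k => //= k; exact: le_trans.
have [Mp taup] := vna_strong_limit hM ler01 (fun k => alg_iter (vna_star hM) k MG) Gk1
  (fun v => let: And3 h _ _ := hp v in h).
have Gp v : G (p v) = p v by case: (hp v).
have iterp k v : G v = v -> iter k G v = v by move=> Gv; elim: k => //= k ->.
have pfix v : G v = v -> p v = v.
  move=> Gv; have [h _ _] := hp v; apply: (hcv_uniq h).
  by under eq_fun do rewrite iterp //; apply: hcv_cst.
have sp : symm p.
  move=> u v; have [_ _ hu] := hp u; have [_ _ hv] := hp v.
  have := hu _ (Gp v); have := hv _ (Gp u).
  rewrite !rdotBl => /eqP; rewrite subr_eq0 => /eqP h1 /eqP; rewrite subr_eq0 => /eqP h2.
  by rewrite rdotC h1 rdotC h2 rdotC.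
exists p; split => //; split => //; last exact: symm_is_adjoint (vna_lin hM Mp) sp.
by apply/funext => v /=; rewrite pfix.
Qed.

(** With c a norm bound of y, G = 1 - y^2 / c^2 is a positive contraction whose fixed vectors form
    ker y^2, and this is ker y because <y^2 v, v> = |y v|^2. *)
Lemma kernel_projection y : M y -> symm y ->
  exists p, [/\ projection M p, symm p, forall v, y (p v) = 0 &
    forall v, y v = 0 -> p v = v].
Proof.
move=> My sy; have [c c0 hc] := bounded_op_nr (vna_op hM My).
pose s := (c ^+ 2)^-1; have s0 : 0 < s by rewrite invr_gt0 exprn_gt0.
pose G := fun v => v - s%:C *: y (y v).
have MG : M G.
  apply: (alg_sub (vna_star hM) (star_alg_id (vna_star hM))).
  apply: (alg_scale (vna_star hM) s%:C).
  exact: (star_alg_comp (vna_star hM) My My).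
have sG : symm G.
  by move=> u v; rewrite /G !(rdotBl, rdotBr, rdotZl, rdotZr) !sy.
have [v|p [pp sp Gp pG _]] := iter_projection MG sG.
  rewrite /G -rdotxx !(rdotBl, rdotBr, rdotZl, rdotZr) (sy (y v)) (sy v) !rdotxx.
  rewrite (rdotC v) (sy (y v)) rdotxx.
  suff : s * nr (y (y v)) ^+ 2 <= nr (y v) ^+ 2.
    by rewrite -(ler_pM2l s0) => h; lra.
  by rewrite /s ler_pdivrMl ?exprn_gt0 // -exprMn ler_sqr ?nnegrE ?mulr_ge0 ?nr_ge0 // ltW.
exists p; split=> // v.
  apply/nr0_eq0/eqP; rewrite -sqrf_eq0 -symm_nr_sqr //.
  have /eqP := Gp v; rewrite /G subr_eq addrC -subr_eq subrr eq_sym scaler_eq0.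
  case/orP => [|/eqP->]; last by rewrite rdot0l.
  by rewrite -[0]/(0%:C) (inj_eq (@complexI _)) gt_eqF.
move=> yv; apply: pG; rewrite /G yv.
by rewrite (lin0 (vna_lin hM My)) scaler0 subr0.
Qed.

(* y = 1 - sqrt (1 - b) is the limit of the iteration y <- (b + y^2) / 2, which is
   dominated by the scalar iteration t <- (1 + t^2) / 2. *)
Lemma vna_sqrt (b : H -> H) : M b -> symm b -> nr_bounded 1 b ->
  exists y, [/\ M y, symm y, nr_bounded 1 y,
    forall v, y v + y v = b v + y (y v) &
    forall A, unital_star_alg A -> A b -> forall e, 0 < e ->
      exists2 y', A y' & forall v, nr (y v - y' v) <= e * nr v].
Proof.
move=> Mb sb bb.
pose step (Y : H -> H) := (2^-1)%:C *: (b + (Y \o Y)).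
pose Y k := iter k step 0.
pose t k := iter k (fun a : R => (1 + a ^+ 2) / 2) 0.
have t0 k : 0 <= t k by elim: k => //= k IH; rewrite divr_ge0 // addr_ge0 // sqr_ge0.
have t1 k : t k <= 1.
  by elim: k => //= k IH; have := t0 k; rewrite -/(t k) => h; nra.
have AY A : unital_star_alg A -> A b -> forall k, A (Y k).
  move=> hA Ab; elim=> [|k IH]; first exact: alg_zero.
  apply: (alg_scale hA); apply: (alg_add hA) => //.
  exact: (star_alg_comp hA IH IH).
have MY := AY _ (vna_star hM) Mb.
have lY k := vna_lin hM (MY k).
have YS k v : Y k.+1 v = (2^-1)%:C *: (b v + Y k (Y k v)) by [].
have bY k : nr_bounded (t k) (Y k).
  elim: k => [|k IH] v; first by rewrite /= nr0 mul0r.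
  rewrite YS nrZr ger0_norm ?invr_ge0 //.
  have -> : t k.+1 * nr v = 2^-1 * (1 * nr v + t k * (t k * nr v)).
    by rewrite /= -/(t k); field.
  rewrite ler_wpM2l ?invr_ge0 //; apply: le_trans (nrD _ _) _; rewrite lerD //.
  by apply: le_trans (IH _) _; rewrite ler_wpM2l.
have dY k v : nr (Y k.+1 v - Y k v) <= (t k.+1 - t k) * nr v.
  elim: k v => [|k IH] v.
    have Y0 w : Y 0%N w = 0 by [].
    rewrite YS !Y0 subr0 addr0 /= expr0n /= addr0 subr0 nrZr ger0_norm ?invr_ge0 //.
    by rewrite div1r ler_wpM2l ?invr_ge0 //; have := bb v; rewrite mul1r.
  (* The [Y k] commute, so the difference of squares Y_(k+1)^2 - Y_k^2 factors. *)
  have -> : Y k.+2 v - Y k.+1 v = (2^-1)%:C *: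
      (Y k.+1 (Y k.+1 v + Y k v) - Y k (Y k.+1 v + Y k v)).
    rewrite !(linD _ _ (lY _)) (vna_comm v (MY k) (MY k.+1)).
    by rewrite [Y k.+2 v]YS [X in _ - X = _]YS; vring.
  rewrite nrZr ger0_norm ?invr_ge0 //.
  have -> : (t k.+2 - t k.+1) * nr v = 2^-1 * ((t k.+1 - t k) * ((t k.+1 + t k) * nr v)).
    have tS m : t m.+1 = (1 + t m ^+ 2) / 2 by [].
    by rewrite (tS k.+1) (tS k); field.
  rewrite ler_wpM2l ?invr_ge0 //; apply: le_trans (IH _) _.
  have [->|tk] := eqVneq (t k.+1 - t k) 0; first by rewrite !mul0r.
  have tk0 : 0 <= t k.+1 - t k.
    by rewrite /= -/(t k); have := t1 k; have := t0 k => h1 h2; nra.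
  rewrite ler_wpM2l // mulrDl; apply: le_trans (nrD _ _) _.
  by apply: lerD; apply: bY.
have tnd : nondecreasing_seq t.
  apply/nondecreasing_seqP => k /=; rewrite -/(t k).
  by have := t1 k; have := t0 k => h1 h2; nra.
have dYl k l v : (k <= l)%N -> nr (Y l v - Y k v) <= (t l - t k) * nr v.
  elim: l => [|l IH]; first by rewrite leqn0 => /eqP ->; rewrite !subrr nr0 mul0r.
  rewrite leq_eqVlt => /predU1P[<-|]; first by rewrite !subrr nr0 mul0r.
  rewrite ltnS => /IH h; apply: le_trans (nr_split (Y l v) _ _) _.
  have := dY l v; lra.
have : cvgn t.
  by apply: nondecreasing_is_cvgn => //; exists 1 => _ [k _ <-].
move=> /cvg_ex[L hL].
have tL k : t k <= L.
  by rewrite -(cvg_lim _ hL) //; apply: nondecreasing_cvgn_le => //; apply/cvg_ex; exists L.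
have L0 : (fun k => L - t k) @ \oo --> (0 : R).
  by rewrite -(subrr L); apply: cvgB => //; apply: cvg_cst.
have L0v v : (fun k => (L - t k) * nr v) @ \oo --> (0 : R).
  by rewrite -[X in _ --> X](mul0r (nr v)); apply: cvgM => //; apply: cvg_cst.
have ex v : exists w, hcv (fun k => Y k v) w.
  apply: hcv_complete => e e0.
  have /cvgrPdist_lt/(_ _ e0)[N _ hN] := L0v v; exists N => k l.
  wlog lk : k l / (l <= k)%N.
    move=> W; have [/W//|/ltnW/W h Nk Nl] := leqP l k; rewrite nrBC; exact: h.
  move=> Nk Nl; apply: le_lt_trans (dYl _ _ _ lk) _.
  have := hN l Nl; rewrite /= sub0r normrN; apply: le_lt_trans.
  apply: le_trans (ler_norm _); rewrite ler_wpM2r ?nr_ge0 //.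
  by rewrite lerB.
have [y hy] := choice ex.
have bY1 k : nr_bounded 1 (Y k).
  by move=> v; apply: le_trans (bY k v) _; rewrite ler_wpM2r ?nr_ge0.
have [My _] := vna_strong_limit hM ler01 MY bY1 hy.
(* The bound is uniform in v, so [Y k] approximates y in norm; this yields the approximation inside
   every algebra containing b. *)
have yY k v : nr (y v - Y k v) <= (L - t k) * nr v.
  apply: (@hcv_le_nr _ _ (fun l => Y (l + k)%N v - Y k v)).
    by apply: hcvB; [exact: (hcv_shift k (hy v))|apply: hcv_cst].
  move=> l; apply: le_trans (dYl _ _ _ (leq_addl _ _)) _.
  by rewrite ler_wpM2r ?nr_ge0 // lerB.
exists y; split=> //.
- have sY k : symm (Y k).
    elim: k => [|k IH] u v; first by rewrite /Y /= rdot0l rdot0r.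
    by rewrite !YS rdotZl rdotZr rdotDl rdotDr sb !IH.
  move=> u v; have h1 : (fun k => rdot (Y k u) v) @ \oo --> rdot (y u) v by apply: hcv_rdot.
  have h2 : (fun k => rdot (Y k v) u) @ \oo --> rdot (y v) u by apply: hcv_rdot.
  have hh : (fun k => rdot (Y k u) v) = (fun k => rdot (Y k v) u).
    by apply/funext => k; rewrite sY rdotC.
  rewrite hh in h1; rewrite (rdotC u); apply: cvg_unique h1 h2.
  exact: norm_hausdorff.
- move=> v; apply: (hcv_le_nr (hy v)) => k; exact: bY1.
- move=> v.
  apply: (@hcv_uniq _ _ (fun k => Y (k + 1)%N v + Y (k + 1)%N v)).
    by apply: hcvD; exact: (hcv_shift 1 (hy v)).
  rewrite (_ : (fun k => _) = (fun k => b v + Y k (Y k v))); last first.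
    by apply/funext => k; rewrite addn1 YS; vring.
  apply: hcvD; first exact: hcv_cst.
  have yy : (fun k => (L - t k) * nr v + (L - t k) * nr (y v)) @ \oo --> (0 : R).
    by rewrite -(addr0 0); apply: cvgD.
  apply: (hcv_le _ yy) => k.
  apply: le_trans (nr_split (Y k (y v)) _ _) _; apply: lerD; last first.
    by rewrite nrBC.
  rewrite -(linB _ _ (lY k)); apply: le_trans (bY1 _ _) _.
  by rewrite mul1r nrBC.
- move=> A hA Ab e e0.
  have /cvgrPdist_lt/(_ _ e0)[N _ hN] := L0.
  exists (Y N); first exact: AY.
  move=> v; apply: le_trans (yY N v) _; rewrite ler_wpM2r ?nr_ge0 //.
  have := hN N (leqnn N); rewrite /= sub0r normrN => /ltW; apply: le_trans.
  exact: ler_norm.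
Qed.

End AbelianAlgebra.

(** * Absolute values and their Lipschitz estimate *)

Section Truncation.
Context {R : realType} {H : hilbertType R}.
Variables (M : set (H -> H)) (tau : (H -> H) -> R[i]).
Hypotheses (hM : tracial_vna M tau) (hab : abelian_alg M).
Implicit Types (A : set (H -> H)) (S T x y : H -> H) (c e r : R) (u v w : H).

Let lM T : M T -> linear T. Proof. exact: vna_lin hM T. Qed.

(* s = |x|; positivity of s is witnessed by a square root in M. *)
Definition is_abs x s := [/\ M s, symm s,
  exists g, [/\ M g, symm g & forall v, s v = g (g v)] &
  forall v, s (s v) = x (x v)].

Definition norm_approx A s := forall e, 0 < e ->
  exists2 s', A s' & forall v, nr (s v - s' v) <= e * nr v.

Lemma alg_affine A (a b : R) x : unital_star_alg A -> A x ->
  A (fun v => a%:C *: v + b%:C *: x v).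
Proof.
move=> hA Ax; apply: (alg_add hA).
  exact: (alg_scale hA a%:C (star_alg_id hA)).
exact: (alg_scale hA b%:C Ax).
Qed.

Lemma symm_affine (a b : R) x : symm x -> symm (fun v => a%:C *: v + b%:C *: x v).
Proof. by move=> sx u v; rewrite rdotDl rdotDr !rdotZl !rdotZr sx. Qed.

(** For c a norm bound of x and b = 1 - x^2 / c^2, [vna_sqrt] gives y = 1 - |x| / c, so s = c (1 -
    y). A second use, on y, gives y2 with (1 - y2)^2 = 1 - y, whence the root g = sqrt c (1 - y2) of
    s. *)
Lemma abs_exists x : M x -> symm x -> exists s, is_abs x s /\
  forall A, unital_star_alg A -> A x -> norm_approx A s.
Proof.
move=> Mx sx; have [c c0 hc] := bounded_op_nr (vna_op hM Mx).
have cn : c != 0 by rewrite gt_eqF.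
pose d := c^-1; have d0 : 0 < d by rewrite invr_gt0.
pose b := fun v => 1%:C *: v + (- (d ^+ 2))%:C *: x (x v).
have Ab A : unital_star_alg A -> A x -> A b.
  by move=> hA Ax; apply: (alg_affine 1 (- (d ^+ 2)) hA (star_alg_comp hA Ax Ax)).
have Mb : M b by apply: Ab => //; apply: (vna_star hM).
have sb : symm b.
  by apply: (symm_affine 1 (- (d ^+ 2)) (x := x \o x)); apply: (symm_comp hab).
have bb : nr_bounded 1 b.
  move=> v; rewrite mul1r nr_le_sqr nr_sqrD !nrZr rdotZl rdotZr.
  rewrite (rdotC v) symm_nr_sqr // normr1 normrN ger0_norm ?sqr_ge0 // !exprMn.
  have h : d ^+ 2 * nr (x (x v)) ^+ 2 <= nr (x v) ^+ 2.
    have d1 : d * nr (x (x v)) <= nr (x v) by rewrite /d ler_pdivrMl.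
    by rewrite -exprMn ler_sqr // nnegrE ?nr_ge0 // mulr_ge0 ?nr_ge0 // ltW.
  have h2 : d ^+ 2 * (d ^+ 2 * nr (x (x v)) ^+ 2) <= d ^+ 2 * nr (x v) ^+ 2.
    by rewrite ler_wpM2l ?sqr_ge0.
  have h3 : 0 <= d ^+ 2 * nr (x v) ^+ 2 by rewrite mulr_ge0 ?sqr_ge0.
  lra.
have [y [My sy by1 yE yA]] := vna_sqrt hM hab Mb sb bb.
have [y2 [My2 sy2 _ y2E _]] := vna_sqrt hM hab My sy by1.
pose s := fun v => c%:C *: v + (- c)%:C *: y v.
pose g := fun v => (Num.sqrt c)%:C *: v + (- Num.sqrt c)%:C *: y2 v.
have sqc : Num.sqrt c * Num.sqrt c = c by rewrite -expr2 sqr_sqrtr // ltW.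
exists s; split; first split.
- exact: (alg_affine c (- c) (vna_star hM) My).
- exact: symm_affine.
- exists g; split; first exact: (alg_affine _ _ (vna_star hM) My2).
    exact: symm_affine.
  move=> v; rewrite /s /g !(linD _ _ (lM My2)) !(linZ _ _ (lM My2)).
  have yv : y v = y2 v + y2 v - y2 (y2 v) by rewrite y2E; vring.
  rewrite yv; apply: rdot_inj => z.
  rewrite !(rdotDl, rdotBl, rdotZl) rdotNl.
  rewrite -{1 2}sqc; ring.
- move=> v; rewrite /s !(linD _ _ (lM My)) !(linZ _ _ (lM My)).
  have yyv : y (y v) = y v + y v - b v by rewrite yE; vring.
  rewrite yyv /b /d; apply: rdot_inj => z.
  by rewrite !(rdotDl, rdotBl, rdotZl, rdotNl); field.
move=> A hA Ax e e0.
have ed : 0 < e / c by rewrite divr_gt0.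
have [y' Ay' hy'] := yA A hA (Ab A hA Ax) _ ed.
exists (fun v => c%:C *: v + (- c)%:C *: y' v); first exact: alg_affine.
move=> v; rewrite (_ : _ - _ = (- c)%:C *: (y v - y' v)); last by vring.
rewrite nrZr normrN gtr0_norm //.
by have := hy' v; rewrite -(ler_pM2l c0) => h; apply: le_trans h _; rewrite mulrA [c * _]mulrC divfK.
Qed.

(** t + T is positive and therefore its own absolute value. The root comes from [vna_sqrt] for b =
    (1 - T / t) / 2, since t + T = 2t (1 - b). *)
Lemma abs_shift T t : M T -> symm T -> 0 < t -> nr_bounded t T ->
  let Tt := fun v => t%:C *: v + 1%:C *: T v in is_abs Tt Tt.
Proof.
move=> MT sT t0 bT Tt; have tn : t != 0 by rewrite gt_eqF.
pose b := fun v => (2^-1)%:C *: v + (- (2 * t)^-1)%:C *: T v.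
have Mb : M b by exact: (alg_affine _ _ (vna_star hM) MT).
have sb : symm b by exact: symm_affine.
have bb : nr_bounded 1 b.
  move=> v; apply: le_trans (nrD _ _) _; rewrite !nrZr normrN.
  have t2 : 0 < (2 * t)^-1 by rewrite invr_gt0 mulr_gt0.
  rewrite (gtr0_norm t2) ger0_norm ?invr_ge0 //; have := bT v.
  rewrite -(ler_pM2l t2) => h.
  have -> : 1 * nr v = 2^-1 * nr v + (2 * t)^-1 * (t * nr v) by field.
  by rewrite lerD2l.
have [y [My sy _ yE _]] := vna_sqrt hM hab Mb sb bb.
have sq2 : Num.sqrt (2 * t) * Num.sqrt (2 * t) = 2 * t.
  by rewrite -expr2 sqr_sqrtr // mulr_ge0 // ltW.
split=> //; first exact: (alg_affine _ _ (vna_star hM) MT).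
  exact: symm_affine.
exists (fun v => (Num.sqrt (2 * t))%:C *: v + (- Num.sqrt (2 * t))%:C *: y v).
split; first exact: (alg_affine _ _ (vna_star hM) My).
  exact: symm_affine.
move=> v; rewrite /Tt !(linD _ _ (lM My)) !(linZ _ _ (lM My)).
have yyv : y (y v) = y v + y v - b v by rewrite yE; vring.
rewrite yyv /b; apply: rdot_inj => z.
rewrite !(rdotDl, rdotBl, rdotZl, rdotNl).
set q := Num.sqrt _ in sq2 *.
have -> : t * rdot v z + 1 * rdot (T v) z = q * q * (2^-1 * rdot v z + (2 * t)^-1 * rdot (T v) z).
  by rewrite sq2; field.
by set h := (2 * t)^-1; field.
Qed.

(* If m = rho^2 and m^2 = z^2 then z <= m: with e the projection onto ker (m + z)
   one has m - z = 2 e m. *)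
Lemma le_abs (z rho : H -> H) v : M z -> M rho -> symm z -> symm rho ->
  (forall v, rho (rho (rho (rho v))) = z (z v)) ->
  rdot (z v) v <= nr (rho v) ^+ 2.
Proof.
move=> Mz Mr sz sr zz; set m := rho \o rho.
have Mm : M m by exact: (star_alg_comp (vna_star hM)).
have Mmz : M (m + z) by exact: (alg_add (vna_star hM)).
have smz : symm (m + z).
  by move=> u w; rewrite [LHS]rdotDl [RHS]rdotDr sz /m /= !sr.
have [p [[Mp pp _] sp yp ker]] := kernel_projection hM Mmz smz.
have e1 : p (m v - z v) = m v - z v.
  apply: ker; change (m (m v - z v) + z (m v - z v) = 0).
  rewrite (linB _ _ (lM Mm)) (linB _ _ (lM Mz)) (vna_comm hab v Mm Mz) -zz /m /=.
  by vring.
have e2 : p (m v + z v) = 0.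
  by rewrite -[m v + z v]/((m + z) v) (vna_comm hab v Mp Mmz).
have e3 : m v - z v = p (m v) + p (m v).
  rewrite -e1 -[LHS]addr0 -e2 -(linD _ _ (lM Mp)) -(linD _ _ (lM Mp)).
  by congr p; vring.
have := congr1 (fun u => rdot u v) e3; rewrite /= rdotBl rdotDl.
have -> : rdot (p (m v)) v = nr (p (rho v)) ^+ 2.
  have pE w : p (p w) = p w by exact: (congr1 (fun f => f w) pp).
  by rewrite -rdotxx [RHS]sp pE (vna_comm hab v Mp Mr) -sr -sp.
have -> : rdot (m v) v = nr (rho v) ^+ 2 by rewrite /m /= sr rdotxx.
by have := sqr_ge0 (nr (p (rho v))); lra.
Qed.

(** Squaring both sides leaves <x y v, v> <= <s t v, v>. This is [le_abs] for z = y x and rho = r q,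
    the product of the roots of s and t, because (s t)^2 = (x y)^2. *)
Lemma abs_lipschitz x y s t v : M x -> M y -> symm x -> symm y ->
  is_abs x s -> is_abs y t -> nr (s v - t v) <= nr (x v - y v).
Proof.
move=> Mx My sx sy [Ms ss [r [Mr sr srE]] sE] [Mt st [q [Mq sq tqE]] tE].
rewrite nr_le_sqr !nr_sqrB -!(symm_nr_sqr _ ss) -!(symm_nr_sqr _ st).
rewrite -!(symm_nr_sqr _ sx) -!(symm_nr_sqr _ sy) sE tE.
have Mrq : M (r \o q) by exact: (star_alg_comp (vna_star hM)).
have Myx : M (y \o x) by exact: (star_alg_comp (vna_star hM)).
have rq w : r (q (r (q w))) = s (t w).
  by rewrite srE tqE (vna_comm hab _ Mq Mr).
have := @le_abs (y \o x) (r \o q) v Myx Mrq (symm_comp hab My Mx sy sx)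
  (symm_comp hab Mr Mq sr sq).
have st4 w : (r \o q) ((r \o q) ((r \o q) ((r \o q) w))) = (y \o x) ((y \o x) w).
  rewrite /= rq rq (vna_comm hab (t w) Mt Ms) sE tE.
  by rewrite (vna_comm hab (y (x w)) My Mx) (vna_comm hab w My Mx) (vna_comm hab (y w) My Mx).
move=> /(_ st4); rewrite -(symm_nr_sqr v (symm_comp hab Mr Mq sr sq)) /= rq.
have -> : rdot (y (x v)) v = rdot (x v) (y v) by rewrite sy.
have -> : rdot (s (t v)) v = rdot (s v) (t v) by rewrite ss rdotC.
lra.
Qed.

End Truncation.

(** * Density in the 2-norm *)

Section Density.
Context {R : realType} {H : hilbertType R}.
Variables (M : set (H -> H)) (tau : (H -> H) -> R[i]).
Hypotheses (hM : tracial_vna M tau) (hab : abelian_alg M).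
Implicit Types (S T x y : H -> H) (c e r : R) (u v w : H).

Let lM T : M T -> linear T. Proof. exact: vna_lin hM T. Qed.

Lemma vna_adj T : M T -> M (adj T). Proof. exact: (alg_adj (vna_star hM)). Qed.

Lemma vna_rdot_adj T u v : M T -> rdot (T u) v = rdot u (adj T v).
Proof. by move=> /(alg_is_adj (vna_star hM)); apply: is_adjoint_rdot. Qed.

Lemma vna_rdot_adjl T u v : M T -> rdot (adj T u) v = rdot u (T v).
Proof. by move=> MT; rewrite rdotC -vna_rdot_adj // rdotC. Qed.

Lemma vna_normal T v : M T -> nr (adj T v) = nr (T v).
Proof.
move=> MT; have MT' := vna_adj MT; apply/eqP; rewrite -(@eqrXn2 _ 2) ?nr_ge0 //; apply/eqP.
by rewrite -!rdotxx vna_rdot_adjl // [RHS]vna_rdot_adj // (vna_comm hab v MT MT').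
Qed.

(** S' = (|S + t| - |S - t|) / 2 is S clamped to [-t, t], and T is its own clamp as |T - t| = t - T.
    The Lipschitz estimate gives both the norm bound and the fact that clamping does not move S away
    from T. This is the cut-off of Kaplansky's density theorem. *)
Lemma truncation t T S : 0 < t -> M T -> symm T -> nr_bounded t T -> M S -> symm S ->
  exists S', [/\ M S', nr_bounded t S', forall v, nr (S' v - T v) <= nr (S v - T v) &
    forall A, unital_star_alg A -> A S -> norm_approx A S'].
Proof.
move=> t0 MT sT bT MS sS.
pose sh (a : R) (x : H -> H) := fun v => a%:C *: v + 1%:C *: x v.
have Msh a x : M x -> M (sh a x) by move=> Mx; apply: (alg_affine _ _ (vna_star hM) Mx).
have ssh a x : symm x -> symm (sh a x) by move=> sx; apply: symm_affine.
have [p [pabs pA]] := abs_exists hM hab (Msh t _ MS) (ssh t _ sS).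
have [m [mabs mA]] := abs_exists hM hab (Msh (- t) _ MS) (ssh (- t) _ sS).
have Tp := abs_shift hM hab MT sT t0 bT.
pose NT := fun v => (-1)%:C *: T v.
have MNT : M NT by apply: (alg_scale (vna_star hM) (-1)%:C MT).
have Tm : is_abs M (sh (- t) T) (sh t NT).
  have sNT : symm NT by move=> u v; rewrite rdotZl rdotZr sT.
  have bNT : nr_bounded t NT by move=> v; rewrite nrZr normrN1 mul1r.
  have [h1 h2 h3 h4] := abs_shift hM hab MNT sNT t0 bNT; split => // v.
  rewrite [LHS](h4 v) /sh /NT !(linD _ _ (lM MT)) !(linZ _ _ (lM MT)); vring.
have [Mp _ _ _] := pabs; have [Mm _ _ _] := mabs.
pose S' := fun v => (2^-1)%:C *: (p v - m v).
have h2 : `|2^-1 : R| = 2^-1 by rewrite ger0_norm ?invr_ge0.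
exists S'; split.
- exact: (alg_scale (vna_star hM) (2^-1)%:C (alg_sub (vna_star hM) Mp Mm)).
- move=> v; rewrite nrZr h2.
  have h := abs_lipschitz hM hab v (Msh t _ MS) (Msh (- t) _ MS) (ssh t _ sS) (ssh (- t) _ sS) pabs mabs.
  apply: (@le_trans _ _ (2^-1 * nr (sh t S v - sh (- t) S v))).
    by rewrite ler_wpM2l ?invr_ge0.
  rewrite (_ : sh t S v - _ = (2 * t)%:C *: v); last by rewrite /sh; vring.
  by rewrite nrZr gtr0_norm ?mulr_gt0 // !mulrA mulVf // mul1r.
- move=> v.
  have hp := abs_lipschitz hM hab v (Msh t _ MS) (Msh t _ MT) (ssh t _ sS) (ssh t _ sT) pabs Tp.
  have hm := abs_lipschitz hM hab v (Msh (- t) _ MS) (Msh (- t) _ MT) (ssh (- t) _ sS) (ssh (- t) _ sT) mabs Tm.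
  rewrite (_ : S' v - T v = (2^-1)%:C *: ((p v - sh t T v) - (m v - sh t NT v))); last first.
    by rewrite /S' /sh /NT; vring.
  rewrite nrZr h2 ler_pdivrMl //; apply: le_trans (nrB _ _) _.
  have e1 a : nr (sh a S v - sh a T v) = nr (S v - T v) by congr nr; rewrite /sh; vring.
  by move: hp hm; rewrite !e1; lra.
- move=> A hA AS e e0.
  have [p' Ap' hp'] := pA A hA (alg_affine t 1 hA AS) e e0.
  have [m' Am' hm'] := mA A hA (alg_affine (- t) 1 hA AS) e e0.
  exists (fun v => (2^-1)%:C *: (p' v - m' v)).
    exact: (alg_scale hA (2^-1)%:C (alg_sub hA Ap' Am')).
  move=> v; rewrite (_ : S' v - _ = (2^-1)%:C *: ((p v - p' v) - (m v - m' v))); last first.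
    by rewrite /S'; vring.
  rewrite nrZr h2 ler_pdivrMl //; apply: le_trans (nrB _ _) _.
  by have := hp' v; have := hm' v; lra.
Qed.

Variable A : set (H -> H).
Hypotheses (hA : unital_star_alg A) (hAM : weakly_dense A M).

(* The orthogonal projection of T xi onto the closure of A xi, as the limit of a
   minimizing sequence; weak density makes the defect vanish. *)
Lemma strong_density T (m : nat) (xi : 'I_m -> H) e : M T -> 0 < e ->
  exists2 S, A S & forall i, nr (S (xi i) - T (xi i)) < e.
Proof.
move=> MT e0.
pose D S := ip (fun i => T (xi i) - S (xi i)) (fun i => T (xi i) - S (xi i)).
have D0 S : 0 <= D S by apply: ip_ge0.
pose E := [set D S | S in A].
have hE : has_inf E.
  split; first by exists (D id), id => //; apply: (star_alg_id hA).
  by exists 0 => _ [S _ <-].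
pose d := inf E.
have dD S : A S -> d <= D S by move=> AS; apply: ge_inf; [exact: hE.2|exists S].
have ex (k : nat) : exists S, A S /\ D S < d + k.+1%:R^-1.
  have k0 : 0 < k.+1%:R^-1 :> R by rewrite invr_gt0 ltr0n.
  have [_ [S AS <-] h] := inf_adherent k0 hE.
  by exists S.
have [S_ hS] := choice ex.
have AS k : A (S_ k) by case: (hS k).
have half S1 S2 : A S1 -> A S2 -> A (fun v => (2^-1)%:C *: (S1 v + S2 v)).
  by move=> h1 h2; apply: (alg_scale hA (2^-1)%:C (alg_add hA h1 h2)).
(* Parallelogram identity: the midpoint of S1 and S2 is in A, so its defect is at least d.
   Minimizing sequences are therefore Cauchy. *)
have par S1 S2 : A S1 -> A S2 -> forall i,
    nr (S1 (xi i) - S2 (xi i)) ^+ 2 <= 2 * D S1 + 2 * D S2 - 4 * d.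
  move=> A1 A2 i.
  apply: le_trans (nr_le_ip (fun i => S1 (xi i) - S2 (xi i)) i) _.
  have hd := dD _ (half _ _ A1 A2).
  suff -> : ip (fun i => S1 (xi i) - S2 (xi i)) (fun i => S1 (xi i) - S2 (xi i)) =
     2 * D S1 + 2 * D S2 - 4 * D (fun v => (2^-1)%:C *: (S1 v + S2 v)) by lra.
  rewrite /D /ip !mulr_sumr -big_split -sumrB; apply: eq_bigr => j _ /=.
  rewrite !(rdotBl, rdotBr, rdotZl, rdotZr, rdotDl, rdotDr).
  rewrite (rdotC (S2 _) (S1 _)) (rdotC (S1 _) (T _)) (rdotC (S2 _) (T _)).
  by field.
have cvgS i : exists l, hcv (fun k => S_ k (xi i)) l.
  apply: hcv_complete => r r0.
  have r4 : 0 < r ^+ 2 / 4 by rewrite divr_gt0 ?exprn_gt0.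
  have /cvgrPdist_lt/(_ _ r4)[N _ hN] := @cvg_harmonic R.
  exists N => k l /hN + /hN; rewrite /harmonic /= !sub0r !normrN.
  rewrite !ger0_norm ?invr_ge0 // => kN lN.
  rewrite -ltr_sqr ?nnegrE ?nr_ge0 ?(ltW r0) //.
  apply: le_lt_trans (par _ _ (AS k) (AS l) i) _.
  have [_ h1] := hS k; have [_ h2] := hS l.
  move: kN lN h1 h2; move: (k.+1%:R^-1) (l.+1%:R^-1) => a b; lra.
have [eta heta] := choice cvgS.
have [rho rhoE] : exists rho, forall i, rho i = T (xi i) - eta i by exists (fun i => T (xi i) - eta i).
have Dcv S (a : R) : (fun k => D (fun v => S_ k v + a%:C *: S v)) @ \oo -->
    ip (fun i => rho i - a%:C *: S (xi i)) (fun i => rho i - a%:C *: S (xi i)).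
  apply: cvgn_sum => i; under eq_fun do rewrite rdotxx expr2.
  have hc : hcv (fun k => T (xi i) - (S_ k (xi i) + a%:C *: S (xi i))) (rho i - a%:C *: S (xi i)).
    rewrite (_ : rho i - _ = T (xi i) - (eta i + a%:C *: S (xi i))); last by rewrite rhoE; vring.
    by apply: hcvB (hcv_cst _) _; apply: hcvD => //; apply: hcv_cst.
  by rewrite rdotxx expr2; exact: (cvgM (hcv_nr hc) (hcv_nr hc)).
have rho_d S (a : R) : A S -> d <= ip (fun i => rho i - a%:C *: S (xi i)) (fun i => rho i - a%:C *: S (xi i)).
  move=> AS1; rewrite -(cvg_lim _ (Dcv S a)) //.
  apply: limr_ge; first by apply/cvg_ex; eexists; exact: (Dcv S a).
  apply: nearW => k; apply: dD; apply: (alg_add hA (AS k)).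
  exact: (alg_scale hA a%:C AS1).
have ip00 : ip (fun i => rho i - 0%:C *: xi i) (fun i => rho i - 0%:C *: xi i) = ip rho rho.
  by apply: eq_bigr => i _; rewrite (_ : rho i - _ = rho i) //; vring.
have d_rho : d <= ip rho rho by rewrite -ip00; apply: (rho_d id 0); apply: (star_alg_id hA).
have rho_le : ip rho rho <= d.
  rewrite -ip00 -[leRHS]addr0.
  apply: (ler_cvg_to (Dcv id 0) (cvgD (cvg_cst d) (@cvg_harmonic R))).
  apply: nearW => k /=; apply: ltW; have [_] := hS k.
  suff -> : D (fun v => S_ k v + 0%:C *: v) = D (S_ k) by [].
  apply: eq_bigr => i _.
  by rewrite (_ : S_ k (xi i) + _ = S_ k (xi i)) //; vring.
have orth S : A S -> ip rho (fun i => S (xi i)) = 0.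
  move=> AS1; set b := ip _ _; pose s := ip (fun i => S (xi i)) (fun i => S (xi i)).
  have s0 : 0 <= s by apply: ip_ge0.
  have h a : 0 <= - 2 * a * b + a ^+ 2 * s.
    have hd := rho_d S a AS1.
    suff he : ip (fun i => rho i - a%:C *: S (xi i)) (fun i => rho i - a%:C *: S (xi i)) =
       ip rho rho - 2 * a * b + a ^+ 2 * s by rewrite he in hd; lra.
    rewrite /s /b /ip !mulr_sumr -sumrB -big_split; apply: eq_bigr => i _ /=.
    by rewrite !(rdotBl, rdotBr, rdotZl, rdotZr) (rdotC (S (xi i)) (rho i)); ring.
  have s1 : 0 < s + 1 by rewrite ltr_wpDl.
  (* Close to the minimizer b / s of the quadratic but defined for s = 0 too; the value is negative
     unless b = 0. *)
  have := h (b / (s + 1)).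
  rewrite [X in 0 <= X](_ : _ = - (b ^+ 2 * ((s + 2) / (s + 1) ^+ 2))); last by field; rewrite gt_eqF.
  rewrite oppr_ge0 pmulr_lle0; first by rewrite le_eqVlt ltNge sqr_ge0 orbF sqrf_eq0 => /eqP.
  by rewrite divr_gt0 ?exprn_gt0 // ltr_wpDl.
(* rho is orthogonal to A xi and to its limit eta, so |rho|^2 = <T xi, rho> = <(T - S) xi, rho> for
   every S in A, and weak density makes the last term small. *)
have rho0 : ip rho rho <= 0.
  have eta0 : ip eta rho = 0.
    have : (fun k => ip (fun i => S_ k (xi i)) rho) @ \oo --> ip eta rho.
      by apply: cvgn_sum => i; apply: hcv_rdot.
    under eq_fun do rewrite ipC orth //.
    by move/cvg_lim <- => //; rewrite lim_cst.
  have -> : ip rho rho = ip (fun i => T (xi i)) rho.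
    rewrite -[RHS]subr0 -eta0 -ipBl; congr (ip _ rho).
    by apply/funext => i; rewrite rhoE.
  apply/ler_addgt0Pl => r r0; rewrite addr0.
  have rm : 0 < r / m.+1%:R by rewrite divr_gt0 ?ltr0n.
  have rm' : 0 < (r / m.+1%:R)%:C by rewrite ltcR.
  have [S AS1 hS1] := hAM.2 _ MT _ xi rho _ rm'.
  rewrite -[leLHS]subr0 -(orth S AS1) (ipC rho) -ipBl.
  apply: (@le_trans _ _ (\sum_(i < m) r / m.+1%:R)).
    apply: ler_sum => i _; have := hS1 i => /ltW h.
    rewrite -lecR; apply: le_trans h; rewrite /rdot.
    by apply: le_trans (_ : _ <= (complex.Re `|hdot H ((T - S) (xi i)) (rho i)|)%:C) _;
      rewrite ?lecR ?RRe_real ?normr_real // (le_trans (ler_norm _)) // Re_le_norm.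
  rewrite sumr_const card_ord -[X in X <= _]mulr_natr -mulrA ler_piMr // ?(ltW r0) //.
  by rewrite mulrC ler_pdivrMr ?ltr0n // mul1r ler_nat.
have e2 : 0 < e ^+ 2 by rewrite exprn_gt0.
have /cvgrPdist_lt/(_ _ e2)[N _ hN] := @cvg_harmonic R.
exists (S_ N) => // i.
rewrite -ltr_sqr ?nnegrE ?nr_ge0 ?(ltW e0) // nrBC.
apply: le_lt_trans (nr_le_ip (fun i => T (xi i) - S_ N (xi i)) i) _.
have := hN N (leqnn N); rewrite /harmonic /= sub0r normrN ger0_norm ?invr_ge0 // => h.
have [_] := hS N; move: h; rewrite -/(D (S_ N)); move: (N.+1%:R^-1) => a; lra.
Qed.

End Density.

(** * Minimal projections and partitions of unity *)

Section Projections.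
Context {R : realType} {H : hilbertType R}.
Variables (M : set (H -> H)) (tau : (H -> H) -> R[i]).
Hypotheses (hM : tracial_vna M tau) (hab : abelian_alg M).
Implicit Types (S T x y p q : H -> H) (c e : R) (u v w : H).

Let lM T : M T -> linear T. Proof. exact: vna_lin hM T. Qed.

Lemma symm_decomposition A x : unital_star_alg A -> A `<=` M -> A x ->
  exists x1 x2, [/\ A x1, A x2, symm x1, symm x2 & x = x1 + 'i *: x2].
Proof.
move=> hA AM Ax; have Axa := alg_adj hA Ax; have Mx := AM _ Ax; have Mxa := AM _ Axa.
exists (fun v => (2^-1)%:C *: (x v + adj x v)), (fun v => (2^-1)%:C *: ('i *: (adj x v - x v))).
split.
- exact: (alg_scale hA (2^-1)%:C (alg_add hA Ax Axa)).
- exact: (alg_scale hA (2^-1)%:C (alg_scale hA 'i (alg_sub hA Axa Ax))).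
- move=> u v; rewrite rdotZl rdotZr rdotDl rdotDr.
  by rewrite (vna_rdot_adj hM _ _ Mx) (vna_rdot_adjl hM _ _ Mx) addrC.
- move=> u v; rewrite rdotZl rdotZr rdotiC rdotBl.
  rewrite (vna_rdot_adj hM _ _ Mx) (vna_rdot_adjl hM _ _ Mx).
  rewrite (linZ _ _ (lM Mx)) (linZ _ _ (lM Mxa)) -rdotBr -scalerBr -rdotNr -scalerN.
  by rewrite opprB.
apply/funext => v.
change (x v = (2^-1)%:C *: (x v + adj x v) + 'i *: ((2^-1)%:C *: ('i *: (adj x v - x v)))).
rewrite scalerA mulrC -scalerA (scalerA 'i 'i) -expr2 sqr_i scaleN1r; vring.
Qed.

(** [tau_small] wants a uniform norm bound, which strong approximation does not provide. So the
    approximant is made symmetric, clamped to norm t, and only then replaced by an element of A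
    close to it in norm. *)
Lemma density2 A T e : unital_star_alg A -> weakly_dense A M ->
  M T -> symm T -> 0 < e ->
  exists2 S, A S & complex.Re `|tau (adj (T - S) \o (T - S))| <= e.
Proof.
move=> hA hAM MT sT e0; have AM := hAM.1.
have [t t0 bT] := bounded_op_nr (vna_op hM MT).
(* Norm bound for T - S2: t from T, t from the clamp S', and 1 from the last approximation as eps <=
   1. *)
pose c := 2 * t + 1; have c0 : 0 < c by rewrite ltr_wpDl // mulr_ge0 // ltW.
have [xi hxi] := tau_small hM.
have [N [d [d0 hd]]] := hxi _ _ (sqr_ge0 c) e0.
pose d' := d / c / 2; have d'0 : 0 < d' by rewrite !divr_gt0.
have [S0 AS0 hS0] := strong_density hA hAM (fun i : 'I_N => xi i) MT d'0.
pose S v := (2^-1)%:C *: (S0 v + adj S0 v).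
have AS : A S by exact: (alg_scale hA (2^-1)%:C (alg_add hA AS0 (alg_adj hA AS0))).
have MS0 := AM _ AS0; have MS := AM _ AS.
have sS : symm S.
  move=> u v; rewrite rdotZl rdotZr rdotDl rdotDr.
  by rewrite (vna_rdot_adj hM _ _ MS0) (vna_rdot_adjl hM _ _ MS0) addrC.
have hS i : (i < N)%N -> nr (S (xi i) - T (xi i)) <= d'.
  move=> iN; have /ltW := hS0 (Ordinal iN) => /=; apply: le_trans.
  (* S0 - T is normal, so its adjoint is as small on xi_i as S0 - T itself, and symmetrizing costs
     nothing. *)
  have MST : M (S0 - T) by exact: (alg_sub (vna_star hM)).
  have aST : adj (S0 - T) = adj S0 - T.
    have -> : S0 - T = (-1) *: T + S0 by rewrite scaleN1r addrC.
    rewrite (adjE (is_adjoint_lin (-1) (symm_is_adjoint (lM MT) sT) (alg_is_adj hA AS0))).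
    by rewrite rmorphN1 scaleN1r addrC.
  have h := vna_normal hM hab (xi i) MST; rewrite aST in h.
  rewrite (_ : _ - _ = (2^-1)%:C *: ((S0 (xi i) - T (xi i)) + (adj S0 (xi i) - T (xi i)))); last first.
    by rewrite /S; vring.
  rewrite nrZr ger0_norm ?invr_ge0 // ler_pdivrMl //; apply: le_trans (nrD _ _) _.
  have {}h : nr (adj S0 (xi i) - T (xi i)) = nr (S0 (xi i) - T (xi i)) by exact: h.
  rewrite h; lra.
have [S' [MS' bS' hS' S'A]] := truncation hM hab t0 MT sT bT MS sS.
pose X := \sum_(i < N) nr (xi i).
have X0 : 0 <= X by apply: sumr_ge0 => i _; apply: nr_ge0.
have X1 : 0 < X + 1 by rewrite ltr_wpDl.
pose eps := Num.min 1 (d' / (X + 1)).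
have eps0 : 0 < eps by rewrite lt_min ltr01 divr_gt0.
have eps1 : eps <= 1 by rewrite ge_min lexx.
have eps2 i : (i < N)%N -> eps * nr (xi i) <= d'.
  move=> iN; apply: (@le_trans _ _ (d' / (X + 1) * (X + 1))).
    apply: ler_pM; rewrite ?nr_ge0 ?(ltW eps0) //; first by rewrite ge_min lexx orbT.
    rewrite /X (bigD1 (Ordinal iN)) //= -addrA lerDl addr_ge0 //.
    by apply: sumr_ge0 => j _; apply: nr_ge0.
  by rewrite divfK // gt_eqF.
have [S2 AS2 hS2] := S'A _ hA AS _ eps0.
exists S2 => //; have MS2 := AM _ AS2.
pose Z := T - S2; have MZ : M Z by exact: (alg_sub (vna_star hM)).
have ZE v : Z v = (T v - S' v) + (S' v - S2 v) by rewrite /Z -[_ v]/(T v - S2 v); vring.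
have bZ v : nr (Z v) <= c * nr v.
  rewrite ZE; apply: le_trans (nrD _ _) _.
  have h1 := nrB (T v) (S' v); have h2 := bT v; have h3 := bS' v.
  have h4 := hS2 v.
  have h5 : eps * nr v <= 1 * nr v by rewrite ler_wpM2r ?nr_ge0.
  rewrite /c; lra.
apply: hd.
- exact: (star_alg_comp (vna_star hM) (vna_adj hM MZ) MZ).
- move=> v; rewrite /= (vna_normal hM hab) //; apply: le_trans (bZ _) _.
  by rewrite expr2 -mulrA ler_wpM2l // ltW.
- move=> i iN; rewrite /= (vna_normal hM hab) //; apply: le_trans (bZ _) _.
  rewrite -/Z -ler_pdivlMl // ZE; apply: le_trans (nrD _ _) _.
  have h1 := le_trans (hS' (xi i)) (hS i iN).
  have h2 := le_trans (hS2 (xi i)) (eps2 i iN).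
  rewrite nrBC; apply: le_trans (lerD h1 h2) _.
  by rewrite /d' -splitr mulrC.
Qed.

(** Minimality leaves for each real l only x >= l or x <= l on the range of p; at the supremum of
    the lower bounds both hold. *)
Lemma minimal_projection_scalar p x : minimal_projections M p -> M x -> symm x ->
  exists l : R, forall v, x (p v) = l%:C *: p v.
Proof.
move=> [[Mp pp /is_adjoint_symm sp] p0 pmin] Mx sx.
have ppE v : p (p v) = p v by exact: (congr1 (fun f => f v) pp).
pose P l := forall v, l * nr (p v) ^+ 2 <= rdot (x (p v)) (p v).
pose Q l := forall v, rdot (x (p v)) (p v) <= l * nr (p v) ^+ 2.
(* Let y = x - l and let e be the projection onto the kernel of |y| - y. Then e p is p or 0. In the
   first case y = |y| on p; in the second, the range of |y| + y lies under e, so y = -|y| on p. *)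
have PQ l : P l \/ Q l.
  have [y [My sy yE]] : exists y, [/\ M y, symm y &
      forall v, y v = (- l)%:C *: v + 1%:C *: x v].
    exists (fun v => (- l)%:C *: v + 1%:C *: x v); split=> //.
      exact: (alg_affine _ _ (vna_star hM) Mx).
    exact: symm_affine.
  have [s [[Ms ss [g [Mg sg sE]] ssE] _]] := abs_exists hM hab My sy.
  have Msy : M (s - y) by exact: (alg_sub (vna_star hM)).
  have ssy : symm (s - y) by move=> u v; rewrite [LHS]rdotBl [RHS]rdotBr ss sy.
  have [e [[Me ee _] se eker kere]] := kernel_projection hM Msy ssy.
  have eE v : e (e v) = e v by exact: (congr1 (fun f => f v) ee).
  have pep : projection M (e \o p).
    split; first exact: (star_alg_comp (vna_star hM)).
      by apply/funext => v; rewrite /= (vna_comm hab _ Mp Me) eE ppE.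
    apply: symm_is_adjoint; first by apply: lM; exact: (star_alg_comp (vna_star hM)).
    exact: (symm_comp hab).
  have pepE : p \o (e \o p) = e \o p.
    by apply/funext => v; rewrite /= (vna_comm hab _ Mp Me) ppE.
  have [ep0|epp] := pmin _ pep pepE.
  - right => v.
    have eh : e (s (p v) + y (p v)) = s (p v) + y (p v).
      apply: kere; change (s (s (p v) + y (p v)) - y (s (p v) + y (p v)) = 0).
      rewrite !(linD _ _ (lM Ms)) !(linD _ _ (lM My)) ssE (vna_comm hab (p v) Ms My).
      vring.
    have ep w : e (p w) = 0 by exact: (congr1 (fun f => f w) ep0).
    have : s (p v) + y (p v) = 0.
      rewrite -eh (linD _ _ (lM Me)) (vna_comm hab _ Me Ms) (vna_comm hab _ Me My) !ep.
      by rewrite (lin0 (lM Ms)) (lin0 (lM My)) addr0.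
    move/(congr1 (fun u => rdot u (p v))); rewrite /= rdotDl rdot0l sE sg rdotxx yE rdotDl !rdotZl rdotxx.
    have := sqr_ge0 (nr (g (p v))); lra.
  - left => v.
    have : s (p v) - y (p v) = 0.
      have := eker (p v); rewrite -[e (p v)]/((e \o p) v) epp; exact.
    move/(congr1 (fun u => rdot u (p v))); rewrite /= rdotBl rdot0l sE sg rdotxx yE rdotDl !rdotZl rdotxx.
    have := sqr_ge0 (nr (g (p v))); lra.
have [c c0 hc] := bounded_op_nr (vna_op hM Mx).
have rb v : `|rdot (x (p v)) (p v)| <= c * nr (p v) ^+ 2.
  by apply: le_trans (rdot_abs_le _ _) _; rewrite expr2 mulrA ler_wpM2r ?nr_ge0.
have [v0 v0p] : exists v0, 0 < nr (p v0) ^+ 2.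
  apply: contrapT => h; case/eqP: p0; apply/funext => v; apply/nr0_eq0/eqP.
  rewrite -sqrf_eq0; apply/negP => /negP n0; apply: h; exists v.
  by rewrite lt_def n0 sqr_ge0.
have Pc l : P l -> l <= c.
  move=> /(_ v0) h; rewrite -(ler_pM2r v0p); apply: le_trans h _.
  by apply: le_trans (ler_norm _) _.
have Pmc : P (- c).
  by move=> v; have := rb v; rewrite ler_norml mulNr => /andP[].
have sP : has_sup P by split; [exists (- c)|exists c].
pose l := sup P; exists l.
have Pl : P l.
  move=> v; have [n0|n0] := eqVneq (nr (p v) ^+ 2) 0.
    by have := rb v; rewrite n0 !mulr0 normr_le0 => /eqP ->.
  have np : 0 < nr (p v) ^+ 2 by rewrite lt_def n0 sqr_ge0.
  rewrite -ler_pdivlMr //; apply: ge_sup; first by exists (- c).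
  by move=> a /(_ v); rewrite ler_pdivlMr.
have Ql : Q l.
  move=> v; apply/ler_addgt0Pl => r r0.
  have n1 : 0 < nr (p v) ^+ 2 + 1 by rewrite ltr_wpDl ?sqr_ge0.
  pose a := r / (nr (p v) ^+ 2 + 1).
  have a0 : 0 < a by rewrite divr_gt0.
  have [Pa|Qa] := PQ (l + a).
    have : l + a <= l by apply: sup_upper_bound.
    by rewrite leNgt ltrDl a0.
  apply: le_trans (Qa v) _; rewrite mulrDl addrC lerD2r.
  rewrite /a -mulrA ler_piMr ?(ltW r0) // mulrC ler_pdivrMr // mul1r lerDl.
  exact: ler01.
move=> v; pose z u := x (p u) - l%:C *: p u.
have zE u : rdot (z u) (p u) = 0.
  have := Pl u; have := Ql u; rewrite /z rdotBl rdotZl rdotxx; lra.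
have pz u : p (z u) = z u.
  by rewrite /z (linB _ _ (lM Mp)) (linZ _ _ (lM Mp)) -(vna_comm hab _ Mx Mp) ppE.
have sz u w : rdot (z u) (p w) = rdot (z w) (p u).
  by rewrite /z !rdotBl !rdotZl sx (rdotC (p u) (p w)) (rdotC (p u)).
have zD u w : z (u + w) = z u + z w.
  by rewrite /z !(linD _ _ (lM Mp)) (linD _ _ (lM Mx)); vring.
(* The quadratic form of z vanishes, and polarizing it at v + z v gives |z v|^2 = 0. *)
have : rdot (z v) (p (z v)) = 0.
  have := zE (v + z v); rewrite zD (linD _ _ (lM Mp)) rdotDl !rdotDr !zE (sz (z v)).
  lra.
rewrite pz rdotxx => /eqP; rewrite sqrf_eq0 => /eqP/nr0_eq0.
by move/eqP; rewrite subr_eq0 => /eqP.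
Qed.

End Projections.

Section Partition.
Context {R : realType} {H : hilbertType R}.
Variables (M : set (H -> H)) (tau : (H -> H) -> R[i]).
Hypotheses (hM : tracial_vna M tau) (hab : abelian_alg M).
Implicit Types (S T x y p q r : H -> H) (c e : R) (u v w : H).

Let lM T : M T -> linear T. Proof. exact: vna_lin hM T. Qed.

Definition tr x : R := complex.Re (tau x).

Lemma trB x y : M x -> M y -> tr (x - y) = tr x - tr y.
Proof. by move=> Mx My; rewrite /tr (tauB hM) // ReD ReN. Qed.

Lemma trD x y : M x -> M y -> tr (x + y) = tr x + tr y.
Proof. by move=> Mx My; rewrite /tr (tauD hM) // ReD. Qed.

Lemma compE S T U v : S \o T = U -> S (T v) = U v.
Proof. by move<-. Qed.

Lemma projK p v : projection M p -> p (p v) = p v.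
Proof. by case=> _ pp _; exact: compE pp. Qed.

Lemma proj_symm p : projection M p -> symm p.
Proof. by case=> _ _ /is_adjoint_symm. Qed.

Lemma tau_proj p : projection M p -> 0 <= tau p.
Proof.
by case=> Mp pp ap; have := tvna_positive hM Mp; rewrite (adjE ap) pp.
Qed.

Lemma tr_proj_ge0 p : projection M p -> 0 <= tr p.
Proof. by move/tau_proj; rewrite lecE => /andP[]. Qed.

Lemma tau_projE p : projection M p -> tau p = (tr p)%:C.
Proof. by move/tau_proj => h; rewrite /tr RRe_real // ger0_real. Qed.

Lemma tr_proj_gt0 p : projection M p -> p != 0 -> 0 < tr p.
Proof.
move=> pp p0; rewrite lt_def tr_proj_ge0 // andbT; apply: contra_neq p0 => t0.
have [Mp pE ap] := pp; apply: (tvna_faithful hM Mp).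
by rewrite (adjE ap) pE (tau_projE pp) t0.
Qed.

Lemma proj_le p q v : projection M p -> projection M q -> q \o p = p -> p (q v) = p v.
Proof.
move=> [Mp _ _] [Mq _ _] h; rewrite (vna_comm hab v Mp Mq).
exact: compE h.
Qed.

Lemma proj_sub p q : projection M p -> projection M q -> q \o p = p ->
  projection M (q - p) /\ q \o (q - p) = q - p.
Proof.
move=> pp pq h; have [Mp _ _] := pp; have [Mq _ _] := pq.
have Mqp : M (q - p) by exact: (alg_sub (vna_star hM)).
have qp v : q (p v) = p v by exact: compE h.
have e1 : q \o (q - p) = q - p.
  apply/funext => v; change (q (q v - p v) = q v - p v).
  by rewrite (linB _ _ (lM Mq)) (projK _ pq) qp.
split => //; split => //.
  apply/funext => v; change (q (q v - p v) - p (q v - p v) = q v - p v).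
  rewrite (linB _ _ (lM Mq)) (linB _ _ (lM Mp)) (projK _ pq) qp (proj_le _ pp pq h).
  by rewrite (projK _ pp) subrr subr0.
apply: symm_is_adjoint; first exact: lM.
move=> u v; change (rdot (q u - p u) v = rdot u (q v - p v)).
by rewrite rdotBl rdotBr !proj_symm.
Qed.

Lemma id_proj : projection M id.
Proof. by split => //; apply: (star_alg_id (vna_star hM)). Qed.

(** A tree of orthogonal sums rather than a list of pieces: partitions of orthogonal projections are
    glued by one constructor, and the decomposition of diagonal vectors follows by induction. *)
Inductive fine_partition e : (H -> H) -> Prop :=
| fine_atom q : projection M q -> minimal_projections M q \/ tr q <= e ->
    fine_partition e q
| fine_add p q : fine_partition e p -> fine_partition e q ->
    (forall v, p (q v) = 0) -> fine_partition e (p + q).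

(* Otherwise there is a decreasing sequence of projections without fine partition
   whose traces are almost minimal, and its limit has no proper subprojection
   without fine partition, although it is not minimal. *)
Lemma fine_partition_id e : 0 < e -> fine_partition e id.
Proof.
move=> e0; apply: contrapT => bad1.
pose bad q := projection M q /\ ~ fine_partition e q.
have bad_sub p q : projection M p -> bad q -> q \o p = p -> bad p \/ bad (q - p).
  move=> pp [pq nq] h; have [pqp _] := proj_sub pp pq h.
  apply: contrapT => /not_orP[np nqp]; apply: nq.
  have -> : q = (q - p) + p by rewrite subrK.
  apply: fine_add.
  - by apply: contrapT => nf; apply: nqp.
  - by apply: contrapT => nf; apply: np.
  move=> v; change (q (p v) - p (p v) = 0).
  by rewrite (projK _ pp) (compE _ h) subrr.
pose E q := [set tr p | p in [set p | bad p /\ q \o p = p]].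
have infE q : bad q -> has_inf (E q).
  move=> bq; split; first by exists (tr q), q => //=; split=> //; case: bq => -[].
  by exists 0 => _ [p [[pp _] _] <-]; apply: tr_proj_ge0.
have next (qk : {q | bad q} * nat) : exists p : {q | bad q},
    sval qk.1 \o sval p = sval p /\ tr (sval p) < inf (E (sval qk.1)) + qk.2.+1%:R^-1.
  case: qk => -[q bq] k /=.
  have k0 : 0 < k.+1%:R^-1 :> R by rewrite invr_gt0 ltr0n.
  have [_ [p [bp qp] <-] hp] := inf_adherent k0 (infE q bq).
  by exists (exist _ p bp).
have [f hf] := choice next.
have bid : bad id by split => //; apply: id_proj.
pose s := fix s k : {q | bad q} := if k is k'.+1 then f (s k', k') else exist _ id bid.
pose q k := sval (s k).
have bq k : bad (q k) by exact: (svalP (s k)).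
have pq k : projection M (q k) by case: (bq k).
have Mq k : M (q k) by case: (pq k).
have qS k : q k \o q k.+1 = q k.+1 by case: (hf (s k, k)).
have qt k : tr (q k.+1) < inf (E (q k)) + k.+1%:R^-1 by case: (hf (s k, k)).
have qle k l : (k <= l)%N -> q k \o q l = q l.
  elim: l => [|l IH]; first by rewrite leqn0 => /eqP ->; case: (pq 0%N).
  rewrite leq_eqVlt => /predU1P[->|]; first by case: (pq l.+1).
  rewrite ltnS => /IH h; rewrite -(qS l); apply/funext => v /=.
  exact: compE h.
have ex v : exists w, hcv (fun k => q k v) w.
  apply: (@hcv_monotone _ _ _ (fun k => nr (q k v) ^+ 2)) => [k|k l kl]; first exact: sqr_ge0.
  have c : rdot (q k v) (q l v) = nr (q l v) ^+ 2.
    rewrite (proj_symm (pq k)) (compE _ (qle _ _ kl)) -(projK v (pq l)).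
    by rewrite -(proj_symm (pq l)) projK // rdotxx.
  rewrite nr_sqrB c; lra.
have [p hp] := choice ex.
have bq1 k : nr_bounded 1 (q k).
  move=> v; rewrite mul1r.
  have h : rdot (q k v) v = nr (q k v) ^+ 2 by rewrite -rdotxx [RHS](proj_symm (pq k)) (projK _ (pq k)) rdotC.
  have [->|n0] := eqVneq (nr (q k v)) 0; first exact: nr_ge0.
  rewrite -(@ler_pM2l _ (nr (q k v))) ?lt_def ?n0 ?nr_ge0 // -expr2 -h.
  exact: rdot_le.
have [Mp trp] := vna_strong_limit hM ler01 Mq bq1 hp.
have qp k v : q k (p v) = p v.
  apply: (@hcv_uniq _ _ (fun l => q k (q (l + k)%N v))).
    exact: (hcv_op (vna_op hM (Mq k)) (hcv_shift k (hp v))).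
  rewrite (_ : (fun l => _) = (fun l => q (l + k)%N v)); first exact: (hcv_shift k (hp v)).
  by apply/funext => l; rewrite (compE _ (qle _ _ (leq_addl l k))).
have qpo k : q k \o p = p by apply/funext => v; apply: qp.
have pp : projection M p.
  split=> //.
    apply/funext => v /=; apply: (hcv_uniq (hp (p v))).
    by under eq_fun do rewrite qp; apply: hcv_cst.
  apply: symm_is_adjoint; first exact: lM.
  move=> u v.
  have h1 : (fun k => rdot (q k u) v) @ \oo --> rdot (p u) v by apply: hcv_rdot.
  have h2 : (fun k => rdot (q k v) u) @ \oo --> rdot (p v) u by apply: hcv_rdot.
  have hh : (fun k => rdot (q k u) v) = (fun k => rdot (q k v) u).
    by apply/funext => k; rewrite proj_symm // rdotC.
  rewrite hh in h1; rewrite (rdotC u); apply: cvg_unique h1 h2.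
  exact: norm_hausdorff.
have trqp k : tr p <= tr (q k).
  have [h _] := proj_sub pp (pq k) (qpo k).
  by have := tr_proj_ge0 h; rewrite trB // subr_ge0.
(* If p were fine, so would be q_N = (q_N - p) + p for large N, since q_N - p has trace at most
   e. *)
have np : ~ fine_partition e p.
  move=> fp; have /cvgrPdist_lt/(_ _ e0)[N _ hN] := trp.
  have [h _] := proj_sub pp (pq N) (qpo N).
  case: (bq N) => _; apply.
  have -> : q N = (q N - p) + p by rewrite subrK.
  apply: fine_add => //.
    apply: fine_atom => //; right; rewrite trB //.
    have := hN N (leqnn N) => /=; rewrite distrC => /ltW; apply: le_trans.
    exact: ler_norm.
  move=> v; change (q N (p v) - p (p v) = 0).
  by rewrite qp (projK _ pp) subrr.
have bp : bad p by [].
have p0 : p != 0.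
  apply/negP => /eqP p0; apply: np; apply: fine_atom => //; right.
  by rewrite p0 /tr (tau0 hM) /= ltW.
have [r [pr r0 rE rp]] : exists r, [/\ projection M r, r != 0, r != p & p \o r = r].
  apply: contrapT => h; apply: np; apply: fine_atom => //; left; split => // r pr rE.
  by apply: contrapT => /not_orP[/eqP r0 /eqP rp]; apply: h; exists r.
(* A bad r' under p is under every q_N, so tr r' >= inf E(q_N) > tr q_(N+1) - 1/(N+1) >= tr p -
   1/(N+1). Both r and p - r have smaller trace than p, and one of them is bad. *)
have absurd r' : bad r' -> p \o r' = r' -> tr r' < tr p -> False.
  move=> br' rE' lt.
  have /cvgrPdist_lt/(_ (tr p - tr r'))[|N _ hN] := @cvg_harmonic R.
    by rewrite subr_gt0.
  have h1 : inf (E (q N)) <= tr r'.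
    apply: ge_inf; first exact: (infE _ (bq N)).2.
    exists r' => //; split => //; apply/funext => v /=.
    by rewrite -rE' /= qp.
  have := hN N (leqnn N); rewrite /harmonic /= sub0r normrN ger0_norm ?invr_ge0 //.
  have := qt N; have := trqp N.+1; move: (N.+1%:R^-1) => a; lra.
have [prp rp'] := proj_sub pr pp rp.
have [Mr _ _] := pr.
have [b|b] := bad_sub _ _ pr bp rp.
  apply: (absurd _ b rp).
  have : 0 < tr (p - r).
    by apply: tr_proj_gt0 => //; apply: contra_neq rE => /eqP; rewrite subr_eq0 => /eqP.
  by rewrite trB // subr_gt0.
apply: (absurd _ b rp'); rewrite trB // ltrBlDr ltrDl.
exact: tr_proj_gt0.
Qed.

End Partition.

(** * The bimodule L^2(M (x) M^o) *)

Section Bimodule.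
Context {R : realType} {H : hilbertType R}.
Variables (M : set (H -> H)) (tau : (H -> H) -> R[i]).
Hypotheses (hM : tracial_vna M tau) (hab : abelian_alg M).
Context {K : hilbertType R}.
Variables (pi : (H -> H) -> (H -> H) -> K -> K) (Om : K).
Hypothesis hK : is_L2_tensor M tau pi Om.
Implicit Types (S T x y a b p q : H -> H) (c e : R) (f g z : K).

Let M1 : M id. Proof. exact: (star_alg_id (vna_star hM)). Qed.
Let Mc x y : M x -> M y -> M (x \o y). Proof. exact: (star_alg_comp (vna_star hM)). Qed.
Let Ma x : M x -> M (adj x). Proof. exact: (vna_adj hM). Qed.

Lemma pi_op x y : M x -> M y -> bounded_op (pi x y).
Proof. exact: (L2_bounded hK). Qed.

Lemma pi_lin x y : M x -> M y -> linear (pi x y).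
Proof. by move=> Mx My; apply/bounded_op_linear/pi_op. Qed.

Lemma pi_comp x y a b f : M x -> M y -> M a -> M b ->
  pi x y (pi a b f) = pi (x \o a) (b \o y) f.
Proof. by move=> Mx My Mxa Mb; rewrite -(L2_mul hK). Qed.

Lemma pi_comm x y a b f : M x -> M y -> M a -> M b ->
  pi x y (pi a b f) = pi a b (pi x y f).
Proof.
move=> Mx My Mxa Mb; rewrite !pi_comp //.
by rewrite (hab Mx Mxa) (hab My Mb).
Qed.

Lemma pi_id f : pi id id f = f. Proof. by rewrite (L2_unital hK). Qed.

Lemma piBl x x' y f : M x -> M x' -> M y -> pi (x - x') y f = pi x y f - pi x' y f.
Proof.
move=> Mx Mx' My; rewrite addrC -scaleN1r (L2_linearl hK) //.
by rewrite -[LHS]/(-1 *: pi x' y f + pi x y f) scaleN1r addrC.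
Qed.

Lemma piBr x y y' f : M x -> M y -> M y' -> pi x (y - y') f = pi x y f - pi x y' f.
Proof.
move=> Mx My My'; rewrite addrC -scaleN1r (L2_linearr hK) //.
by rewrite -[LHS]/(-1 *: pi x y' f + pi x y f) scaleN1r addrC.
Qed.

Lemma piDl x x' y f : M x -> M x' -> M y -> pi (x + x') y f = pi x y f + pi x' y f.
Proof.
by move=> Mx Mx' My; rewrite -{1}[x]scale1r (L2_linearl hK) // scale1r.
Qed.

Lemma piDr x y y' f : M x -> M y -> M y' -> pi x (y + y') f = pi x y f + pi x y' f.
Proof.
by move=> Mx My My'; rewrite -{1}[y]scale1r (L2_linearr hK) // scale1r.
Qed.

Lemma pi0l y f : M y -> pi 0 y f = 0.
Proof. by move=> My; have := piBl f M1 M1 My; rewrite !subrr. Qed.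

Lemma pi0r x f : M x -> pi x 0 f = 0.
Proof. by move=> Mx; have := piBr f Mx M1 M1; rewrite !subrr. Qed.

Lemma piZl (c : R[i]) x y f : M x -> M y -> pi (c *: x) y f = c *: pi x y f.
Proof.
move=> Mx My; rewrite -[c *: x]addr0 (L2_linearl hK) //; last exact: (alg_zero (vna_star hM)).
by rewrite -[LHS]/(c *: pi x y f + pi 0 y f) pi0l // addr0.
Qed.

Lemma piZr (c : R[i]) x y f : M x -> M y -> pi x (c *: y) f = c *: pi x y f.
Proof.
move=> Mx My; rewrite -[c *: y]addr0 (L2_linearr hK) //; last exact: (alg_zero (vna_star hM)).
by rewrite -[LHS]/(c *: pi x y f + pi x 0 f) pi0r // addr0.
Qed.

Lemma pi_rdot_adj x y f g : M x -> M y ->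
  rdot (pi x y f) g = rdot f (pi (adj x) (adj y) g).
Proof. by move=> Mx My; apply: is_adjoint_rdot; apply: (L2_adj hK). Qed.

Lemma pi_rdot_adjl x y f g : M x -> M y ->
  rdot (pi (adj x) (adj y) f) g = rdot f (pi x y g).
Proof. by move=> Mx My; rewrite rdotC -pi_rdot_adj // rdotC. Qed.

Lemma adj_id : adj (@id H) = id. Proof. exact: adjE. Qed.

Lemma vna_adjK x : M x -> adj (adj x) = x.
Proof. by move=> Mx; apply: adjK; apply: (alg_is_adj (vna_star hM)). Qed.

Definition vec x y := pi x y Om.

Lemma tau_adj_tr x : M x -> tau (adj x \o x) = (tr tau (adj x \o x))%:C.
Proof. by move=> Mx; rewrite /tr RRe_real // ger0_real // (tvna_positive hM). Qed.

Lemma vec_nr x y : M x -> M y ->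
  nr (vec x y) ^+ 2 = tr tau (adj x \o x) * tr tau (adj y \o y).
Proof.
move=> Mx My; have Mx' := Ma Mx; have My' := Ma My.
rewrite -rdotxx /vec pi_rdot_adj // rdotC pi_comp //.
rewrite /rdot (L2_trace hK (Mc Mx' Mx) (Mc My My')) (hab My (Ma My)) tau_adj_tr // tau_adj_tr //.
by rewrite -rmorphM.
Qed.

Lemma tr_id : tr tau id = 1. Proof. by rewrite /tr (tvna_unital hM). Qed.

Lemma vec_nrl x : M x -> nr (vec x id) ^+ 2 = tr tau (adj x \o x).
Proof. by move=> Mx; rewrite vec_nr // adj_id tr_id mulr1. Qed.

Lemma vec_nrr x : M x -> nr (vec id x) = nr (vec x id).
Proof.
move=> Mx; apply/eqP; rewrite -(@eqrXn2 _ 2) ?nr_ge0 // vec_nrl //.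
by rewrite vec_nr // adj_id tr_id mul1r.
Qed.

Lemma vec_nr_adj x : M x -> nr (vec (adj x) id) = nr (vec x id).
Proof.
move=> Mx; have Mx' := Ma Mx.
apply/eqP; rewrite -(@eqrXn2 _ 2) ?nr_ge0 // !vec_nrl //.
by rewrite vna_adjK // (hab Mx Mx').
Qed.

Lemma norm2E x : M x -> norm2 tau x = (nr (vec x id))%:C.
Proof.
move=> Mx; rewrite /norm2 tau_adj_tr // -vec_nrl // rmorphXn sqrCK //.
by rewrite ler0c nr_ge0.
Qed.

Lemma vec_proj p q : projection M p -> projection M q ->
  nr (vec p q) ^+ 2 = (tr tau p) * (tr tau q).
Proof.
by move=> [Mp pp ap] [Mq qq aq]; rewrite vec_nr // (adjE ap) (adjE aq) pp qq.
Qed.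

Lemma rdot_Om x y : projection M x -> projection M y ->
  rdot (vec x y) Om = tr tau x * tr tau y.
Proof.
move=> px py; have [Mx _ _] := px; have [My _ _] := py.
by rewrite /rdot (L2_trace hK) // (tau_projE hM px) (tau_projE hM py) -rmorphM.
Qed.

Lemma nr_Om : nr Om = 1.
Proof.
apply/eqP; rewrite -(@eqrXn2 _ 2) ?nr_ge0 // expr1n -(pi_id Om).
by rewrite -/(vec id id) vec_proj ?tr_id ?mulr1 //; apply: (id_proj hM).
Qed.

Lemma vec_dense f : (forall a b, M a -> M b -> rdot f (vec a b) = 0) -> f = 0.
Proof.
move=> h; apply/nr0_eq0/eqP; rewrite eq_le nr_ge0 andbT.
apply/ler_addgt0Pl => e e0; rewrite addr0.
have e0' : 0 < e%:C by rewrite ltcR.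
have : closure (tensor_vectors M pi Om) f by rewrite (L2_cyclic hK).
move=> /(_ (ball f e%:C)) [|v [[m [a [b [Ma' Mb vE]]]]]]; first exact: nbhsx_ballx.
rewrite -ball_normE /= nrE ltcR => fv.
have fv0 : rdot f v = 0.
  by rewrite vE rdot_sumr big1 // => i _; apply: h.
have := nr_sqrB f v; rewrite fv0 => h1.
rewrite (le_trans _ (ltW fv)) // nr_le_sqr h1.
by have := sqr_ge0 (nr v); lra.
Qed.

Definition comm_map x f := pi x id f - pi id x f.

Lemma comm_op x : M x -> bounded_op (comm_map x).
Proof.
move=> Mx; have [c c0 hc] := bounded_op_nr (pi_op Mx M1).
have [d d0 hd] := bounded_op_nr (pi_op M1 Mx).
apply: (@nr_bounded_op _ _ _ (c + d)).
  move=> a u v; rewrite /comm_map (pi_lin Mx M1) (pi_lin M1 Mx).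
  by rewrite scalerBr opprD addrACA.
move=> v; rewrite mulrDl; apply: le_trans (nrB _ _) _; exact: lerD.
Qed.

Lemma comm_lin x : M x -> linear (comm_map x).
Proof. by move=> Mx; apply/bounded_op_linear/comm_op. Qed.

Lemma comm_pi x a b f : M x -> M a -> M b -> pi a b (comm_map x f) = comm_map x (pi a b f).
Proof.
move=> Mx Mxa Mb; rewrite /comm_map (linB _ _ (pi_lin Mxa Mb)).
by rewrite (pi_comm f Mxa Mb Mx M1) (pi_comm f Mxa Mb M1 Mx).
Qed.

Lemma comm_comm x y f : M x -> M y -> comm_map x (comm_map y f) = comm_map y (comm_map x f).
Proof.
by move=> Mx My; rewrite {1}/comm_map !comm_pi // -(linB _ _ (comm_lin My)).
Qed.

Lemma comm_rdot x f g : M x -> rdot (comm_map x f) g = rdot f (comm_map (adj x) g).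
Proof. by move=> Mx; rewrite rdotBl rdotBr !pi_rdot_adj // adj_id. Qed.

Lemma comm_normal x f : M x -> nr (comm_map (adj x) f) = nr (comm_map x f).
Proof.
move=> Mx; apply/eqP; rewrite -(@eqrXn2 _ 2) ?nr_ge0 // -!rdotxx.
have Mx' := Ma Mx; apply/eqP.
by rewrite comm_rdot // vna_adjK // [RHS]comm_rdot // comm_comm.
Qed.

Lemma commZ (c : R[i]) x f : M x -> comm_map (c *: x) f = c *: comm_map x f.
Proof. by move=> Mx; rewrite /comm_map piZl // piZr // scalerBr. Qed.

Lemma commD x y f : M x -> M y -> comm_map (x + y) f = comm_map x f + comm_map y f.
Proof. by move=> Mx My; rewrite /comm_map piDl // piDr // opprD addrACA. Qed.

Lemma commB x y f : M x -> M y -> comm_map (x - y) f = comm_map x f - comm_map y f.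
Proof. by move=> Mx My; rewrite /comm_map piBl // piBr // !opprD !opprK addrACA. Qed.

Lemma comm_id f : comm_map id f = 0.
Proof. by rewrite /comm_map subrr. Qed.

Lemma comm_leibniz x y f : M x -> M y ->
  comm_map (x \o y) f = pi x id (comm_map y f) + pi id y (comm_map x f).
Proof.
move=> Mx My; rewrite {2 3}/comm_map (linB _ _ (pi_lin Mx M1)) (linB _ _ (pi_lin M1 My)).
rewrite (pi_comm f Mx M1 M1 My) addrA subrK /comm_map !pi_comp //.
Qed.

End Bimodule.

(** * Diagonal vectors *)

Section Diagonal.
Context {R : realType} {H : hilbertType R}.
Variables (M : set (H -> H)) (tau : (H -> H) -> R[i]).
Hypotheses (hM : tracial_vna M tau) (hab : abelian_alg M).
Context {K : hilbertType R}.
Variables (pi : (H -> H) -> (H -> H) -> K -> K) (Om : K).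
Hypothesis hK : is_L2_tensor M tau pi Om.
Variable A : set (H -> H).
Hypotheses (hA : unital_star_alg A) (hAM : weakly_dense A M).
Implicit Types (S T x y a b p q : H -> H) (c e : R) (f g z : K).

Let lM T : M T -> linear T. Proof. exact: vna_lin hM T. Qed.
Let M1 : M id. Proof. exact: (star_alg_id (vna_star hM)). Qed.
Let A1 : A id. Proof. exact: (star_alg_id hA). Qed.
Let Mc x y : M x -> M y -> M (x \o y). Proof. exact: (star_alg_comp (vna_star hM)). Qed.
Let Ma x : M x -> M (adj x). Proof. exact: (vna_adj hM). Qed.
Let AM x : A x -> M x. Proof. exact: hAM.1 x. Qed.
Local Notation vec := (vec pi Om).
Local Notation comm := (comm_map pi).
Let MB x y : M x -> M y -> M (x - y). Proof. exact: (alg_sub (vna_star hM)). Qed.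

Lemma vec_density T e : M T -> 0 < e -> exists2 S, A S & nr (vec (T - S) id) <= e.
Proof.
have sym T' e' : M T' -> symm T' -> 0 < e' -> exists2 S, A S & nr (vec (T' - S) id) <= e'.
  move=> MT' sT' e0; have e2 : 0 < e' ^+ 2 by rewrite exprn_gt0.
  have [S AS hS] := density2 hM hab hA hAM MT' sT' e2.
  exists S => //; rewrite -ler_sqr ?nnegrE ?nr_ge0 ?(ltW e0) //.
  have MS := AM AS.
  rewrite (vec_nrl hM hab hK) ?MB //; last exact: MB.
  by apply: le_trans hS; apply: le_trans (ler_norm _) _; apply: Re_le_norm.
move=> MT e0; have [T1 [T2 [M1' M2 s1 s2 ->]]] := symm_decomposition hM (vna_star hM) (fun x h => h) MT.
have e2 : 0 < e / 2 by rewrite divr_gt0.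
have [S1 AS1 h1] := sym _ _ M1' s1 e2.
have [S2 AS2 h2] := sym _ _ M2 s2 e2.
have MT1S := MB M1' (AM AS1); have MT2S := MB M2 (AM AS2).
exists (S1 + 'i *: S2); first exact: (alg_add hA AS1 (alg_scale hA 'i AS2)).
have -> : T1 + 'i *: T2 - (S1 + 'i *: S2) = (T1 - S1) + 'i *: (T2 - S2).
  by rewrite scalerBr opprD addrACA.
rewrite /vec (piDl hK) //; last exact: (alg_scale (vna_star hM)).
rewrite (piZl hM hK) // [e]splitr; apply: le_trans (nrD _ _) _; apply: lerD => //.
by rewrite nrZ normc_def /= expr0n expr1n add0r sqrtr1 mul1r.
Qed.

Lemma vec_nrM x y : M x -> M y -> nr (vec x y) = nr (vec x id) * nr (vec y id).
Proof.
move=> Mx My; apply/eqP; rewrite -(@eqrXn2 _ 2) ?mulr_ge0 ?nr_ge0 //.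
by rewrite exprMn (vec_nrl hM hab hK Mx) (vec_nrl hM hab hK My) (vec_nr hM hab hK).
Qed.

(** Carries identities from A to M, one tensor leg at a time. *)
Lemma vec_extension (F : (H -> H) -> R) c :
  (forall x y, M x -> M y -> F (x - y) = F x - F y) ->
  (forall x, M x -> `|F x| <= c * nr (vec x id)) ->
  (forall x, A x -> F x = 0) -> forall x, M x -> F x = 0.
Proof.
move=> FB Fc FA x Mx; apply/normr0_eq0/eqP; rewrite eq_le normr_ge0 andbT.
apply/ler_addgt0Pl => e e0; rewrite addr0.
have c1 : 0 < `|c| + 1 by rewrite ltr_wpDl.
have ec : 0 < e / (`|c| + 1) by rewrite divr_gt0.
have [S AS hS] := vec_density Mx ec.
have -> : F x = F (x - S) by rewrite FB ?(FA _ AS) ?subr0 //; apply: AM.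
apply: le_trans (Fc _ (MB Mx (AM AS))) _.
apply: (@le_trans _ _ ((`|c| + 1) * (e / (`|c| + 1)))); last by rewrite mulrC divfK ?gt_eqF.
apply: le_trans (ler_wpM2r (nr_ge0 _) (_ : c <= `|c| + 1)) _.
  by apply: le_trans (ler_norm _) _; rewrite lerDl.
by rewrite ler_wpM2l // ltW.
Qed.

Lemma vec_dense_alg f : (forall a b, A a -> A b -> rdot f (vec a b) = 0) -> f = 0.
Proof.
move=> h; apply: (vec_dense hK) => a b; move: a.
have hl b' : A b' -> forall a, M a -> rdot f (vec a b') = 0.
  move=> Ab; apply: (@vec_extension (fun a => rdot f (vec a b')) (nr f * nr (vec b' id))).
  - by move=> x y Mx My; rewrite /vec (piBl hK) ?rdotBr //; apply: AM.
  - move=> x Mx; apply: le_trans (rdot_abs_le _ _) _.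
    by rewrite (vec_nrM Mx (AM Ab)) mulrAC mulrA.
  - by move=> x Ax; apply: h.
move=> a Mxa; move: b.
apply: (@vec_extension (fun b => rdot f (vec a b)) (nr f * nr (vec a id))).
- by move=> x y Mx My; rewrite /vec (piBr hK) ?rdotBr.
- move=> x Mx; apply: le_trans (rdot_abs_le _ _) _.
  by rewrite (vec_nrM Mxa Mx) mulrA.
- by move=> x Ax; apply: hl.
Qed.

(** Approximating each leg in 2-norm moves a (x) b from M to A. Hence every f in K may define an
    inner derivation with values in the prescribed range. *)
Lemma L2_alg_full f : L2_alg A pi Om f.
Proof.
have approx a b e : M a -> M b -> 0 < e ->
    exists ab : (H -> H) * (H -> H), [/\ A ab.1, A ab.2 & nr (vec a b - vec ab.1 ab.2) <= e].
  move=> Mxa Mb e0.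
  pose cb := nr (vec b id) + 1; have cb0 : 0 < cb by rewrite ltr_wpDl ?nr_ge0.
  have e1 : 0 < e / 2 / cb by rewrite !divr_gt0.
  have [S AS hS] := vec_density Mxa e1; have MS := AM AS.
  pose cs := nr (vec S id) + 1; have cs0 : 0 < cs by rewrite ltr_wpDl ?nr_ge0.
  have e2 : 0 < e / 2 / cs by rewrite !divr_gt0.
  have [T AT hT] := vec_density Mb e2; have MT := AM AT.
  exists (S, T); split => //=.
  apply: le_trans (nr_split (vec S b) _ _) _.
  have -> : vec a b - vec S b = vec (a - S) b by rewrite /vec (piBl hK).
  have -> : vec S b - vec S T = vec S (b - T) by rewrite /vec (piBr hK).
  rewrite (vec_nrM (MB Mxa MS) Mb) (vec_nrM MS (MB Mb MT)).
  rewrite [e]splitr; apply: lerD.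
    apply: (@le_trans _ _ (e / 2 / cb * cb)); last by rewrite divfK // gt_eqF.
    by apply: ler_pM; rewrite ?nr_ge0 // lerDl.
  apply: (@le_trans _ _ (cs * (e / 2 / cs))); last by rewrite mulrC divfK // gt_eqF.
  by apply: ler_pM; rewrite ?nr_ge0 // lerDl.
move=> B /nbhs_ballP[e0 /= /pos_complexE[e0p ->]] eB.
set e := complex.Re e0 in e0p eB.
have e2 : 0 < (e / 2)%:C by rewrite ltcR divr_gt0.
have : closure (tensor_vectors M pi Om) f by rewrite (L2_cyclic hK).
move=> /(_ (ball f (e / 2)%:C)) [|v [[m [a [b [Ma' Mb vE]]]]]]; first exact: nbhsx_ballx.
rewrite -ball_normE /= nrE ltcR => fv.
have em : 0 < e / 2 / m.+1%:R by rewrite !divr_gt0 ?ltr0n.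
have [ab hab'] := choice (fun i => approx (a i) (b i) _ (Ma' i) (Mb i) em).
exists (\sum_(i < m) pi (ab i).1 (ab i).2 Om); split.
  exists m, (fun i => (ab i).1), (fun i => (ab i).2).
  by split => // i; case: (hab' i).
apply: eB; rewrite -ball_normE /= nrE ltcR.
apply: le_lt_trans (nr_split v _ _) _; rewrite [e]splitr; apply: ltr_leD fv _.
rewrite vE -sumrB.
have nrsum (I : finType) (F : I -> K) : nr (\sum_i F i) <= \sum_i nr (F i).
  by elim/big_ind2 : _ => [|x s y t hx hy|//]; rewrite ?nr0 // (le_trans (nrD _ _)) ?lerD.
apply: le_trans (nrsum _ _) _.
apply: (@le_trans _ _ (\sum_(i < m) e / 2 / m.+1%:R)).
  by apply: ler_sum => i _; case: (hab' i).
rewrite sumr_const card_ord -[X in X <= _]mulr_natr -[_ / _ * _]mulrA ler_piMr //.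
  by rewrite divr_ge0 // ltW.
by rewrite mulrC ler_pdivrMr ?ltr0n // mul1r ler_nat.
Qed.

(** The central vectors of the A-A bimodule K. *)
Definition diag f := forall x, A x -> comm x f = 0.

(** Tested on a (x) b, [x, f] becomes the pairing of a^* f b^* with [x^*, 1 (x) 1], a vector of norm
    at most twice the 2-norm of x; so [vec_extension] applies. *)
Lemma diag_vna f x : diag f -> M x -> comm x f = 0.
Proof.
move=> df Mx; apply: (vec_dense hK) => a b Mxa Mb.
move: x Mx; apply: (@vec_extension _ (nr (pi (adj a) (adj b) f) * 2)).
- by move=> x y Mx My; rewrite (commB hM hK) // rdotBl.
- move=> x Mx; have Mx' := Ma Mx.
  rewrite (comm_rdot hM hK) // -(comm_pi hM hab hK) // -(pi_rdot_adjl hK) //.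
  apply: le_trans (rdot_abs_le _ _) _; rewrite -mulrA ler_wpM2l ?nr_ge0 //.
  apply: le_trans (nrB _ _) _.
  rewrite -!/(vec _ _) (vec_nrr hM hab hK) // (vec_nr_adj hM hab hK) //.
  lra.
- by move=> x Ax; rewrite df ?rdot0l.
Qed.

Lemma comm_minimal p x f : minimal_projections M p -> M x -> comm x (pi p p f) = 0.
Proof.
move=> hp; have [[Mp pp _] _ _] := hp.
have sym y : M y -> symm y -> comm y (pi p p f) = 0.
  move=> My sy; have [l hl] := minimal_projection_scalar hM hab hp My sy.
  have yp : y \o p = l%:C *: p by apply/funext.
  rewrite /comm !(pi_comp hK) // yp (hab Mp My) yp.
  rewrite (piZl hM hK) // (piZr hM hK) //; apply: subrr.
move=> Mx; have [x1 [x2 [M1' M2 s1 s2 ->]]] := symm_decomposition hM (vna_star hM) (fun x h => h) Mx.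
have Mi : M ('i *: x2) by exact: (alg_scale (vna_star hM)).
by rewrite (commD hM hK) // (commZ hM hK) // !sym // scaler0 addr0.
Qed.

Lemma diag_pi f a b : diag f -> M a -> M b -> diag (pi a b f).
Proof.
move=> df Mxa Mb x Ax; rewrite -(comm_pi hM hab hK) ?df // ?(lin0 (pi_lin hK Mxa Mb)) //.
exact: AM.
Qed.

Lemma diag_proj f q : diag f -> projection M q -> pi q q f = pi q id f.
Proof.
move=> df pq; have [Mq qq _] := pq.
have /eqP := diag_vna df Mq; rewrite /comm subr_eq0 => /eqP h.
have -> : pi q q f = pi q id (pi id q f) by rewrite (pi_comp hK).
by rewrite -h (pi_comp hK) // qq.
Qed.

(* A fine partition of q into minimal projections F and small projections q_i splits
   the part of a diagonal vector under q into the parts under p (x) p for p in F and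
   under sum_i q_i (x) q_i; here w is (sum_i q_i (x) q_i) Om. *)
Lemma fine_partition_diag e q : 0 <= e -> fine_partition M tau e q ->
  projection M q /\ exists (F : seq (H -> H)) (w : K),
    [/\ forall p, p \in F -> minimal_projections M p /\ q \o p = p, uniq F,
        nr w ^+ 2 <= e * tr tau q, pi q q w = w &
        forall z, diag z -> rdot (pi q id z) Om =
           \sum_(p <- F) rdot z (vec p p) + rdot z w].
Proof.
move=> e0; elim=> {q} [q pq [mq|tq]|q r _ [pq [F [w [hF uF nw ww hz]]]] _ [pr [G [v [hG uG nv vv hz']]]] qr].
- split=> //; exists [:: q], 0; have [Mq qq aq] := pq; split=> //.
  + by move=> p; rewrite inE => /eqP ->.
  + by rewrite nr0 expr0n mulr_ge0 // (tr_proj_ge0 hM).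
  + exact: (lin0 (pi_lin hK Mq Mq)).
  + move=> z dz; rewrite big_seq1 rdot0r addr0 -(diag_proj dz pq).
    by rewrite (pi_rdot_adj hK) // (adjE aq).
- split=> //; exists [::], (vec q q); have [Mq qq aq] := pq; split=> //.
  + by rewrite (vec_proj hM hab hK) // ler_wpM2r // (tr_proj_ge0 hM).
  + by rewrite /vec (pi_comp hK) // qq.
  + move=> z dz; rewrite big_nil add0r -(diag_proj dz pq).
    by rewrite (pi_rdot_adj hK) // (adjE aq).
have [Mq qq aq] := pq; have [Mr rr ar] := pr.
have rq u : r (q u) = 0 by rewrite (vna_comm hab u Mr Mq).
have MQ : M (q + r) by exact: (alg_add (vna_star hM)).
have pqr : projection M (q + r).
  split=> //.
    apply/funext => u; change (q (q u + r u) + r (q u + r u) = q u + r u).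
    rewrite (linD _ _ (lM Mq)) (linD _ _ (lM Mr)) qr rq (projK _ pq) (projK _ pr).
    by rewrite addr0 add0r.
  apply: symm_is_adjoint; first exact: lM.
  move=> u t; change (rdot (q u + r u) t = rdot u (q t + r t)).
  by rewrite rdotDl rdotDr (proj_symm pq) (proj_symm pr).
have qr0 : q \o r = 0 by apply/funext.
have rq0 : r \o q = 0 by apply/funext.
have qv x : M x -> pi q x v = 0.
  move=> Mx; rewrite -vv (pi_comp hK) // qr0 (pi0l hM hK) //; exact: Mc.
have rw x : M x -> pi r x w = 0.
  move=> Mx; rewrite -ww (pi_comp hK) // rq0 (pi0l hM hK) //; exact: Mc.
have wv0 : rdot w v = 0.
  by rewrite -ww (pi_rdot_adj hK) // (adjE aq) qv // rdot0r.
split=> //; exists (F ++ G), (w + v); split.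
- move=> p; rewrite mem_cat => /orP[/hF|/hG] [mp pE]; split=> //; apply/funext => u;
    change (q (p u) + r (p u) = p u).
    by rewrite (compE _ pE) -(compE _ pE) rq addr0.
  by rewrite (compE _ pE) -(compE _ pE) qr add0r.
- rewrite cat_uniq uF uG andbT /=; apply/hasPn => p /hG[[_ p0 _] rp].
  apply/negP => /hF[_ qp]; case/eqP: p0; apply/funext => u.
  by rewrite -(compE u qp) -(compE u rp) qr.
- rewrite nr_sqrD wv0 mulr0 addr0 (trD hM) // mulrDr; exact: lerD.
- rewrite (linD _ _ (pi_lin hK MQ MQ)) !(piDl hK) // !(piDr hK) // ww vv !qv // !rw //.
  have rqw : pi q r w = 0.
    by rewrite -ww (pi_comp hK) // qr0 (pi0r hM hK) //; exact: Mc.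
  have qrv : pi r q v = 0.
    by rewrite -vv (pi_comp hK) // rq0 (pi0r hM hK) //; exact: Mc.
  by rewrite rqw qrv !addr0 !add0r.
- move=> z dz; rewrite (piDl hK) // rdotDl hz // hz' // big_cat /= rdotDr.
  by rewrite addrACA.
Qed.

End Diagonal.

(** * Derivations with 1 (x) 1 in the domain of the adjoint *)

Section BoundedDerivation.
Context {R : realType} {H : hilbertType R}.
Variables (M : set (H -> H)) (tau : (H -> H) -> R[i]).
Hypotheses (hM : tracial_vna M tau) (hab : abelian_alg M).
Context {K : hilbertType R}.
Variables (pi : (H -> H) -> (H -> H) -> K -> K) (Om : K).
Hypothesis hK : is_L2_tensor M tau pi Om.
Variable A : set (H -> H).
Hypotheses (hA : unital_star_alg A) (hAM : weakly_dense A M).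
Implicit Types (S T x y a b p q : H -> H) (f g z : K) (delta : (H -> H) -> K).

Let lM T : M T -> linear T. Proof. exact: vna_lin hM T. Qed.
Let M1 : M id. Proof. exact: (star_alg_id (vna_star hM)). Qed.
Let A1 : A id. Proof. exact: (star_alg_id hA). Qed.
Let Mc x y : M x -> M y -> M (x \o y). Proof. exact: (star_alg_comp (vna_star hM)). Qed.
Let Ac x y : A x -> A y -> A (x \o y). Proof. exact: (star_alg_comp hA). Qed.
Let Ma x : M x -> M (adj x). Proof. exact: (vna_adj hM). Qed.
Let AM x : A x -> M x. Proof. exact: hAM.1 x. Qed.
Local Notation vec := (vec pi Om).
Let MB x y : M x -> M y -> M (x - y). Proof. exact: (alg_sub (vna_star hM)). Qed.

(** The form of the condition defining [Der_1x1] used below: real constant, real part of the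
    pairing. It is stable under x |-> a delta(x) b, see [bder_twist]. *)
Record bounded_derivation delta : Prop := {
  bder_linear : forall (c : R[i]) x y, A x -> A y ->
    delta (c *: x + y) = c *: delta x + delta y;
  bder_leibniz : forall x y, A x -> A y ->
    delta (x \o y) = pi x id (delta y) + pi id y (delta x);
  bder_bounded : exists2 C : R, 0 <= C &
    forall x, A x -> `|rdot (delta x) Om| <= C * nr (vec x id) }.

Section Fixed.
Variable delta : (H -> H) -> K.
Hypothesis hd : bounded_derivation delta.

Lemma bder_id : delta id = 0.
Proof.
have := bder_leibniz hd A1 A1; rewrite !(pi_id hK) => /eqP.
by rewrite -subr_eq0 opprD addrA subrr sub0r oppr_eq0 => /eqP.
Qed.

Lemma bder0 : delta 0 = 0.
Proof.
have := bder_linear hd (-1) A1 A1.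
by rewrite !scaleN1r !addNr.
Qed.

Lemma bderZ (c : R[i]) x : A x -> delta (c *: x) = c *: delta x.
Proof.
by move=> Ax; have := bder_linear hd c Ax (alg_zero hA); rewrite bder0 !addr0.
Qed.

Lemma bderD x y : A x -> A y -> delta (x + y) = delta x + delta y.
Proof. by move=> Ax Ay; rewrite -{1}[x]scale1r (bder_linear hd) // scale1r. Qed.

Lemma bder_iter c k : A c ->
  delta (iter k c) = \sum_(0 <= j < k) pi (iter j c) (iter (k.-1 - j) c) (delta c).
Proof.
move=> Ac'; have Mc' := AM Ac'.
have Mi j : M (iter j c) by exact: (alg_iter (vna_star hM)).
elim: k => [|k IH]; first by rewrite big_geq // bder_id.
have -> : iter k.+1 c = c \o iter k c by [].
rewrite (bder_leibniz hd) //; last exact: (alg_iter hA).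
rewrite IH (lin_sum _ _ _ (pi_lin hK Mc' M1)) big_nat_recl // subn0 addrC; congr (_ + _).
apply: eq_big_nat => j _; rewrite (pi_comp hK) //.
have -> // : (k.+1.-1 - j.+1 = k.-1 - j)%N.
by rewrite -[k.-1]subn1 -subnDA add1n.
Qed.

(** Commutativity keeps the Leibniz rule. For the bound, a delta(x) b = delta(a x b) - a x delta(b)
    - delta(a) x b, and each term on the right pairs with 1 (x) 1 boundedly in the 2-norm of x. *)
Lemma bder_twist a b : A a -> A b -> bounded_derivation (fun x => pi a b (delta x)).
Proof.
move=> Aa Ab; have Mxa := AM Aa; have Mb := AM Ab; split.
- move=> c x y Ax Ay; rewrite (bder_linear hd) //; exact: (pi_lin hK Mxa Mb).
- move=> x y Ax Ay; rewrite (bder_leibniz hd) // (linD _ _ (pi_lin hK Mxa Mb)).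
  by rewrite (pi_comm hab hK _ Mxa Mb) ?(pi_comm hab hK (delta x) Mxa Mb) //; apply: AM.
have [C C0 hC] := bder_bounded hd.
have [Ca Ca0 hCa] := bounded_op_nr (pi_op hK Mxa M1).
have [Cb Cb0 hCb] := bounded_op_nr (pi_op hK Mb M1).
exists (C * Ca * Cb + nr (pi a id (delta b)) + nr (pi id b (delta a))).
  by rewrite !addr_ge0 ?nr_ge0 // !mulr_ge0 // ltW.
move=> x Ax; have Mx := AM Ax; have Mx' := Ma Mx.
have -> : pi a b (delta x) = delta (a \o (x \o b)) -
    pi x id (pi a id (delta b)) - pi id x (pi id b (delta a)).
  rewrite (bder_leibniz hd) //; last exact: Ac.
  rewrite (bder_leibniz hd) // (linD _ _ (pi_lin hK Mxa M1)).
  rewrite (pi_comm hab hK _ Mx M1 Mxa M1) !(pi_comp hK) //.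
  rewrite (hab Mx Mb) (_ : a \o id = a) // (_ : b \o id = b) //.
  by vring.
rewrite !rdotBl.
have e1 : `|rdot (delta (a \o (x \o b))) Om| <= C * Ca * Cb * nr (vec x id).
  apply: le_trans (hC _ _) _; first by do 2!apply: Ac.
  rewrite -!mulrA ler_wpM2l //.
  have -> : vec (a \o (x \o b)) id = pi a id (pi b id (vec x id)).
    by rewrite /vec !(pi_comp hK) // ?(hab Mx Mb) //; apply: Mc.
  apply: le_trans (hCa _) _; rewrite ler_wpM2l //; exact: ltW.
have nx : nr (pi (adj x) id Om) = nr (vec x id).
  exact: (vec_nr_adj hM hab hK).
have nx' : nr (pi id (adj x) Om) = nr (vec x id).
  by rewrite -nx -/(vec _ _) (vec_nrr hM hab hK).
have e2 : `|rdot (pi x id (pi a id (delta b))) Om| <= nr (pi a id (delta b)) * nr (vec x id).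
  by rewrite (pi_rdot_adj hK) // adj_id -nx rdot_abs_le.
have e3 : `|rdot (pi id x (pi id b (delta a))) Om| <= nr (pi id b (delta a)) * nr (vec x id).
  by rewrite (pi_rdot_adj hK) // adj_id -nx' rdot_abs_le.
apply: le_trans (ler_normB _ _) _; apply: le_trans (lerD (ler_normB _ _) e3) _.
rewrite !mulrDl lerD2r; exact: lerD.
Qed.

End Fixed.

(* With c = 1 + i x - x^2 one has |c| <= 1 and c^* c = 1 - x^2 + x^4, which is 1
   exactly where x vanishes as long as |x| < 1.  Hence c^k converges to the projection e
   onto ker x and delta (c^k / k) = (1/k) sum_j c^j delta(c) c^(k-1-j) to e delta(c) e,
   whereas c^k / k tends to 0. *)
Lemma powers_to_kernel x : A x -> symm x -> nr_bounded 2^-1 x ->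
  let c := 'i *: x + ((-1) *: (x \o x) + id) in
  A c /\ exists e, [/\ projection M e,
    forall p, M p -> (forall v, x (p v) = 0) -> e \o p = p,
    (fun k => nr (vec (iter k c - e) id)) @ \oo --> (0 : R) &
    forall delta, bounded_derivation delta -> rdot (delta c) (vec e e) = 0].
Proof.
move=> Ax sx bx c; have Mx := AM Ax; have lx := lM Mx.
have Acc : A c.
  apply: (alg_add hA); first exact: (alg_scale hA).
  by apply: (alg_add hA) => //; apply: (alg_scale hA); apply: Ac.
split => //; have MC := AM Acc.
have ax : is_adjoint x x by exact: symm_is_adjoint.
pose cs := Num.conj 'i *: x + (Num.conj (-1) *: (x \o x) + id).
have acs : is_adjoint c cs.
  apply: is_adjoint_lin => //; apply: is_adjoint_lin => //; exact: is_adjoint_comp.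
have csE : adj c = cs by exact: adjE.
have MCs : M cs by rewrite -csE; apply: Ma.
have cE v : c v = (v - x (x v)) + 'i *: x v.
  by rewrite /c -[LHS]/('i *: x v + (-1 *: x (x v) + v)) scaleN1r; vring.
have xi v : rdot (x v) ('i *: v) = 0.
  suff : rdot (x v) ('i *: v) = - rdot (x v) ('i *: v) by lra.
  by rewrite {1}rdotC -sx linZ // rdotiC.
have cnr v : nr (c v) ^+ 2 = nr v ^+ 2 - nr (x v) ^+ 2 + nr (x (x v)) ^+ 2.
  have nri u : nr ('i *: u : H) = nr u.
    by rewrite nrZ normc_def /= expr0n expr1n add0r sqrtr1 mul1r.
  rewrite cE nr_sqrD rdotBl xi (rdotC v) rdotiC xi !(oppr0, addr0, mulr0) nri.
  rewrite nr_sqrB -(sx v) rdotxx; ring.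
have bxx v : nr (x (x v)) ^+ 2 <= 4^-1 * nr (x v) ^+ 2.
  have := bx (x v); rewrite -ler_sqr ?nnegrE ?mulr_ge0 ?invr_ge0 ?nr_ge0 // exprMn.
  by rewrite exprVn; rewrite (_ : 2 ^+ 2 = 4 :> R) //; ring.
have cnr1 v : nr (c v) <= nr v.
  by rewrite nr_le_sqr cnr; have := bxx v; have := sqr_ge0 (nr (x v)); lra.
pose G := cs \o c; have MG : M G by exact: Mc.
have GE v : rdot (G v) v = nr (c v) ^+ 2.
  by rewrite -rdotxx (is_adjoint_rdot _ _ acs) rdotC.
have sG : symm G.
  move=> u v; rewrite /G /= -(is_adjoint_rdot _ _ acs) rdotC.
  by rewrite -(is_adjoint_rdot _ _ (is_adjoint_sym acs)) rdotC.
have [v|e [pe se Ge Gfix trG]] := iter_projection hM MG sG.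
  by rewrite GE ler_sqr ?nnegrE ?nr_ge0 // /G /= -csE (vna_normal hM hab) // cnr1.
have [Me ee ae] := pe.
have ker_c v : x v = 0 -> c v = v.
  by move=> xv; rewrite cE xv (lin0 lx) subr0 scaler0 addr0.
have ker_cs v : x v = 0 -> cs v = v.
  move=> xv; rewrite -[cs v]/(Num.conj 'i *: x v + (Num.conj (-1) *: x (x v) + v)).
  by rewrite xv (lin0 lx) !scaler0 !add0r.
have xe v : x (e v) = 0.
  apply/nr0_eq0/eqP; rewrite -sqrf_eq0 eq_le sqr_ge0 andbT.
  have := GE (e v); rewrite Ge rdotxx cnr; have := bxx (e v).
  by have := sqr_ge0 (nr (x (e v))); lra.
have MCk k : M (iter k c) by exact: (alg_iter (vna_star hM)).
have ce v : c (e v) = e v by rewrite ker_c.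
have cse v : cs (e v) = e v by rewrite ker_cs.
have ack k : is_adjoint (iter k c) (iter k cs).
  elim: k => [|k IH]; first exact: is_adjoint_id.
  have -> : iter k.+1 cs = iter k cs \o cs by apply/funext => v; rewrite iterSr.
  exact: (is_adjoint_comp acs IH).
have MCsk k : M (iter k cs) by exact: (alg_iter (vna_star hM)).
have MGk k : M (iter k G) by exact: (alg_iter (vna_star hM)).
have cke k v : iter k c (e v) = e v by elim: k => //= k ->.
have cske k v : iter k cs (e v) = e v by elim: k => //= k ->.
have ae_k k : is_adjoint (iter k c - e) (iter k cs - e).
  by have := is_adjoint_lin (-1) ae (ack k); rewrite rmorphN1 !scaleN1r ![- e + _]addrC.
have GkE k v : iter k cs (iter k c v) = iter k G v.
  elim: k v => // k IH v; rewrite !iterSr -IH.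
  by rewrite (vna_comm hab _ MCs (MCk k)).
(* Since c^k e = e and likewise for c^*, the product of c^k - e with its adjoint is G^k - e, so the
   trace convergence for G gives convergence in 2-norm. *)
have u_sqr k : nr (vec (iter k c - e) id) ^+ 2 = tr tau (iter k G) - tr tau e.
  rewrite (vec_nrl hM hab hK) ?MB //; last exact: MB.
  rewrite (adjE (ae_k k)) -(trB hM) //; congr tr; apply/funext => v.
  change (iter k cs (iter k c v - e v) - e (iter k c v - e v) = iter k G v - e v).
  rewrite (linB _ _ (lM (MCsk k))) (linB _ _ (lM Me)) cske GkE.
  by rewrite (vna_comm hab v Me (MCk k)) cke (projK _ pe) subrr subr0.
pose u k := nr (vec (iter k c - e) id); pose E := nr (vec e id).
have u0 k : 0 <= u k by apply: nr_ge0.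
have E0 : 0 <= E by apply: nr_ge0.
have ucv : u @ \oo --> (0 : R).
  rewrite (_ : u = (fun k => Num.sqrt (tr tau (iter k G) - tr tau e))); last first.
    by apply/funext => k; rewrite -u_sqr sqrtr_sqr ger0_norm // nr_ge0.
  rewrite -[X in _ --> X](_ : Num.sqrt (tr tau e - tr tau e) = 0); last by rewrite subrr sqrtr0.
  apply: (continuous_cvg _ (@sqrt_continuous R _)).
  by apply: cvgB; [exact: trG | exact: cvg_cst].
exists e; split => //.
  move=> p Mp xp; apply/funext => v; apply: Gfix.
  by rewrite /G /= ker_c ?ker_cs.
move=> delta hd; set X := rdot _ _.
have [C C0 hC] := bder_bounded hd.
(* [g] decouples the two exponents: u_j u_i + E u_j + E u_i <= (g_j + g_i) / 2. Summed over j + i =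
   n, the errors then form a Cesaro mean of [g], which tends to 0. *)
pose N := nr (delta c); pose g k := u k ^+ 2 + 2 * E * u k.
have us k : nr (vec (iter k cs - e) id) = u k.
  rewrite -(adjE (ae_k k)) (vec_nr_adj hM hab hK) //; exact: MB.
have term j i : nr (vec (iter j cs) (iter i cs) - vec e e) <= (g j + g i) / 2.
  have Mje := MB (MCsk j) Me; have Mie := MB (MCsk i) Me.
  have -> : vec (iter j cs) (iter i cs) - vec e e =
      vec (iter j cs - e) (iter i cs - e) + (vec (iter j cs - e) e + vec e (iter i cs - e)).
    rewrite /vec !(piBl hK) // !(piBr hK) //; vring.
  apply: le_trans (nrD _ _) _; apply: le_trans (lerD (lexx _) (nrD _ _)) _.
  have e1 := vec_nrM hM hab hK Mje Mie; have e2 := vec_nrM hM hab hK Mje Me.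
  have e3 := vec_nrM hM hab hK Me Mie; rewrite !us -/E in e1 e2 e3.
  by rewrite e1 e2 e3 /g; have := sqr_ge0 (u j - u i); lra.
have bound n : `|X| <= C * ((u n.+1 + E) / n.+1%:R) + N * arithmetic_mean g n.
  have n0 : 0 < n.+1%:R :> R by rewrite ltr0n.
  rewrite -(ler_pM2l n0).
  have sumE : rdot (delta (iter n.+1 c)) Om =
      \sum_(0 <= j < n.+1) rdot (delta c) (vec (iter j cs) (iter (n - j) cs)).
    rewrite (bder_iter hd) // rdot_suml; apply: eq_bigr => j _.
    by rewrite (pi_rdot_adj hK) // (adjE (ack j)) (adjE (ack (n - j)%N)).
  have XE : n.+1%:R * X = rdot (delta (iter n.+1 c)) Om -
      \sum_(0 <= j < n.+1) rdot (delta c) (vec (iter j cs) (iter (n - j) cs) - vec e e).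
    rewrite sumE -sumrB (eq_bigr (fun=> X)); last first.
      by move=> j _; rewrite rdotBr opprB addrC subrK.
    by rewrite sumr_const_nat subn0 mulr_natl.
  have h1 : `|rdot (delta (iter n.+1 c)) Om| <= C * (u n.+1 + E).
    apply: le_trans (hC _ _) _; first exact: (alg_iter hA).
    rewrite ler_wpM2l //; have -> : vec (iter n.+1 c) id = vec (iter n.+1 c - e) id + vec e id.
      by rewrite /vec (piBl hK) // subrK.
    exact: nrD.
  have h2 : `|\sum_(0 <= j < n.+1) rdot (delta c) (vec (iter j cs) (iter (n - j) cs) - vec e e)|
      <= N * \sum_(0 <= j < n.+1) g j.
    apply: le_trans (ler_norm_sum _ _ _) _.
    apply: (@le_trans _ _ (\sum_(0 <= j < n.+1) N * ((g j + g (n - j)%N) / 2))).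
      apply: ler_sum => j _; apply: le_trans (rdot_abs_le _ _) _.
      by rewrite ler_wpM2l ?nr_ge0.
    rewrite -mulr_sumr ler_wpM2l ?nr_ge0 // -mulr_suml big_split /=.
    have -> : \sum_(0 <= i < n.+1) g (n - i)%N = \sum_(0 <= i < n.+1) g i.
      by rewrite [RHS]big_nat_rev; apply: eq_bigr => i _; rewrite add0n subSS.
    by rewrite mulrDl -splitr.
  rewrite -{1}(gtr0_norm n0) -normrM XE.
  apply: le_trans (ler_normB _ _) _; apply: le_trans (lerD h1 h2) _.
  rewrite /arithmetic_mean /series /= mulrDr le_eqVlt; apply/orP; left; apply/eqP.
  by field; rewrite gt_eqF.
have gcv : g @ \oo --> (0 : R).
  rewrite -[X in _ --> X](_ : 0 * 0 + 2 * E * 0 = 0); last by rewrite !mulr0 addr0.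
  under [g]eq_fun do rewrite expr2.
  by apply: cvgD; apply: cvgM => //; apply: cvg_cst.
have mcv := cesaro gcv.
have rcv : (fun n => C * ((u n.+1 + E) / n.+1%:R) + N * arithmetic_mean g n) @ \oo --> (0 : R).
  rewrite -[X in _ --> X](_ : C * ((0 + E) * 0) + N * 0 = 0); last by rewrite !mulr0 addr0.
  apply: cvgD; apply: cvgM => //; try exact: cvg_cst.
  apply: cvgM; last exact: cvg_harmonic.
  apply: cvgD; last exact: cvg_cst.
  by rewrite (cvg_shiftS u).
apply/normr0_eq0/eqP; rewrite eq_le normr_ge0 andbT.
by apply: (cvgr_to_ge rcv); apply: nearW.
Qed.

(** Applied to all twists a^* delta b^* of delta, [powers_to_kernel] gives e delta(c) e = 0, hence p
    delta(c) p = 0 because p <= e. When y p = 0, the quadratic term of c contributes nothing and p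
    delta(c) p = i p delta(y) p. A general y is first shifted by its scalar on p, as delta vanishes
    on scalars. *)
Lemma bder_minimal delta p x : bounded_derivation delta ->
  minimal_projections M p -> A x -> pi p p (delta x) = 0.
Proof.
move=> hd hp; have [[Mp pp ap] _ _] := hp.
have base y : A y -> symm y -> nr_bounded 2^-1 y -> (forall v, y (p v) = 0) ->
    pi p p (delta y) = 0.
  move=> Ay sy by2 yp; have My := AM Ay.
  have [Acc [e [pe ep _ h]]] := powers_to_kernel Ay sy by2; set c := _ + _ in Acc h.
  have [Me ee ae] := pe; have epp := ep _ Mp yp.
  have yp0 : y \o p = 0 by apply/funext.
  have ec0 : pi e e (delta c) = 0.
    apply: (vec_dense_alg hM hab hK hA hAM) => a b Aa Ab.
    have Aa' := alg_adj hA Aa; have Ab' := alg_adj hA Ab.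
    have := h _ (bder_twist hd Aa' Ab').
    rewrite (pi_rdot_adjl hK) ?AM //; try exact: AM.
    rewrite /vec (pi_comm hab hK _ (AM Aa) (AM Ab) Me Me) => <-.
    by rewrite (pi_rdot_adj hK _ _ Me Me) (adjE ae).
  have pc : pi p p (delta c) = 0.
    have -> : pi p p (delta c) = pi p p (pi e e (delta c)).
      by rewrite (pi_comp hK) // (hab Mp Me) epp.
    by rewrite ec0 (lin0 (pi_lin hK Mp Mp)).
  have lp := pi_lin hK Mp Mp.
  have dc : delta c = 'i *: delta y + (-1 *: (pi y id (delta y) + pi id y (delta y))).
    rewrite (bder_linear hd) //; last first.
      apply: (alg_add hA) => //; apply: (alg_scale hA); exact: Ac.
    rewrite (bder_linear hd) //; last exact: Ac.
    by rewrite (bder_leibniz hd) // (bder_id hd) addr0.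
  move: pc; rewrite dc (linD _ _ lp) !(linZ _ _ lp) (linD _ _ lp) !(pi_comp hK) //.
  rewrite (hab Mp My) yp0 (pi0l hM hK) // (pi0r hM hK) // addr0 scaler0 addr0.
  by move/eqP; rewrite scaler_eq0 => /orP[/eqP|/eqP //] => /(congr1 (@complex.Im R)) /= /eqP; rewrite oner_eq0.
have sym y : A y -> symm y -> pi p p (delta y) = 0.
  move=> Ay sy; have My := AM Ay.
  have [l hl] := minimal_projection_scalar hM hab hp My sy.
  pose y0 := (- l)%:C *: (@id H) + y.
  have Ay0 : A y0 by exact: (star_alg_lin hA).
  have [C C0 hC] := bounded_op_nr (vna_op hM (AM Ay0)).
  (* Rescales y - l to norm at most 1/2, as [base] requires. *)
  pose s := (2 * C)^-1; have s0 : 0 < s by rewrite invr_gt0 mulr_gt0.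
  have y0E v : y0 v = (- l)%:C *: v + y v by [].
  have Asy : A (s%:C *: y0) by exact: (alg_scale hA).
  have h : pi p p (delta (s%:C *: y0)) = 0.
    apply: base => //.
    - move=> u v; change (rdot (s%:C *: y0 u) v = rdot u (s%:C *: y0 v)).
      by rewrite !y0E rdotZl rdotZr rdotDl rdotDr rdotZl rdotZr sy.
    - move=> v; change (nr (s%:C *: y0 v) <= 2^-1 * nr v).
      rewrite nrZr gtr0_norm // ler_pdivrMl ?mulr_gt0 //.
      by apply: le_trans (hC v) _; rewrite le_eqVlt; apply/orP; left; apply/eqP; field.
    - move=> v; change (s%:C *: y0 (p v) = 0).
      rewrite y0E hl; vring.
  move: h; rewrite (bderZ hd) // (bder_linear hd) // (bder_id hd) scaler0 add0r.
  rewrite (linZ _ _ (pi_lin hK Mp Mp)) => /eqP; rewrite scaler_eq0 => /orP[|/eqP //].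
  by rewrite -[0]/(0%:C) (inj_eq (@complexI _)) gt_eqF.
move=> Ax; have [x1 [x2 [A1' A2 s1 s2 ->]]] := symm_decomposition hM hA (fun x h => AM h) Ax.
have Ai : A ('i *: x2) by exact: (alg_scale hA).
rewrite (bderD hd) // (bderZ hd) // (linD _ _ (pi_lin hK Mp Mp)) (linZ _ _ (pi_lin hK Mp Mp)).
by rewrite !sym // scaler0 addr0.
Qed.

End BoundedDerivation.

(** * The diagonal part of 1 (x) 1 and the traces of minimal projections *)

Section DiagonalTrace.
Context {R : realType} {H : hilbertType R}.
Variables (M : set (H -> H)) (tau : (H -> H) -> R[i]).
Hypotheses (hM : tracial_vna M tau) (hab : abelian_alg M).
Context {K : hilbertType R}.
Variables (pi : (H -> H) -> (H -> H) -> K -> K) (Om : K).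
Hypothesis hK : is_L2_tensor M tau pi Om.
Variable A : set (H -> H).
Hypotheses (hA : unital_star_alg A) (hAM : weakly_dense A M).
Implicit Types (x y a b p q : H -> H) (e : R) (f g z : K).

Let lM T : M T -> linear T. Proof. exact: vna_lin hM T. Qed.
Let M1 : M id. Proof. exact: (star_alg_id (vna_star hM)). Qed.
Let Mc x y : M x -> M y -> M (x \o y). Proof. exact: (star_alg_comp (vna_star hM)). Qed.
Let Ma x : M x -> M (adj x). Proof. exact: (vna_adj hM). Qed.
Let AM x : A x -> M x. Proof. exact: hAM.1 x. Qed.
Local Notation vec := (vec pi Om).
Local Notation diag := (diag pi A).

Lemma nr_le_of_sqr (w : K) e : 0 < e -> nr w ^+ 2 <= e ^+ 2 * tr tau id -> nr w <= e.
Proof.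
by move=> e0; rewrite (tr_id hM) mulr1 ler_sqr ?nnegrE ?nr_ge0 // ltW.
Qed.

(** Twisting z by a^* and b^* reduces the claim to <z, 1 (x) 1> = 0. A fine partition of 1 splits
    this pairing into p (x) p terms, which vanish, and a term with an arbitrarily short vector w. *)
Lemma diag_eq0 z : diag z ->
  (forall p, minimal_projections M p -> pi p p z = 0) -> z = 0.
Proof.
move=> dz hz; apply: (vec_dense hK) => a b Mxa Mb.
rewrite -(pi_rdot_adjl hK) //; set z' := pi _ _ z.
have dz' : diag z' by apply: (diag_pi hM hab hK hAM dz); apply: Ma.
have hz' p : minimal_projections M p -> pi p p z' = 0.
  move=> mp; have [[Mp _ _] _ _] := mp.
  rewrite /z' (pi_comm hab hK _ Mp Mp (Ma Mxa) (Ma Mb)) hz //.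
  by rewrite (lin0 (pi_lin hK (Ma Mxa) (Ma Mb))).
apply/normr0_eq0/eqP; rewrite eq_le normr_ge0 andbT.
apply/ler_addgt0Pl => e e0; rewrite addr0.
have n1 : 0 < nr z' + 1 by rewrite ltr_wpDl ?nr_ge0.
have d0 : 0 < e / (nr z' + 1) by rewrite divr_gt0.
have d2 := exprn_gt0 2 d0.
have [_ [F [w [hF _ nw _ /(_ _ dz')]]]] :=
  fine_partition_diag hM hab hK hA hAM (ltW d2) (fine_partition_id hM hab d2).
rewrite (pi_id hK) => ->; rewrite big_seq big1 ?add0r; last first.
  move=> p /hF[mp _]; have [[Mp _ ap] _ _] := mp.
  have := pi_rdot_adj hK z' Om Mp Mp; rewrite (adjE ap) => <-.
  by rewrite hz' // rdot0l.
apply: le_trans (rdot_abs_le _ _) _.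
apply: (@le_trans _ _ ((nr z' + 1) * (e / (nr z' + 1)))); last by rewrite mulrC divfK // gt_eqF.
by apply: ler_pM; rewrite ?nr_ge0 ?lerDl //; apply: nr_le_of_sqr.
Qed.

Lemma diag_minimal p : minimal_projections M p -> diag (vec p p).
Proof. by move=> mp x Ax; apply: (comm_minimal hM hab hK) => //; apply: AM. Qed.

Lemma minimal_orthogonal p q : minimal_projections M p -> minimal_projections M q ->
  p != q -> p \o q = 0.
Proof.
move=> [pp p0 pmin] [pq q0 qmin] npq; have [Mp pE ap] := pp; have [Mq qE aq] := pq.
have Mpq := Mc Mp Mq.
have ppq : projection M (p \o q).
  split=> //.
    apply/funext => v /=; rewrite (vna_comm hab (q v) Mq Mp) (projK _ pq).
    by rewrite (projK _ pp).
  apply: symm_is_adjoint; first exact: lM.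
  exact: (symm_comp hab Mp Mq (proj_symm pp) (proj_symm pq)).
have hp : p \o (p \o q) = p \o q by apply/funext => v /=; rewrite (projK _ pp).
have hq : q \o (p \o q) = p \o q.
  by apply/funext => v /=; rewrite (vna_comm hab _ Mq Mp) (projK _ pq).
have [//|e1] := pmin _ ppq hp; have [//|e2] := qmin _ ppq hq.
by case/eqP: npq; rewrite -e1 e2.
Qed.

(** [zeta] is the orthogonal projection of 1 (x) 1 onto the diagonal vectors. *)
Variable zeta : K.
Hypotheses (dzeta : diag zeta) (zetaP : forall z, diag z -> rdot (Om - zeta) z = 0).

Let rdot_zeta z : diag z -> rdot zeta z = rdot Om z.
Proof.
by move=> /zetaP; rewrite rdotBl => /eqP; rewrite subr_eq0 => /eqP.
Qed.

Let rdot_zeta_minimal p : minimal_projections M p -> rdot zeta (vec p p) = tr tau p ^+ 2.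
Proof.
move=> mp; rewrite rdot_zeta; last exact: diag_minimal.
by have [pp _ _] := mp; rewrite rdotC (rdot_Om hM hK) // expr2.
Qed.

Let zeta_Om : rdot zeta Om = nr zeta ^+ 2.
Proof. by rewrite rdotC -(rdot_zeta dzeta) rdotxx. Qed.

(* Bessel's inequality for the orthogonal family of the p (x) p. *)
Lemma sum_minimal_le (F : seq (H -> H)) : uniq F ->
  (forall p, p \in F -> minimal_projections M p) ->
  \sum_(p <- F) tr tau p ^+ 2 <= nr zeta ^+ 2.
Proof.
move=> uF hF; pose v := \sum_(p <- F) vec p p.
have vv : nr v ^+ 2 = \sum_(p <- F) tr tau p ^+ 2.
  rewrite -rdotxx /v rdot_suml big_seq [RHS]big_seq; apply: eq_bigr => p pF.
  have [pp _ _] := hF _ pF; have [Mp _ ap] := pp.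
  rewrite rdot_sumr (bigD1_seq p) //= rdotxx (vec_proj hM hab hK) // big_seq_cond big1 ?addr0 ?expr2 //.
  move=> q /andP[qF qp]; have [[Mq _ aq] _ _] := hF _ qF.
  have pq : q \o p = 0 by apply: minimal_orthogonal; [exact: hF | exact: hF |].
  have := pi_rdot_adj hK Om (vec p p) Mq Mq; rewrite (adjE aq).
  rewrite rdotC => ->.
  by rewrite /vec (pi_comp hK) // pq (pi0l hM hK) ?rdot0r //; apply: Mc.
have zv : rdot zeta v = \sum_(p <- F) tr tau p ^+ 2.
  rewrite /v rdot_sumr big_seq [RHS]big_seq; apply: eq_bigr => p /hF.
  exact: rdot_zeta_minimal.
have := sqr_ge0 (nr (zeta - v)); rewrite nr_sqrB vv zv; lra.
Qed.

(** |zeta|^2 = <zeta, 1 (x) 1> is split along a partition of fineness e^2: the minimal pieces give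
    tr(p)^2, and the rest is at most |w| <= e since |zeta| <= 1. *)
Lemma sum_minimal_ge e : 0 < e -> exists F : seq (H -> H), [/\ uniq F,
  forall p, p \in F -> minimal_projections M p &
  nr zeta ^+ 2 <= \sum_(p <- F) tr tau p ^+ 2 + e].
Proof.
move=> e0; have e2 := exprn_gt0 2 e0.
have [_ [F [w [hF uF nw _ /(_ _ dzeta)]]]] :=
  fine_partition_diag hM hab hK hA hAM (ltW e2) (fine_partition_id hM hab e2).
rewrite (pi_id hK) zeta_Om => h.
exists F; split=> // [p /hF[]//|].
have z1 : nr zeta <= 1.
  rewrite -(nr_Om hM hab hK); have [->|n0] := eqVneq (nr zeta) 0; first exact: nr_ge0.
  by rewrite -(@ler_pM2l _ (nr zeta)) ?lt_def ?n0 ?nr_ge0 // -expr2 -zeta_Om rdot_le.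
rewrite h lerD //.
  rewrite big_seq [leRHS]big_seq le_eqVlt; apply/orP; left; apply/eqP.
  by apply: eq_bigr => p /hF[mp _]; apply: rdot_zeta_minimal.
apply: le_trans (rdot_le _ _) _; rewrite -[e]mul1r.
by apply: ler_pM; rewrite ?nr_ge0 //; apply: nr_le_of_sqr.
Qed.

Lemma esum_minimal :
  (\esum_(p in minimal_projections M) ((complex.Re (tau p)) ^+ 2)%:E = (nr zeta ^+ 2)%:E)%E.
Proof.
apply/eqP; rewrite eq_le; apply/andP; split.
  apply: ub_ereal_sup => _ [F [finF FP] <-].
  rewrite fsbig_finite //= sumEFin lee_fin.
  apply: sum_minimal_le; first exact: finmap.fset_uniq.
  by move=> p; rewrite in_fset_set // inE => /FP.
apply/lee_addgt0Pr => e e0.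
have [F [uF hF hz]] := sum_minimal_ge e0.
apply: (@le_trans _ _ ((\sum_(p <- F) tr tau p ^+ 2)%:E + e%:E)%E).
  by rewrite -EFinD lee_fin.
rewrite leeD2r // -sumEFin fsbig_seq //; apply: ereal_sup_ubound.
exists [set` F] => //; split; first exact: finite_seq.
by move=> p /= pF; apply: hF.
Qed.

End DiagonalTrace.

(** * The free Stein dimension *)

Section SteinDimension.
Context {R : realType} {H : hilbertType R}.
Variables (M : set (H -> H)) (tau : (H -> H) -> R[i]).
Hypotheses (hM : tracial_vna M tau) (hab : abelian_alg M).
Context {K : hilbertType R}.
Variables (pi : (H -> H) -> (H -> H) -> K -> K) (Om : K).
Hypothesis hK : is_L2_tensor M tau pi Om.
Variable A : set (H -> H).
Hypotheses (hA : unital_star_alg A) (hAM : weakly_dense A M).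
Variables (n : nat) (X : 'I_n -> H -> H).
Hypothesis hgen : generates X A.
Implicit Types (x y a b p q : H -> H) (e : R) (f g z : K) (u v w : 'I_n -> K).

Let M1 : M id. Proof. exact: (star_alg_id (vna_star hM)). Qed.
Let A1 : A id. Proof. exact: (star_alg_id hA). Qed.
Let Ac x y : A x -> A y -> A (x \o y). Proof. exact: (star_alg_comp hA). Qed.
Let Ma x : M x -> M (adj x). Proof. exact: (vna_adj hM). Qed.
Let AM x : A x -> M x. Proof. exact: hAM.1 x. Qed.
Local Notation vec := (vec pi Om).
Local Notation comm := (comm_map pi).
Local Notation diag := (diag pi A).
Let clin x : M x -> linear (comm x). Proof. exact: (comm_lin hM hK). Qed.

Let AX i : A (X i).
Proof. by rewrite -hgen => B [_ ]; apply; exists i. Qed.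

Let MX i : M (X i). Proof. exact: AM. Qed.

Lemma gen_ind (P : (H -> H) -> Prop) : (forall i, P (X i)) -> P id ->
  (forall (c : R[i]) x y, A x -> A y -> P x -> P y -> P (c *: x + y)) ->
  (forall x y, A x -> A y -> P x -> P y -> P (x \o y)) ->
  (forall x, A x -> P x -> P (adj x)) ->
  forall x, A x -> P x.
Proof.
move=> PX P1 Plin Pc Pa x Ax.
suff : A `<=` [set y | A y /\ P y] by move=> /(_ _ Ax)[].
rewrite -{1}hgen; apply: smallest_sub; last by move=> _ [i _ <-]; split.
split=> //.
- by move=> c S T [AS PS] [AT PT]; split; [exact: (star_alg_lin hA)|exact: Plin].
- by move=> S T [AS PS] [AT PT]; split; [exact: Ac|exact: Pc].
move=> T [AT PT]; split; first exact: (alg_is_adj hA).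
by split; [exact: (alg_adj hA)|exact: Pa].
Qed.

Lemma diag_gen z : (forall i, comm (X i) z = 0) -> diag z.
Proof.
move=> hz; apply: gen_ind => //.
- exact: comm_id.
- move=> c x y Ax Ay hx hy; rewrite (commD hM hK) ?(commZ hM hK) ?hx ?hy ?scaler0 ?addr0 //;
    try exact: AM.
  exact: (alg_scale (vna_star hM) c (AM Ax)).
- move=> x y Ax Ay hx hy; rewrite (comm_leibniz hM hab hK) ?hx ?hy //; try exact: AM.
  by rewrite (lin0 (pi_lin hK (AM Ax) M1)) (lin0 (pi_lin hK M1 (AM Ay))) addr0.
move=> x Ax hx; apply/nr0_eq0; rewrite (comm_normal hM hab hK) ?hx ?nr0 //; exact: AM.
Qed.

(* The inner derivations x |-> [x, f] correspond to the range of f |-> ([X_i, f])_i. *)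
Definition inner_closure : set ('I_n -> K) :=
  [set v | forall e, 0 < e -> exists f, forall i, nr (comm (X i) f - v i) < e].

Lemma hcv_inner_closure v (g : nat -> K) :
  (forall i, hcv (fun k => comm (X i) (g k)) (v i)) -> inner_closure v.
Proof.
move=> hg e e0.
have /choice[N hN] : forall i, exists N, forall k, (N <= k)%N -> nr (comm (X i) (g k) - v i) < e.
  by move=> i; have /hcvP/(_ _ e0) := hg i.
exists (g (\max_i N i)) => i; apply: hN; exact: leq_bigmax.
Qed.

Let S u := \sum_(j < n) comm (adj (X j)) (u j).
Let T f := fun i => comm (X i) f.

Let S_rdot u f : rdot (S u) f = ip u (T f).
Proof.
by rewrite /S rdot_suml; apply: eq_bigr => i _; rewrite (comm_rdot hM hK) ?(vna_adjK hM) //; apply: Ma.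
Qed.

Let STE f : rdot (S (T f)) f = ip (T f) (T f).
Proof. exact: S_rdot. Qed.

Let TB f g i : T (f - g) i = T f i - T g i.
Proof. exact: (linB _ _ (clin (MX i))). Qed.

Let TD f g i : T (f + g) i = T f i + T g i.
Proof. exact: (linD _ _ (clin (MX i))). Qed.

Let TZ (c : R[i]) f i : T (c *: f) i = c *: T f i.
Proof. exact: (linZ _ _ (clin (MX i))). Qed.

Let SB u v : S (fun i => u i - v i) = S u - S v.
Proof.
by rewrite /S -sumrB; apply: eq_bigr => i _; rewrite (linB _ _ (clin (Ma (MX i)))).
Qed.

Let SZ (c : R[i]) u : S (fun i => c *: u i) = c *: S u.
Proof.
by rewrite /S scaler_sumr; apply: eq_bigr => i _; rewrite (linZ _ _ (clin (Ma (MX i)))).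
Qed.

(** The step size: with s T^*T <= 1, both 1 - s T^*T and 1 - s T T^* are positive contractions. *)
Let T_bounded : exists2 s : R, 0 < s & forall f, s * ip (T f) (T f) <= nr f ^+ 2.
Proof.
have /choice[c hc] : forall i, exists c, 0 < c /\ nr_bounded c (comm (X i)).
  by move=> i; have [c c0 hc] := bounded_op_nr (comm_op hM hK (MX i)); exists c.
pose C := \sum_i c i ^+ 2 + 1.
have C0 : 0 < C by rewrite ltr_wpDl // sumr_ge0 // => i _; apply: sqr_ge0.
exists C^-1; first by rewrite invr_gt0.
move=> f; rewrite ler_pdivrMl //.
apply: (@le_trans _ _ (\sum_i c i ^+ 2 * nr f ^+ 2)).
  apply: ler_sum => i _; have [ci hci] := hc i; rewrite rdotxx -exprMn.
  have h0 : 0 <= c i * nr f by rewrite mulr_ge0 ?nr_ge0 // ltW.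
  by rewrite ler_sqr ?nnegrE ?nr_ge0 //; apply: hci.
by rewrite -mulr_suml ler_wpM2r ?sqr_ge0 // lerDl.
Qed.

(** * Projections onto the closed range and the kernel of T *)

Section Iteration.
Variable s : R.
Hypotheses (s0 : 0 < s) (sT : forall f, s * ip (T f) (T f) <= nr f ^+ 2).

(* Richardson iteration for the orthogonal projection onto the closure of the range
   of T, where S is the adjoint of T. *)
Fixpoint range_seq u k : K :=
  if k is k'.+1 then
    range_seq u k' + s%:C *: S (fun i => u i - T (range_seq u k') i)
  else 0.

(** The residual u - T ([range_seq u k]) is C^k u for C = 1 - s T S, so it converges to a vector w
    fixed by C. Then T S w = 0 and |S w|^2 = <w, T S w> = 0. *)
Lemma range_seq_cvg u : exists w,
  (forall i, hcv (fun k => T (range_seq u k) i) (u i - w i)) /\ S w = 0.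
Proof.
pose C v := fun i => v i - s%:C *: T (S v) i.
have CB v v' : C (fun i => v i - v' i) = (fun i => C v i - C v' i).
  by apply/funext => i; rewrite /C SB TB scalerBr opprD !opprK addrACA opprD opprK.
have CE v (z : 'I_n -> K) : ip (C v) z = ip v z - s * ip (T (S v)) z.
  rewrite ipBl; congr (_ - _).
  by rewrite mulr_sumr; apply: eq_bigr => i _; rewrite rdotZl.
have Csym v v' : ip (C v) v' = ip v (C v').
  by rewrite CE (ipC v (C v')) CE (ipC v') !(ipC (T _)) -!S_rdot (rdotC (S v)).
have Ccon v : ip (C v) (C v) <= ip (C v) v.
  rewrite [leLHS]CE (ipC v) gerBl mulr_ge0 ?(ltW s0) // ipC CE -S_rdot rdotxx.
  by rewrite subr_ge0.
have [w [hw Cw _]] := iter_cvg_fixed CB Csym Ccon u.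
have iterE k i : iter k C u i = u i - T (range_seq u k) i.
  elim: k i => [|k IH] i /=; first by rewrite /T (lin0 (clin (MX i))) subr0.
  rewrite {1}/C (_ : S (iter k C u) = S (fun i => u i - T (range_seq u k) i)); last first.
    by congr S; apply/funext.
  by rewrite IH TD TZ [in RHS]opprD addrA.
exists w; split.
  move=> i; have h := hcvB (hcv_cst (u i)) (hw i).
  rewrite (_ : (fun k => _) = (fun k => u i - iter k C u i)) //.
  by apply/funext => k; rewrite iterE opprB addrC subrK.
have TSw i : T (S w) i = 0.
  have /eqP := congr1 (fun v : 'I_n -> K => v i) Cw.
  rewrite /C subr_eq addrC -subr_eq subrr eq_sym scaler_eq0 => /orP[|/eqP //].
  by rewrite -[0]/(0%:C) (inj_eq (@complexI _)) gt_eqF.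
apply/nr0_eq0/eqP; rewrite -sqrf_eq0 -rdotxx S_rdot /ip big1 // => i _.
by rewrite TSw rdot0r.
Qed.

(** Expand |u - s T S u|^2 >= 0 and bound s |T S u|^2 by |S u|^2. *)
Lemma adjoint_bounded u : s * nr (S u) ^+ 2 <= ip u u.
Proof.
have := ip_ge0 (fun i => u i - s%:C *: T (S u) i); have := sT (S u).
have -> : ip (fun i => u i - s%:C *: T (S u) i) (fun i => u i - s%:C *: T (S u) i) =
    ip u u - 2 * s * ip u (T (S u)) + s * (s * ip (T (S u)) (T (S u))).
  rewrite /ip !mulr_sumr -sumrB -big_split; apply: eq_bigr => i _ /=.
  move: (u i) (T (S u) i) => a b.
  by rewrite !(rdotBl, rdotBr, rdotZl, rdotZr) (rdotC b a); ring.
rewrite -(S_rdot u) rdotxx -(ler_pM2l s0); lra.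
Qed.

Let B f := f - s%:C *: S (T f).

Let B_lin : linear B.
Proof.
move=> c f g; apply/esym/eqP; rewrite /B.
have -> : S (T (c *: f + g)) = c *: S (T f) + S (T g).
  rewrite /S scaler_sumr -big_split; apply: eq_bigr => i _ /=.
  by rewrite TD TZ (linD _ _ (clin (Ma (MX i)))) (linZ _ _ (clin (Ma (MX i)))).
by rewrite scalerBr scalerDr opprD addrACA !scalerA (mulrC c).
Qed.

Let B_comm x f : M x -> comm x (B f) = B (comm x f).
Proof.
move=> Mx; rewrite /B (linB _ _ (clin Mx)) (linZ _ _ (clin Mx)); congr (_ - _ *: _).
rewrite /S (lin_sum _ _ _ (clin Mx)); apply: eq_bigr => i _.
rewrite (comm_comm hM hab hK _ Mx (Ma (MX i))); congr (comm _ _).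
exact: (comm_comm hM hab hK _ Mx (MX i)).
Qed.

(** B = 1 - s S T is a positive contraction whose fixed vectors are ker T, that is, the diagonal
    vectors. *)
Lemma diagonal_projection : exists z, [/\ diag z,
  forall f, diag f -> rdot (Om - z) f = 0 & hcv (fun k => iter k B Om) z].
Proof.
have Brdot f g : rdot (B f) g = rdot f g - s * ip (T f) (T g).
  by rewrite /B rdotBl rdotZl S_rdot.
have Bsym : symm B by move=> f g; rewrite Brdot rdotC [RHS]rdotC Brdot ipC.
have Bcon f : nr (B f) ^+ 2 <= rdot (B f) f.
  have h1 := adjoint_bounded (T f).
  rewrite /B nr_sqrB nrZr (gtr0_norm s0) exprMn rdotZr rdotBl rdotZl rdotxx.
  rewrite (rdotC f) STE; have := h1; rewrite -(ler_pM2l s0); lra.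
have [z [hz Bz zP]] := iter_cvg_fixed1 B_lin Bsym Bcon Om.
exists z; split=> //.
  apply: diag_gen => i; apply/nr0_eq0/eqP; rewrite -sqrf_eq0 eq_le sqr_ge0 andbT.
  have := Brdot z z; rewrite Bz => h.
  have ip0 : ip (T z) (T z) = 0.
    have /eqP : s * ip (T z) (T z) = 0 by lra.
    by rewrite mulf_eq0 gt_eqF //= => /eqP.
  by rewrite -ip0; apply: (nr_le_ip (T z)).
move=> f df; apply: zP; rewrite /B.
have -> : T f = fun=> 0 by apply/funext => i; apply: df.
rewrite /S big1 ?scaler0 ?subr0 // => i _; exact: (lin0 (clin (Ma (MX i)))).
Qed.

Let e_ (i : 'I_n) : 'I_n -> K := fun j => if j == i then Om else 0.

(** As all [x, -] commute with B, S maps the residual of step l for [e_ i] to B^l [X_i^*, Om].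
    Applying [X_i, -] and summing over i gives B^l S T Om, and s B^l S T = B^l - B^(l+1) telescopes.
    In effect the trace over i turns a polynomial in T S without constant term into the same
    polynomial in S T. *)
Lemma sum_range_seq k : \sum_i T (range_seq (e_ i) k) i = Om - iter k B Om.
Proof.
have S0 i : S (e_ i) = comm (adj (X i)) Om.
  rewrite /S (bigD1 i) //= /e_ eqxx big1 ?addr0 // => j /negbTE ->.
  exact: (lin0 (clin (Ma (MX j)))).
have SF i l : S (fun j => e_ i j - T (range_seq (e_ i) l) j) = iter l B (comm (adj (X i)) Om).
  elim: l => [|l IH].
    rewrite -S0; congr S; apply/funext => j.
    by rewrite /= /T (lin0 (clin (MX j))) subr0.
  pose F j := e_ i j - T (range_seq (e_ i) l) j.
  have -> : (fun j => e_ i j - T (range_seq (e_ i) l.+1) j) =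
      (fun j => F j - s%:C *: T (S F) j).
    by apply/funext => j; rewrite /= TD TZ [in LHS]opprD addrA.
  by rewrite (SB F) (SZ _ (T (S F))) /= -IH.
have B_iter x l f : M x -> comm x (iter l B f) = iter l B (comm x f).
  by move=> Mx; elim: l => //= l <-; rewrite B_comm.
elim: k => [|k IH].
  by rewrite subrr big1 // => i _; rewrite /= /T (lin0 (clin (MX i))).
have -> : \sum_i T (range_seq (e_ i) k.+1) i =
    \sum_i T (range_seq (e_ i) k) i + s%:C *: iter k B (S (T Om)).
  have iterD l f g : iter l B (f + g) = iter l B f + iter l B g.
    by elim: l => //= l ->; rewrite (linD _ _ B_lin).
  have iter0 l : iter l B 0 = 0 by elim: l => //= l ->; rewrite (lin0 B_lin).
  have -> : iter k B (S (T Om)) = \sum_i iter k B (comm (adj (X i)) (T Om i)).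
    by rewrite /S (big_morph _ (iterD k) (iter0 k)).
  rewrite scaler_sumr -big_split; apply: eq_bigr => i _ /=.
  rewrite TD TZ SF; congr (_ + _ *: _).
  rewrite /T B_iter //; congr iter; exact: (comm_comm hM hab hK _ (MX i) (Ma (MX i))).
rewrite IH iterSr; have iterB l f g : iter l B (f - g) = iter l B f - iter l B g.
  by elim: l => //= l ->; rewrite (linB _ _ B_lin).
have iterZ l (c : R[i]) f : iter l B (c *: f) = c *: iter l B f.
  by elim: l => //= l ->; rewrite (linZ _ _ B_lin).
have -> : B Om = Om - s%:C *: S (T Om) by [].
by rewrite iterB iterZ; vring.
Qed.

End Iteration.

(** * The closure of the derivations as the closure of the inner ones *)

Lemma bder_cross delta x y : bounded_derivation pi Om A delta -> A x -> A y ->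
  comm x (delta y) = comm y (delta x).
Proof.
move=> hd Ax Ay; have := bder_leibniz hd Ax Ay.
rewrite (hab (AM Ax) (AM Ay)) (bder_leibniz hd Ay Ax) => /eqP.
rewrite -subr_eq0 => /eqP h; apply/eqP; rewrite -subr_eq0 /comm_map -oppr_eq0 -h.
by apply/eqP; vring.
Qed.

(* The defect w of (delta X_i)_i against the closure of the inner derivations satisfies
   [X_i, w_j] = [X_j, w_i] and sum_i [X_i^*, w_i] = 0, hence is diagonal; as the part of
   delta under p (x) p vanishes for p minimal, w = 0. *)
Lemma bder_inner_closure delta : bounded_derivation pi Om A delta ->
  inner_closure (phiX X delta).
Proof.
move=> hd; have [s s0 sT] := T_bounded; set v := phiX X delta.
have [w [hw Sw]] := range_seq_cvg s0 sT v; set g := range_seq s v in hw.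
have hv j : hcv (fun k => v j - comm (X j) (g k)) (w j).
  have h := hcvB (hcv_cst (v j)) (hw j).
  by rewrite opprB addrC subrK in h.
have cross i j : comm (X i) (w j) = comm (X j) (w i).
  apply: (@hcv_uniq _ _ (fun k => comm (X i) (v j - comm (X j) (g k)))).
    exact: (hcv_op (comm_op hM hK (MX i)) (hv j)).
  rewrite (_ : (fun k => _) = (fun k => comm (X j) (v i - comm (X i) (g k)))).
    exact: (hcv_op (comm_op hM hK (MX j)) (hv i)).
  apply/funext => k; rewrite (linB _ _ (clin (MX i))) (linB _ _ (clin (MX j))).
  by rewrite (comm_comm hM hab hK _ (MX i) (MX j)) (bder_cross hd (AX i) (AX j)).
have dw j : diag (w j).
  apply: diag_gen => i; apply/nr0_eq0/eqP; rewrite -sqrf_eq0 eq_le sqr_ge0 andbT.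
  apply: le_trans (nr_le_ip (T (w j)) i) _.
  rewrite -STE (_ : S (T (w j)) = comm (X j) (S w)).
    by rewrite Sw (lin0 (clin (MX j))) rdot0l.
  rewrite /S (lin_sum _ _ _ (clin (MX j))); apply: eq_bigr => k _.
  by rewrite (comm_comm hM hab hK _ (MX j) (Ma (MX k))) /T cross.
have w0 j : w j = 0.
  apply: (diag_eq0 hM hab hK hA hAM (dw j)) => p mp; have [[Mp _ _] _ _] := mp.
  apply: (hcv_uniq (hcv_op (pi_op hK Mp Mp) (hv j))).
  rewrite (_ : _ \o _ = (fun=> 0)); first exact: hcv_cst.
  apply/funext => k /=; rewrite (linB _ _ (pi_lin hK Mp Mp)).
  rewrite (comm_pi hM hab hK _ (MX j) Mp Mp) (comm_minimal hM hab hK _ mp (MX j)) subr0.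
  exact: (bder_minimal hM hab hK hA hAM hd mp (AX j)).
apply: (@hcv_inner_closure _ g) => i.
by have := hw i; rewrite w0 subr0.
Qed.

Lemma Der_1x1_bounded delta : Der_1x1 A tau pi Om delta -> bounded_derivation pi Om A delta.
Proof.
move=> [hd [C hC]]; split.
- exact: (der_linear hd).
- exact: (der_leibniz hd).
exists `|complex.Re C|; first exact: normr_ge0.
move=> x Ax; have := hC x Ax; rewrite (norm2E hM hab hK (AM Ax)).
rewrite mulrC lecE => /andP[_]; rewrite ReM_real => h.
apply: le_trans (Re_le_norm _) _; apply: le_trans h _.
by rewrite mulrC ler_wpM2r ?nr_ge0 ?ler_norm.
Qed.

Lemma comm_dot x f g : M x -> hdot K (comm x f) g = hdot K f (comm (adj x) g).
Proof.
move=> Mx; rewrite !dotE !(comm_rdot hM hK) //.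
by rewrite (linZ _ _ (clin (Ma Mx))).
Qed.

(** <[x, f], Om> = <f, [x^*, Om]>, and |[x^*, Om]| is at most twice the 2-norm of x. *)
Lemma inner_Der_1x1 f : Der_1x1 A tau pi Om (fun x => comm x f).
Proof.
split; first split.
- move=> x Ax; exact: (L2_alg_full hM hab hK hA hAM).
- move=> c x y Ax Ay; have Mx := AM Ax.
  rewrite (commD hM hK) ?(commZ hM hK) //; try exact: AM.
  exact: (alg_scale (vna_star hM)).
- by move=> x y Ax Ay; apply: (comm_leibniz hM hab hK); apply: AM.
exists (nr f * 2)%:C => x Ax; have Mx := AM Ax.
rewrite (norm2E hM hab hK Mx) comm_dot //; apply: le_trans (dot_abs_le _ _) _.
rewrite -rmorphM lecR -mulrA ler_wpM2l ?nr_ge0 //.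
apply: le_trans (nrB _ _) _; have Mx' := Ma Mx.
rewrite -!/(vec _ _) (vec_nrr hM hab hK) // (vec_nr_adj hM hab hK) //.
lra.
Qed.

Lemma normXE (d : (H -> H) -> K) :
  normX X d = (Num.sqrt (\sum_i nr (d (X i)) ^+ 2))%:C.
Proof.
rewrite /normX.
have -> : \sum_(i < n) `|d (X i)| ^+ 2 = (\sum_(i < n) nr (d (X i)) ^+ 2)%:C :> R[i].
  by rewrite rmorph_sum; apply: eq_bigr => i _; rewrite nrE -rmorphXn.
have s0 : 0 <= \sum_(i < n) nr (d (X i)) ^+ 2 by apply: sumr_ge0 => i _; apply: sqr_ge0.
by rewrite -{1}(sqr_sqrtr s0) rmorphXn sqrCK // ler0c sqrtr_ge0.
Qed.

Lemma normX_lt (d : (H -> H) -> K) e : 0 < e ->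
  (forall i, nr (d (X i)) < e / n.+1%:R) -> normX X d < e%:C.
Proof.
move=> e0 hd; rewrite normXE ltcR -(ltr_sqr (x := Num.sqrt _)) ?nnegrE ?sqrtr_ge0 ?(ltW e0) //.
rewrite sqr_sqrtr; last by apply: sumr_ge0 => i _; apply: sqr_ge0.
have a0 : 0 < e / n.+1%:R by rewrite divr_gt0 ?ltr0n.
apply: (@le_lt_trans _ _ (\sum_(i < n) (e / n.+1%:R) ^+ 2)).
  by apply: ler_sum => i _; rewrite ler_sqr ?nnegrE ?nr_ge0 ?(ltW a0) // ltW.
rewrite sumr_const card_ord -[X in X < _]mulr_natr.
have -> : e ^+ 2 = (e / n.+1%:R) ^+ 2 * n.+1%:R ^+ 2.
  by rewrite -exprMn divfK // pnatr_eq0.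
rewrite ltr_pM2l ?exprn_gt0 // -natrX ltr_nat.
by rewrite -mulnn leq_pmulr.
Qed.

Lemma normX_ge (d : (H -> H) -> K) (e : R[i]) i : normX X d < e -> nr (d (X i)) < complex.Re e.
Proof.
rewrite normXE ltcE => /andP[_]; apply: le_lt_trans => /=.
rewrite -{1}(ger0_norm (nr_ge0 (d (X i)))) -sqrtr_sqr ler_wsqrtr //.
by rewrite (bigD1 i) //= lerDl sumr_ge0 // => j _; apply: sqr_ge0.
Qed.

(** For the inclusion from right to left, inner derivations converging on the generators converge on
    all of A, and their limit is a derivation. *)
Lemma phiX_Der_1x1_closure :
  phiX X @` Der_1x1_closure A tau pi Om X = inner_closure.
Proof.
apply/seteqP; split=> [_ [delta [hd hcl] <-] e e0|v hv].
  have e2 : 0 < (e / 2)%:C by rewrite ltcR divr_gt0.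
  have [delta' hd' hdd] := hcl _ e2.
  have e2' : 0 < e / 2 by rewrite divr_gt0.
  have [f hf] := bder_inner_closure (Der_1x1_bounded hd') e2'.
  exists f => i; apply: le_lt_trans (nr_split (phiX X delta' i) _ _) _.
  rewrite [e]splitr; apply: ltrD; first exact: hf.
  by have := normX_ge i hdd; rewrite /= nrBC.
have /choice[f hf] : forall k : nat, exists f, forall i, nr (comm (X i) f - v i) < k.+1%:R^-1.
  by move=> k; apply: hv; rewrite invr_gt0 ltr0n.
have fv i : hcv (fun k => comm (X i) (f k)) (v i).
  by apply: (hcv_le _ (@cvg_harmonic R)) => k; apply/ltW/hf.
have hcv_lin (c : R[i]) x y l m : A x -> A y ->
    hcv (fun k => comm x (f k)) l -> hcv (fun k => comm y (f k)) m ->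
    hcv (fun k => comm (c *: x + y) (f k)) (c *: l + m).
  move=> Ax Ay hl hm; rewrite (_ : (fun k => _) = (fun k => c *: comm x (f k) + comm y (f k))).
    by apply: hcvD => //; apply: hcvZ.
  apply/funext => k; have Mx := AM Ax.
  rewrite (commD hM hK) ?(commZ hM hK) //; try exact: AM.
  exact: (alg_scale (vna_star hM)).
have hcv_leibniz x y l m : A x -> A y ->
    hcv (fun k => comm x (f k)) l -> hcv (fun k => comm y (f k)) m ->
    hcv (fun k => comm (x \o y) (f k)) (pi x id m + pi id y l).
  move=> Ax Ay hl hm; have Mx := AM Ax; have My := AM Ay.
  rewrite (_ : (fun k => _) = (fun k => pi x id (comm y (f k)) + pi id y (comm x (f k)))).
    by apply: hcvD; [exact: (hcv_op (pi_op hK Mx M1) hm)|exact: (hcv_op (pi_op hK M1 My) hl)].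
  by apply/funext => k; rewrite (comm_leibniz hM hab hK).
have ex : forall x, A x -> exists l, hcv (fun k => comm x (f k)) l.
  apply: gen_ind.
  - by move=> i; exists (v i).
  - exists 0; rewrite (_ : (fun k => comm id (f k)) = (fun=> 0)); first exact: hcv_cst.
    by apply/funext => k; apply: comm_id.
  - by move=> c x y Ax Ay [l hl] [m hm]; exists (c *: l + m); apply: hcv_lin.
  - by move=> x y Ax Ay [l hl] [m hm]; exists (pi x id m + pi id y l); apply: hcv_leibniz.
  move=> x Ax [l /hcvP hl]; have Mx := AM Ax.
  apply: hcv_complete => e e0.
  have e2 : 0 < e / 2 by rewrite divr_gt0.
  have [N hN] := hl _ e2; exists N => k m Nk Nm.
  (* [x^*, -] and [x, -] have the same norm on f_k - f_m, so the sequence for x^* is Cauchy; its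
     limit need not be identified. *)
  rewrite -(linB _ _ (clin (Ma Mx))) (comm_normal hM hab hK) // (linB _ _ (clin Mx)).
  apply: le_lt_trans (nr_split l _ _) _; rewrite [e]splitr; apply: ltrD; first exact: hN.
  by rewrite nrBC hN.
pose delta x := xget 0 [set l | hcv (fun k => comm x (f k)) l].
have dP x : A x -> hcv (fun k => comm x (f k)) (delta x).
  by move=> /ex[l hl]; exact: (@xgetI _ _ _ l hl).
have dX : phiX X delta = v.
  by apply/funext => i; apply: hcv_uniq (dP _ (AX i)) (fv i).
exists delta => //; split; first split.
- move=> x Ax; exact: (L2_alg_full hM hab hK hA hAM).
- move=> c x y Ax Ay; apply: (hcv_uniq (dP _ (star_alg_lin hA c Ax Ay))).
  by apply: hcv_lin => //; apply: dP.
- move=> x y Ax Ay; apply: (hcv_uniq (dP _ (Ac Ax Ay))).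
  by apply: hcv_leibniz => //; apply: dP.
move=> e /pos_complexE[e0 ->]; set r := complex.Re e in e0 *.
have r0 : 0 < r / n.+1%:R by rewrite divr_gt0 ?ltr0n.
have /cvgrPdist_lt/(_ _ r0)[N _ hN] := @cvg_harmonic R.
exists (fun x => comm x (f N)); first exact: inner_Der_1x1.
apply: normX_lt => // i.
rewrite -[(_ - _) _]/(delta (X i) - comm (X i) (f N)) -[delta _]/(phiX X delta i) dX nrBC.
apply: lt_trans (hf N i) _.
by have := hN N (leqnn N); rewrite /harmonic /= sub0r normrN ger0_norm ?invr_ge0.
Qed.

(** The closure is stable under multiplication by i, so orthogonality for the real product, which is
    <w, T f> = <S w, f> = 0 and continuity, gives it for the complex one. *)
Lemma inner_closure_orth (w v : 'I_n -> K) : S w = 0 -> inner_closure v ->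
  \sum_(i < n) hdot K (w i) (v i) = 0.
Proof.
move=> Sw hv.
have real v' : inner_closure v' -> ip w v' = 0.
  move=> hv'; apply/normr0_eq0/eqP; rewrite eq_le normr_ge0 andbT.
  apply/ler_addgt0Pl => e e0; rewrite addr0.
  pose C := \sum_i nr (w i); have C0 : 0 <= C by apply: sumr_ge0 => i _; apply: nr_ge0.
  have C1 : 0 < C + 1 by rewrite ltr_wpDl.
  have eC : 0 < e / (C + 1) by rewrite divr_gt0.
  have [f hf] := hv' _ eC.
  have -> : ip w v' = - ip w (fun i => T f i - v' i).
    by rewrite ipBr -S_rdot Sw rdot0l sub0r opprK.
  rewrite normrN; apply: le_trans (ler_norm_sum _ _ _) _.
  apply: (@le_trans _ _ (\sum_i nr (w i) * (e / (C + 1)))).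
    apply: ler_sum => i _; apply: le_trans (rdot_abs_le _ _) _.
    by rewrite ler_wpM2l ?nr_ge0 // ltW // hf.
  rewrite -mulr_suml -/C mulrCA ler_piMr ?(ltW e0) //.
  by rewrite ler_pdivrMr // mul1r lerDl.
have hiv : inner_closure (fun i => 'i *: v i).
  move=> e /hv[f hf]; exists ('i *: f) => i.
  rewrite (linZ _ _ (clin (MX i))) -scalerBr nrZ normc_def /= expr0n expr1n add0r sqrtr1 mul1r.
  exact: hf.
have -> : \sum_(i < n) hdot K (w i) (v i) = ip w v +i* ip w (fun i => 'i *: v i).
  rewrite /ip; elim/big_ind3 : _ => [//|? ? ? ? ? ? -> ->|i _]; last by rewrite dotE.
  by simpc.
by rewrite !real.
Qed.

Lemma orth_projE (u w : 'I_n -> K) : inner_closure (fun i => u i - w i) -> S w = 0 ->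
  orth_proj inner_closure u = fun i => u i - w i.
Proof.
move=> hw Sw; apply: xget_unique.
  split=> // v hv; rewrite -[RHS](inner_closure_orth Sw hv); apply: eq_bigr => i _.
  by rewrite opprB addrC subrK.
move=> eta [heta oeta]; apply/funext => i; apply/eqP; rewrite -subr_eq0; apply/eqP/nr0_eq0/eqP.
rewrite -sqrf_eq0 eq_le sqr_ge0 andbT.
apply: le_trans (nr_le_ip (fun i => eta i - (u i - w i)) i) _.
have ort (v : 'I_n -> K) : inner_closure v -> ip (fun i => eta i - (u i - w i)) v = 0.
  move=> hv; have e1 : ip w v = 0.
    by have := congr1 (@complex.Re R) (inner_closure_orth Sw hv); rewrite Re_sum.
  have e2 : ip (fun i => u i - eta i) v = 0.
    by have := congr1 (@complex.Re R) (oeta v hv); rewrite Re_sum.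
  transitivity (ip w v - ip (fun i => u i - eta i) v); last by rewrite e1 e2 subrr.
  by rewrite -ipBl; congr (ip _ v); apply/funext => j; vring.
by rewrite [X in X <= _]ipBr !ort // subr0.
Qed.

(** One sequence of sums has two limits: by [range_seq_cvg] the trace of the projection matrix, and
    by [sum_range_seq] the number <Om - z, Om>, equal to 1 - |z|^2 as z is a projection of the unit
    vector Om. *)
Lemma vN_dim_inner_closure : exists z, [/\ diag z,
  forall f, diag f -> rdot (Om - z) f = 0 & vN_dim Om inner_closure = 1 - nr z ^+ 2].
Proof.
have [s s0 sT] := T_bounded.
have [z [dz zP hz]] := diagonal_projection s0 sT; exists z; split=> //.
pose e_ (i : 'I_n) : 'I_n -> K := fun j => if j == i then Om else 0.
have /choice[w hw] := fun i => range_seq_cvg s0 sT (e_ i).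
have projE i : orth_proj inner_closure (e_ i) = fun j => e_ i j - w i j.
  by have [h1 h2] := hw i; apply: orth_projE => //; apply: (hcv_inner_closure h1).
rewrite /vN_dim Re_sum.
have -> : \sum_i complex.Re (hdot K (orth_proj_entry inner_closure i i Om) Om) =
    \sum_i rdot (e_ i i - w i i) Om.
  by apply: eq_bigr => i _; rewrite /orth_proj_entry -/(e_ i) projE.
have h1 : (fun k => \sum_i rdot (T (range_seq s (e_ i) k) i) Om) @ \oo -->
    \sum_i rdot (e_ i i - w i i) Om.
  by apply: cvgn_sum => i; apply: hcv_rdot; have [h _] := hw i.
have h2 : (fun k => \sum_i rdot (T (range_seq s (e_ i) k) i) Om) @ \oo --> rdot (Om - z) Om.
  rewrite (_ : (fun k => _) = (fun k => rdot (Om - iter k (fun f => f - s%:C *: S (T f)) Om) Om)).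
    by apply: hcv_rdot; apply: hcvB hz; apply: hcv_cst.
  by apply/funext => k; rewrite -rdot_suml (sum_range_seq s).
rewrite (cvg_unique (@norm_hausdorff _ _) h1 h2).
rewrite rdotBl rdotxx (nr_Om hM hab hK) expr1n; congr (_ - _).
have /eqP := zP z dz; rewrite rdotBl subr_eq0 => /eqP.
by rewrite rdotxx rdotC.
Qed.

End SteinDimension.

Theorem theorem4p3 (R : realType) (H : hilbertType R)
    (M : set (H -> H)) (tau : (H -> H) -> R[i])
    (hM : tracial_vna M tau) (hsep : separable_tracial M tau)
    (hab : abelian_alg M)
    (K : hilbertType R) (pi : (H -> H) -> (H -> H) -> K -> K) (Om : K)
    (hK : is_L2_tensor M tau pi Om)
    (A : set (H -> H)) (hA : unital_star_alg A) (hAM : weakly_dense A M)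
    (n : nat) (X : 'I_n -> H -> H) (hX : self_adjoint_family X)
    (hgen : generates X A) :
  ((free_stein_dim A tau pi Om X)%:E =
     1 - \esum_(p in minimal_projections M) ((complex.Re (tau p)) ^+ 2)%:E)%E.
Proof.
have [z [dz zP dimE]] := vN_dim_inner_closure hM hab hK hA hAM hgen.
rewrite (esum_minimal hM hab hK hA hAM dz zP).
by rewrite /free_stein_dim (phiX_Der_1x1_closure hM hab hK hA hAM hgen) dimE EFinB.
Qed.
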